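(* Let $k$ be an algebraically closed field, $\Lambda=kQ/\langle\rho\rangle$ a basic finite-dimensional $k$-algebra given by a quiver $Q$ with vertices $1,\ldots,n$ and admissible relations $\rho$, and let $E=\{e_1,\ldots,e_n\}$ be the trivial paths. Let $\mathbf{c}=(c_1,\ldots,c_d)\in E^d$, let $\mu,\nu\in T_{\mathbf{c}}(\Lambda)$, and let $M_1\xrightarrow{i_1}\cdots\xrightarrow{i_{d-1}}M_d$ and $N_1\xrightarrow{j_1}\cdots\xrightarrow{j_{d-1}}N_d$ be the composition series corresponding to $\mu$ and $\nu$. Then $\nu\in\overline{N_{U_d(k)}(T_{\mathbf{c}}(\Lambda))*\mu}$ (Zariski closure of the orbit) if and only if there exist $\Lambda$-modules $X_1,\ldots,X_d$, homomorphisms $h_l:X_l\to X_{l+1}$ ($1\leq l\leq d-1$), and short exact sequences $0\to X_l\xrightarrow{a_l}X_l\oplus M_l\xrightarrow{b_l}N_l\to 0$ ($1\leq l\leq d$) such that $\begin{pmatrix}h_l&0\\0&i_l\end{pmatrix}a_l=a_{l+1}h_l$ and $j_lb_l=b_{l+1}\begin{pmatrix}h_l&0\\0&i_l\end{pmatrix}$ for all $1\leq l\leq d-1$.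
   Context: A $d$-dimensional representation of $\Lambda$ is a $k$-algebra homomorphism $\rho:\Lambda\to M_d(k)$, corresponding to the module structure $\lambda\cdot v=\rho(\lambda)v$ on $k^d$. It is triangular if all $\rho(\lambda)$ are upper triangular; $T_d(\Lambda)$ is the variety of triangular $d$-dimensional representations. For $\mathbf{c}\in E^d$ and $1\leq i\leq n$ let $A_i^{\mathbf{c}}$ be the diagonal $d\times d$ matrix whose $j$-th diagonal entry is $1$ if $c_j=e_i$ and $0$ otherwise, and let $T_{\mathbf{c}}(\Lambda)=\{\mu\in T_d(\Lambda)\mid \mu(e_i)=A_i^{\mathbf{c}}\text{ for all }i\}$. $U_d(k)$ is the group of invertible upper triangular matrices acting by conjugation $(g*\mu)(\lambda)=g\mu(\lambda)g^{-1}$, and $N_{U_d(k)}(T_{\mathbf{c}}(\Lambda))=\{g\in U_d(k)\mid g*T_{\mathbf{c}}(\Lambda)=T_{\mathbf{c}}(\Lambda)\}$ is its normalizer. The composition series corresponding to a triangular $\mu$: $M_d$ is $k^d$ with the module structure from $\mu$, $M_i\subseteq M_d$ is the submodule spanned by the first $i$ unit vectors, and $i_l:M_l\hookrightarrow M_{l+1}$ are the inclusions. *)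

(* Defs.v *)
From HB Require Import structures.
From mathcomp Require Import all_boot all_order all_algebra all_field.
From mathcomp Require Import mpoly.
Set Implicit Arguments. Unset Strict Implicit. Unset Printing Implicit Defensive.
Import Order.TTheory GRing.Theory Num.Theory.
Local Open Scope ring_scope.

Section Defs.
Variable K : fieldType.
Variable L : falgType K.

(* A complete set of pairwise orthogonal primitive idempotents e_1..e_n of a
   basic algebra (the images of the trivial paths of the quiver). *)
Definition primitive_idem (f : L) :=
  f * f = f /\ f != 0 /\
  forall g : L, g * g = g -> g * f = g -> f * g = g -> g = 0 \/ g = f.

Definition basic_idempotents (n : nat) (e : 'I_n -> L) :=
  [/\ forall i, primitive_idem (e i),
      forall i j, i != j -> e i * e j = 0,
      \sum_(i < n) e i = 1 &
      (* e_i Lambda and e_j Lambda are non-isomorphic for i <> j *)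
      forall i j, i != j -> ~ exists u v : L,
        [/\ u = e i * u * e j, v = e j * v * e i, u * v = e i & v * u = e j]].

(* An m-dimensional representation: a k-algebra homomorphism L -> M_m(k);
   the module structure on column vectors is  lam . v = rho lam *m v. *)
Definition is_rep (m : nat) (rho : L -> 'M[K]_m) :=
  [/\ forall (a : K) (x y : L), rho (a *: x + y) = a *: rho x + rho y,
      forall x y : L, rho (x * y) = rho x *m rho y &
      rho 1 = 1%:M].

Definition is_hom m m' (X : L -> 'M[K]_m) (Y : L -> 'M[K]_m') (f : 'M[K]_(m', m)) :=
  forall lam : L, f *m X lam = Y lam *m f.

Definition rep_dsum m m' (X : L -> 'M[K]_m) (Y : L -> 'M[K]_m') : L -> 'M[K]_(m + m') :=
  fun lam => block_mx (X lam) 0 0 (Y lam).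

Definition short_exact m1 m2 m3 (X : L -> 'M[K]_m1) (Y : L -> 'M[K]_m2)
    (Z : L -> 'M[K]_m3) (a : 'M[K]_(m2, m1)) (b : 'M[K]_(m3, m2)) :=
  [/\ is_hom X Y a, is_hom Y Z b,
      (forall w : 'cV[K]_m1, a *m w = 0 -> w = 0),
      (forall u : 'cV[K]_m3, exists v, b *m v = u) &
      (forall v : 'cV[K]_m2, b *m v = 0 <-> exists w, v = a *m w)].

Definition upper_tri d (A : 'M[K]_d) := forall i j : 'I_d, (j < i)%N -> A i j = 0.

Definition triangular_rep d (mu : L -> 'M[K]_d) :=
  is_rep mu /\ forall lam, upper_tri (mu lam).

Definition Amx n d (c : 'I_d -> 'I_n) (i : 'I_n) : 'M[K]_d :=
  \matrix_(j < d, j' < d) (if j == j' then (c j == i)%:R else 0).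

Definition Tc n d (e : 'I_n -> L) (c : 'I_d -> 'I_n) (mu : L -> 'M[K]_d) :=
  triangular_rep mu /\ forall i, mu (e i) = Amx c i.

Definition Ud d (g : 'M[K]_d) := upper_tri g /\ g \in unitmx.
Definition conj_act d (g : 'M[K]_d) (mu : L -> 'M[K]_d) : L -> 'M[K]_d :=
  fun lam => g *m mu lam *m invmx g.

Definition normalizer_Tc n d (e : 'I_n -> L) (c : 'I_d -> 'I_n) (g : 'M[K]_d) :=
  [/\ Ud g,
      (forall mu, Tc e c mu -> Tc e c (conj_act g mu)) &
      (forall nu, Tc e c nu -> exists2 mu, Tc e c mu & nu =1 conj_act g mu)].

Definition coord_index d := ('I_(\dim {: L}) * 'I_d * 'I_d)%type.
Definition coords d (mu : L -> 'M[K]_d) : 'I_#|{: coord_index d}| -> K :=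
  fun k => let: (r, i, j) := enum_val k in mu (tnth (vbasis fullv) r) i j.

Definition zariski_closure d (S : (L -> 'M[K]_d) -> Prop) (nu : L -> 'M[K]_d) :=
  forall p : {mpoly K[#|{: coord_index d}|]},
    (forall mu, S mu -> p.@[coords mu] = 0) -> p.@[coords nu] = 0.

Definition orbit_N n d (e : 'I_n -> L) (c : 'I_d -> 'I_n) (mu : L -> 'M[K]_d) :=
  fun nu : L -> 'M[K]_d => exists2 g, normalizer_Tc e c g & nu =1 conj_act g mu.

(* M_l: the submodule spanned by the first l unit vectors, i.e. the top-left
   l x l blocks of mu (for l <= d). *)
Definition mxnat d (A : 'M[K]_d) (i j : nat) : K :=
  match insub i, insub j with Some i', Some j' => A i' j' | _, _ => 0 end.
Definition sub_rep d (mu : L -> 'M[K]_d) (l : nat) : L -> 'M[K]_l :=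
  fun lam => \matrix_(i < l, j < l) mxnat (mu lam) i j.

Definition incl_mx (l : nat) : 'M[K]_(l.+1, l) :=
  \matrix_(i < l.+1, j < l) (i == j :> nat)%:R.

End Defs.

(* Main.v *)
(* Given the sequences, put a_{l,t} = a_l + t (1; 0).  For generic t the cokernel of a_{d,t}, read
   off on a fixed complement of the image of a_d, is isomorphic to M_d, and at t = 0 it is N_d.
   Choosing the complement through compatible lifts of the unit vectors makes the isomorphism
   upper triangular and commuting with the A_i, so this line through nu lies in the orbit of mu
   except for finitely many t.

   Conversely, the orbit is parametrised by the entries of a triangular matrix, and a point of its
   closure is reached along a curve.  The curve is obtained by restricting a Noether normalization
   to a generic line through the origin, and the limit along it is taken at a K-valued place,
   encoded by its maximal ideal M: a nonunital K-subalgebra of the function field, maximal among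
   those not containing 1.  Truncating power series in a uniformizer gives a triangular polynomial
   matrix g such that g mu g^-1 is defined at X = 0 with value nu.  Zwara's construction then
   applies: for s > ord_X (det g), X_l is the image of K[X]^l under adj g modulo X^s, a_l is
   multiplication by X, and the coefficient of X^s supplies M_l. *)
Require Import Defs.
From HB Require Import structures.
From mathcomp Require Import all_boot all_order all_algebra all_field.
From mathcomp Require Import perm mpoly ring.
From mathcomp Require boolp classical_sets.
Set Implicit Arguments. Unset Strict Implicit. Unset Printing Implicit Defensive.
Import Order.TTheory GRing.Theory Num.Theory.
Local Open Scope ring_scope.

(** * Places *)

(** The limit along the curve has to be [nu] and not another point of the fibre of the Noether
    normalization over the origin, and the determinant must not vanish identically on the curve. For
    the first, a single element [x], integral over the polynomial ring, is built so that its
    smallness forces every coordinate to be small. Polynomial rings being integrally closed, the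
    minimal polynomial of [x] has polynomial coefficients; its constant term vanishes at the origin,
    so over every line through the origin it has a root in the maximal ideal of the place. This is
    the going-down argument, and the reason why integral closedness is developed. For the second,
    nonvanishing of the determinant is pushed down to that of one polynomial, which only restricts
    the direction of the line. Fields are enlarged by finite extensions only, never by an algebraic
    closure: the degree over K(t) bounds the ramification of the place, which makes it discrete and
    provides the uniformizer. *)

Section Place.
Variables (K : closedFieldType) (E : fieldType) (i : {rmorphism K -> E}).
Implicit Types (M : E -> Prop).

Definition proper_subalg M :=
  [/\ M 0, forall x y, M x -> M y -> M (x + y),
      forall x y, M x -> M y -> M (x * y),
      forall c x, M x -> M (i c * x) & ~ M 1].

(** The alternatives say that [z] is finite with residue [c], or that its inverse is small. That the
    residue field is [K] is thus built in. *)
Definition is_place M :=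
  proper_subalg M /\ forall z, (exists c, M (z - i c)) \/ M z^-1.

Lemma proper_subalg_maximal M : proper_subalg M ->
  exists N, [/\ proper_subalg N, forall x, M x -> N x &
    forall N', proper_subalg N' -> (forall x, N x -> N' x) -> forall x, N' x -> N x].
Proof.
move=> hM.
(* Zorn is applied to [N] through its union with [M], so that the empty chain, whose union is empty,
   also satisfies the predicate. *)
pose P := (fun N : classical_sets.set E => proper_subalg (fun x => N x \/ M x)).
have [A [PA maxA]] : exists A : classical_sets.set E, P A /\
    forall B, classical_sets.proper A B -> ~ P B.
  apply: classical_sets.Zorn_bigcup => C CP Ctot.
  have two (x y : E) : (classical_sets.bigcup C id x \/ M x) ->
      (classical_sets.bigcup C id y \/ M y) ->
      exists2 N, (N = M \/ C N) & ((N x \/ M x) /\ (N y \/ M y)).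
    move=> [[N1 CN1 N1x]|Mx] [[N2 CN2 N2y]|My].
    - case: (Ctot _ _ CN1 CN2) => sub; [exists N2|exists N1]; try (by right).
        by split; left=> //; apply: sub.
      by split; left=> //; apply: sub.
    - by exists N1; [right|split; [left|right]].
    - by exists N2; [right|split; [right|left]].
    - by exists M; [left|split; right].
  have sub N x : (N = M \/ C N) -> N x \/ M x ->
      classical_sets.bigcup C id x \/ M x.
    move=> [->|CN]; first by case; right.
    by case=> [Nx|]; [left; exists N|right].
  have PN N : (N = M \/ C N) -> P N.
    case=> [->|/CP//]; rewrite /P; case: hM => h0 hD hM hZ h1.
    by split; [left|move=> x y [] h [] h'; left; apply: hD
      |move=> x y [] h [] h'; left; apply: hM
      |move=> c x [] h; left; apply: hZ|case=> /h1].
  split.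
  - by right; case: hM.
  - move=> x y hx hy; have [N hN [hx' hy']] := two _ _ hx hy.
    by apply: (sub _ _ hN); have [_ + _ _ _] := PN _ hN; apply.
  - move=> x y hx hy; have [N hN [hx' hy']] := two _ _ hx hy.
    by apply: (sub _ _ hN); have [_ _ + _ _] := PN _ hN; apply.
  - move=> c x hx; have [N hN [hx' _]] := two _ _ hx hx.
    by apply: (sub _ _ hN); have [_ _ _ + _] := PN _ hN; apply.
  - move=> h; have [N hN [hx' _]] := two _ _ h h.
    by have [_ _ _ _ +] := PN _ hN; apply.
have MA x : M x -> A x.
  move=> Mx; case: (boolp.EM (A x)) => // nAx; exfalso.
  apply: (maxA (fun x => A x \/ M x)).
    split; first by move=> z; left.
    by move=> /(_ x (or_intror Mx)).
  move: PA; rewrite /P => -[h0 hD hMM hZ h1].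
  split.
  - by left.
  - by move=> a b ha hb; left; apply: hD; tauto.
  - by move=> a b ha hb; left; apply: hMM; tauto.
  - by move=> c a ha; left; apply: hZ; tauto.
  - by tauto.
have AE x : (A x \/ M x) -> A x by case=> //; apply: MA.
have hA : proper_subalg A.
  move: PA; rewrite /P => -[h0 hD hMM hZ h1]; split.
  - exact: AE.
  - by move=> a b ha hb; apply: AE; apply: hD; left.
  - by move=> a b ha hb; apply: AE; apply: hMM; left.
  - by move=> c a ha; apply: AE; apply: hZ; left.
  - by move=> h; apply: h1; left.
exists A; split => // N' hN' sub x N'x.
case: (boolp.EM (A x)) => // nAx; exfalso; apply: (maxA N').
  by split=> // /(_ _ N'x).
rewrite /P; case: hN' => h0 hD hMM hZ h1.
have E' y : (N' y \/ M y) -> N' y by case=> // /MA/sub.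
split; [by left|by move=> a b /E' ha /E' hb; left; apply: hD
  |by move=> a b /E' ha /E' hb; left; apply: hMM|by move=> c a /E' ha; left; apply: hZ|].
by move/E'.
Qed.

Section Subalg.
Variable M : E -> Prop.
Hypothesis hM : proper_subalg M.

Lemma subalg0 : M 0. Proof. by case: hM. Qed.
Lemma subalgD x y : M x -> M y -> M (x + y). Proof. by case: hM => _ + _ _ _; apply. Qed.
Lemma subalgM x y : M x -> M y -> M (x * y). Proof. by case: hM => _ _ + _ _; apply. Qed.
Lemma subalgZ c x : M x -> M (i c * x). Proof. by case: hM => _ _ _ + _; apply. Qed.
Lemma subalg1 : ~ M 1. Proof. by case: hM. Qed.
Lemma subalgN x : M x -> M (- x).
Proof. by move=> /(subalgZ (-1)); rewrite rmorphN1 mulN1r. Qed.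
Lemma subalgB x y : M x -> M y -> M (x - y).
Proof. by move=> hx hy; apply: subalgD => //; apply: subalgN. Qed.
Lemma subalg_sum I (r : seq I) (P : pred I) (G : I -> E) :
  (forall j, P j -> M (G j)) -> M (\sum_(j <- r | P j) G j).
Proof. by move=> h; elim/big_ind: _ => //; [apply: subalg0|apply: subalgD]. Qed.
Lemma subalgX x n : M x -> M (x ^+ n.+1).
Proof.
move=> hx; elim: n => [|n IH]; first by rewrite expr1.
by rewrite exprS; apply: subalgM.
Qed.
Lemma subalgC c : M (i c) -> c = 0.
Proof.
move=> h; apply/eqP; apply: contra_notT subalg1 => c0.
by move: (subalgZ c^-1 h); rewrite -rmorphM mulVf // rmorph1.
Qed.

(* [i K + M], a valuation ring with maximal ideal [M] and residue field [K] when [M] is a place. *)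
Definition local_ring x := exists c, M (x - i c).

Lemma local_ringC c : local_ring (i c).
Proof. by exists c; rewrite subrr; apply: subalg0. Qed.
Lemma local_ring0 : local_ring 0. Proof. by rewrite -(rmorph0 i); apply: local_ringC. Qed.
Lemma local_ring1 : local_ring 1. Proof. by rewrite -(rmorph1 i); apply: local_ringC. Qed.
Lemma subalg_local x : M x -> local_ring x.
Proof. by exists 0; rewrite rmorph0 subr0. Qed.
Lemma local_ringD x y : local_ring x -> local_ring y -> local_ring (x + y).
Proof.
move=> [c hc] [c' hc']; exists (c + c').
by rewrite rmorphD opprD addrACA; apply: subalgD.
Qed.
Lemma subalgMl x y : local_ring x -> M y -> M (x * y).
Proof.
move=> [c hc] hy; rewrite -(subrK (i c) x) mulrDl.
by apply: subalgD; [apply: subalgM|apply: subalgZ].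
Qed.
Lemma subalgMr x y : M x -> local_ring y -> M (x * y).
Proof. by move=> hx hy; rewrite mulrC; apply: subalgMl. Qed.
Lemma local_ringM x y : local_ring x -> local_ring y -> local_ring (x * y).
Proof.
move=> hx [c hc]; rewrite -(subrK (i c) y) mulrDr; apply: local_ringD.
  by apply: subalg_local; apply: subalgMl.
case: hx => c' hc'; exists (c' * c); rewrite rmorphM -mulrBl mulrC.
exact: subalgZ.
Qed.
Lemma local_ringN x : local_ring x -> local_ring (- x).
Proof.
by move=> h; rewrite -mulN1r -(rmorphN1 i); apply: local_ringM => //; apply: local_ringC.
Qed.
Lemma local_ringB x y : local_ring x -> local_ring y -> local_ring (x - y).
Proof. by move=> hx hy; apply: local_ringD => //; apply: local_ringN. Qed.
Lemma local_ringX x n : local_ring x -> local_ring (x ^+ n).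
Proof.
move=> hx; elim: n => [|n IH]; first exact: local_ring1.
by rewrite exprS; apply: local_ringM.
Qed.
Lemma local_ring_sum I (r : seq I) (P : pred I) (G : I -> E) :
  (forall j, P j -> local_ring (G j)) -> local_ring (\sum_(j <- r | P j) G j).
Proof. by move=> h; elim/big_ind: _ => //; [apply: local_ring0|apply: local_ringD]. Qed.
Lemma local_ring_prod I (r : seq I) (P : pred I) (G : I -> E) :
  (forall j, P j -> local_ring (G j)) -> local_ring (\prod_(j <- r | P j) G j).
Proof. by move=> h; elim/big_ind: _ => //; [apply: local_ring1|apply: local_ringM]. Qed.
Lemma subalg_prime x y : local_ring x -> local_ring y -> M (x * y) -> M x \/ M y.
Proof.
move=> [c hc] [c' hc'] hxy.
have /subalgC/eqP : M (i (c * c')).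
  have -> : i (c * c') = x * y - (x - i c) * y - i c * (y - i c').
    by rewrite rmorphM; ring.
  apply: subalgB; last exact: subalgZ.
  by apply: subalgB => //; apply: subalgMr => //; exists c'.
rewrite mulf_eq0 => /orP[] /eqP z; [left|right].
  by move: hc; rewrite z rmorph0 subr0.
by move: hc'; rewrite z rmorph0 subr0.
Qed.

Lemma subalg_prime_prod (I : eqType) (r : seq I) (G : I -> E) :
  (forall j, j \in r -> local_ring (G j)) -> M (\prod_(j <- r) G j) ->
  exists2 j, j \in r & M (G j).
Proof.
elim: r => [|a r IH] hG; first by rewrite big_nil => /subalg1.
rewrite big_cons => /subalg_prime[||h|h].
- by apply: hG; rewrite mem_head.
- rewrite big_seq; apply: local_ring_prod => j jr; apply: hG.
  by rewrite in_cons jr orbT.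
- by exists a; rewrite ?mem_head.
- have [|j jr hj] := IH _ h; first by move=> j jr; apply: hG; rewrite in_cons jr orbT.
  by exists j => //; rewrite in_cons jr orbT.
Qed.

End Subalg.

Section Maximal.
Variable M : E -> Prop.
Hypothesis hM : proper_subalg M.
Hypothesis maxM : forall N, proper_subalg N -> (forall x, M x -> N x) ->
  forall x, N x -> M x.

(** This says that [1] lies in [M[z]], all coefficients being in [M], with a witness of degree at
    most [n]; the degree is what the argument below decreases. *)
Let MP z n := exists p : {poly E}, [/\ 1 = p.[z], (size p <= n.+1)%N & forall j, M p`_j].

(** Otherwise the polynomials in [z] with coefficients in [M] form a proper subalgebra containing
    [M], so by maximality they lie in [M]. *)
Let no_relation z : ~ (exists n, MP z n) -> forall x, M x -> M (z * x).
Proof.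
move=> no.
pose N x := exists p : {poly E}, x = p.[z] /\ forall j, M p`_j.
have hN : proper_subalg N.
  split.
  - by exists 0; rewrite horner0; split=> // j; rewrite coef0; apply: subalg0.
  - move=> _ _ [p [-> hp]] [q [-> hq]]; exists (p + q); rewrite hornerD; split=> // j.
    by rewrite coefD; apply: subalgD.
  - move=> _ _ [p [-> hp]] [q [-> hq]]; exists (p * q); rewrite hornerM; split=> // j.
    by rewrite coefM; apply: subalg_sum => // k _; apply: subalgM.
  - move=> c _ [p [-> hp]]; exists (i c *: p); rewrite hornerZ; split=> // j.
    by rewrite coefZ; apply: subalgZ.
  - by move=> [p [h hp]]; apply: no; exists (size p), p; split.
have sub x : M x -> N x.
  move=> Mx; exists x%:P; rewrite hornerC; split=> // j; rewrite coefC.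
  by case: ifP => // _; apply: subalg0.
move=> x Mx; apply: (maxM hN sub); exists (x *: 'X); rewrite hornerZ hornerX mulrC.
split=> // j; rewrite coefZ coefX; case: eqP => _; rewrite ?mulr1 ?mulr0 //.
exact: subalg0.
Qed.

(** Here [M] is an ideal of [K[z] + M], and maximality makes the quotient a field generated by [z]
    over [K]. Such a field is algebraic, hence equal to the algebraically closed [K]. *)
Let stable_local z : (forall x, M x -> M (z * x)) -> local_ring M z.
Proof.
move=> stab.
have stabX n x : M x -> M (z ^+ n * x).
  by elim: n => [|n IH] hx; rewrite ?mul1r // exprS -mulrA; apply/stab/IH.
pose ev (p : {poly K}) := (map_poly i p).[z].
have evM (p : {poly K}) x : M x -> M (ev p * x).
  move=> Mx; rewrite /ev horner_coef mulr_suml; apply: subalg_sum => // j _.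
  by rewrite coef_map -mulrA; apply: subalgZ => //; apply: stabX.
have adj (p : {poly K}) : M (ev p) \/ exists q : {poly K}, M (1 - ev p * ev q).
  case: (boolp.EM (M (ev p))) => [|nMp]; first by left.
  right.
  pose N x := exists (q : E) (r : {poly K}), M q /\ x = q + ev p * ev r.
  case: (boolp.EM (proper_subalg N)) => [hN|nN].
    exfalso; apply: nMp; apply: (maxM hN).
      by move=> x Mx; exists x, 0; rewrite /ev rmorph0 horner0 mulr0 addr0.
    by exists 0, 1; rewrite /ev rmorph1 hornerC mulr1 add0r; split=> //; apply: subalg0.
  case: (boolp.EM (N 1)) => [[q [r [Mq h]]]|N1].
    by exists r; rewrite h addrK.
  exfalso; apply: nN; split=> //.
  - by exists 0, 0; rewrite /ev rmorph0 horner0 mulr0 addr0; split=> //; apply: subalg0.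
  - move=> _ _ [q [r [Mq ->]]] [q' [r' [Mq' ->]]]; exists (q + q'), (r + r').
    split; first exact: subalgD.
    by rewrite /ev rmorphD hornerD mulrDr addrACA.
  - move=> _ _ [q [r [Mq ->]]] [q' [r' [Mq' ->]]].
    exists (q * q' + ev (p * r) * q' + ev (p * r') * q), (r * p * r').
    split; first by apply: subalgD; [|apply: subalgD; [|apply: subalgM|apply: evM]|apply: evM].
    by rewrite /ev !rmorphM !hornerM; ring.
  - move=> c _ [q [r [Mq ->]]]; exists (i c * q), (c *: r); split; first exact: subalgZ.
    by rewrite /ev linearZ hornerZ /=; ring.
(* Algebraicity of [z] modulo [M]: if [z] is not in [M], it has an inverse given by some [q], and
   [1 - 'X * q] is nonzero because of its constant term. *)
have [p p0 Mp] : exists2 p : {poly K}, p != 0 & M (ev p).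
  have [|[q hq]] := adj 'X; first by exists 'X; rewrite ?polyX_eq0.
  exists (1 - 'X * q); last by rewrite /ev rmorphB rmorphM rmorph1 !hornerE.
  by apply/eqP => /polyP/(_ 0); rewrite coefB coef1 coefXM coef0 subr0 => /eqP; rewrite oner_eq0.
rewrite -size_poly_gt0 in p0; move: Mp p0.
have [n] := ubnP (size p); elim: n p => // n IH p sp Mp sp0.
have [/eqP/size_poly1P[c c0 pE]|sp1] := eqVneq (size p) 1.
  by move: Mp; rewrite pE /ev map_polyC hornerC => /(subalgC hM)/eqP; rewrite (negbTE c0).
have [c rc] := closed_rootP _ sp1.
have /factor_theorem[q pE] := rc.
have q0 : q != 0 by apply: contraTneq sp0 => q0; rewrite pE q0 mul0r size_poly0.
have [|[r hr]] := adj ('X - c%:P).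
  by move=> h; exists c; move: h; rewrite /ev rmorphB /= map_polyX map_polyC !hornerE.
apply: (IH q); last by rewrite size_poly_gt0.
  by move: sp; rewrite pE size_Mmonic ?monicXsubC // size_XsubC addn2.
have -> : ev q = ev q * (1 - ev ('X - c%:P) * ev r) + ev r * ev p.
  by rewrite pE /ev !rmorphM !hornerM; ring.
by apply: subalgD => //; apply: evM.
Qed.

(** Chevalley's argument: [1] cannot lie in both [M[z]] and [M[z^-1]], since the longer of two
    relations can always be shortened by means of the other. *)
Lemma maximal_subalg_place : is_place M.
Proof.
split=> // z.
have [->|z0] := eqVneq z 0; first by left; exists 0; rewrite rmorph0 subr0; apply: subalg0.
case: (boolp.EM (exists n, MP z n)) => [rz|/no_relation/stable_local[c hc]]; last first.
  by left; exists c.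
case: (boolp.EM (exists n, MP z^-1 n)) => [rz'|/no_relation/stable_local[c hc]]; last first.
  have [c0|c0] := eqVneq c 0; first by right; move: hc; rewrite c0 rmorph0 subr0.
  (* Multiplied by [z^-1 ^+ n], the relation puts a power of [z^-1] into [M], against its nonzero
     residue [c]. *)
  exfalso; case: rz => n [p [h sp Mp]].
  have {}h : (z^-1) ^+ n = \sum_(j < n.+1) p`_j * z^-1 ^+ (n - j).
    rewrite -[LHS]mulr1 h (horner_coef_wide _ sp) mulr_sumr; apply: eq_bigr => j _.
    rewrite mulrCA; congr (_ * _).
    by rewrite -{1}(subnK (leq_ord j)) exprD -mulrA -exprMn mulVf // expr1n mulr1.
  have lz : local_ring M z^-1 by exists c.
  have : M ((z^-1) ^+ n).
    by rewrite h; apply: subalg_sum => // j _; apply: subalgMr => //; apply: local_ringX.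
  have prime : forall k, M (z^-1 ^+ k) -> False.
    elim=> [|k IH]; first by rewrite expr0 => /(subalg1 hM).
    rewrite exprS => /(subalg_prime hM lz (local_ringX hM k lz))[] // h1.
    move: (subalgB hM h1 hc); rewrite opprB addrCA subrr addr0 => /(subalgC hM)/eqP.
    by rewrite (negbTE c0).
  exact: prime.
exfalso.
suff key : forall n (w : E), w != 0 -> MP w n -> forall m, MP w^-1 m -> (m <= n)%N ->
    exists2 n', (n' < n)%N & MP w n'.
  have all : forall s n m (w : E), (n + m < s)%N -> w != 0 -> MP w n -> MP w^-1 m -> False.
    elim=> // s IH n m w lts w0 hn hm.
    case: (leqP m n) => le.
      have [n' lt' h'] := key n w w0 hn m hm le.
      by apply: (IH n' m w) => //; rewrite -ltnS; apply: leq_trans lts; rewrite ltnS ltn_add2r.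
    have hn' : MP (w^-1)^-1 n by rewrite invrK.
    have [|n' lt' h'] := key m w^-1 _ hm n hn' (ltnW le); first by rewrite invr_eq0.
    by apply: (IH n n' w) => //; rewrite -ltnS; apply: leq_trans lts; rewrite ltnS ltn_add2l.
  by case: rz rz' => n hn [m hm]; apply: (all (n + m).+1 n m z).
move=> n w w0 [p [hp sp Mp]] m [q [hq sq Mq]] le.
case: n le sp => [|n] le sp.
  have : M 1 by rewrite hp [p]size1_polyC // hornerC.
  by move/(subalg1 hM).
exists n => //.
have q1 : 1 - q`_0 = \sum_(j < m) q`_j.+1 * w^-1 ^+ j.+1.
  rewrite {1}hq (horner_coef_wide _ sq) big_ord_recl expr0 mulr1 addrAC subrr add0r.
  by apply: eq_bigr => j _.
(* In [(1 - q_0) p(w)] the top term is rewritten with [1 - q_0 = sum_j q_(j+1) w^-(j+1)]; all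
   exponents stay nonnegative because [m] is at most the degree of [p]'s relation. *)
pose r := polyC (q`_0) + (1 - q`_0) *: (p - (p`_n.+1) *: 'X^(n.+1))
   + \sum_(j < m) (p`_n.+1 * q`_j.+1) *: 'X^(n.+1 - j.+1).
exists r; split.
- rewrite /r hornerD hornerD hornerC hornerZ hornerD hornerN hornerZ hornerXn.
  rewrite -{}hp.
  rewrite horner_sum.
  have -> : \sum_(j < m) ((p`_n.+1 * q`_j.+1) *: 'X^(n.+1 - j.+1)).[w]
     = p`_n.+1 * w ^+ n.+1 * (1 - q`_0).
    rewrite q1 mulr_sumr; apply: eq_bigr => j _; rewrite hornerZ hornerXn.
    have lj : (j.+1 <= n.+1)%N by apply: leq_trans le.
    have -> : w ^+ n.+1 = w ^+ (n.+1 - j.+1) * w ^+ j.+1 by rewrite -exprD subnK.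
    rewrite exprVn.
    have : w ^+ j.+1 != 0 by rewrite expf_neq0.
    by move=> wj; field.
  ring.
- apply/leq_sizeP => j lj; rewrite /r !coefD coefC coefZ coefD coefN coefZ coefXn coef_sum.
  rewrite (_ : j == 0 = false); last by case: j lj.
  rewrite add0r big1 ?addr0 => [|k _]; last first.
    rewrite coefZ coefXn (_ : j == _ = false) ?mulr0 //.
    by apply/negbTE; rewrite neq_ltn orbC (leq_trans _ lj) // ltnS subSS leq_subr.
  case: eqP => [->|/eqP jn]; first by rewrite mulr1 subrr mulr0.
  rewrite mulr0 subr0 [p`_j]nth_default ?mulr0 //.
  by apply: leq_trans sp _; rewrite ltn_neqAle eq_sym jn lj.
- move=> j; rewrite /r !coefD coefC coefZ coefD coefN coefZ coefXn coef_sum.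
  apply: subalgD => //; first apply: subalgD => //.
  + by case: eqP => // _; apply: subalg0.
  + rewrite mulrBl mul1r; apply: subalgB => //.
      apply: subalgB => //; case: eqP => _; rewrite ?mulr1 ?mulr0 //; exact: subalg0.
    apply: subalgM => //; apply: subalgB => //.
    case: eqP => _; rewrite ?mulr1 ?mulr0 //; exact: subalg0.
  + apply: subalg_sum => // k _; rewrite coefZ coefXn.
    case: eqP => _; rewrite ?mulr1 ?mulr0; [exact: subalgM|exact: subalg0].
Qed.

End Maximal.

Lemma place_exists M : proper_subalg M ->
  exists2 N, is_place N & forall x, M x -> N x.
Proof.
move=> /proper_subalg_maximal[N [hN sub maxN]]; exists N => //.
exact: maximal_subalg_place.
Qed.

Section PlaceTheory.
Variable M : E -> Prop.
Hypothesis pM : is_place M.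
Let hM : proper_subalg M := proj1 pM.

Lemma place_cases z : local_ring M z \/ M z^-1.
Proof. by case: pM => _; apply. Qed.

(** If [z] had a pole, the equation divided by the top power of [z] would put [1] into [M]. *)
Lemma place_integral z p : p \is monic -> root p z -> (forall j, local_ring M p`_j) ->
  local_ring M z.
Proof.
move=> mp /eqP rz lp.
have [->|z0] := eqVneq z 0; first exact: local_ring0.
case: (place_cases z) => // Mz; exfalso; apply: (subalg1 hM).
case sp : (size p) => [|n]; first by move: (monic_neq0 mp); rewrite -size_poly_eq0 sp.
have lead : p`_n = 1 by move/monicP: mp; rewrite lead_coefE sp.
move: rz; rewrite horner_coef sp big_ord_recr /= lead mul1r => /eqP.
rewrite addrC addr_eq0 => /eqP/(congr1 (fun x => x * z^-1 ^+ n)).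
rewrite -exprMn mulfV // expr1n => ->.
rewrite mulNr mulr_suml; apply: subalgN => //; apply: subalg_sum => // j _.
rewrite -mulrA; apply: subalgMl => //.
have lj : (j <= n)%N by apply: ltnW.
rewrite -{2}(subnK lj) exprD mulrCA -exprMn mulfV // expr1n mulr1.
by rewrite -(subnSK (ltn_ord j)); apply: subalgX.
Qed.

End PlaceTheory.
End Place.

(** * Discreteness of places of finite degree over K(t) *)

Section Discrete.
Variables (K : closedFieldType) (E : fieldType) (i : {rmorphism K -> E}).
Variables (M : E -> Prop) (pM : is_place i M).
Let hM : proper_subalg i M := proj1 pM.
Local Notation O := (local_ring i M).
Local Notation ev p t := (map_poly i p).[t].

(* [E] has dimension at most [D] over its subfield [K(t)]. *)
Definition bounded_rank (t : E) (D : nat) :=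
  forall o : 'I_D.+1 -> E, exists p : 'I_D.+1 -> {poly K},
    (exists k, p k != 0) /\ \sum_k ev (p k) t * o k = 0.

Lemma local_ring_horner (p : {poly K}) x : O x -> O (ev p x).
Proof.
move=> hx; rewrite horner_coef; apply: (local_ring_sum hM) => j _.
by rewrite coef_map; apply: (local_ringM hM); [apply: (local_ringC hM)|apply: (local_ringX hM)].
Qed.

Lemma subalg_horner_sub (p : {poly K}) x : M x -> M (ev p x - i p`_0).
Proof.
move=> hx; elim/poly_ind: p => [|p c _].
  by rewrite rmorph0 horner0 coef0 rmorph0 subrr; apply: (subalg0 hM).
rewrite rmorphD rmorphM /= map_polyX map_polyC !hornerE coefD coefMX coefC /= add0r addrK.
by apply: (subalgMl hM) => //; apply: local_ring_horner; apply: subalg_local.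
Qed.

Lemma polyX_factor_family (D : nat) (p : 'I_D -> {poly K}) : (exists k, p k != 0) ->
  exists2 q : 'I_D -> {poly K}, exists k, (q k)`_0 != 0 &
    exists v, forall k, p k = 'X^v * q k.
Proof.
have [m] := ubnP (\sum_k size (p k)); elim: m p => // m IH p lt [k0 pk0].
case: (boolp.EM (exists k, (p k)`_0 != 0)) => [h|nh].
  by exists p => //; exists 0 => k; rewrite expr0 mul1r.
have p0 k : (p k)`_0 = 0 by apply/eqP; apply: contra_notT nh => h; exists k.
have pX k : exists q, p k = 'X * q.
  have : root (p k) 0 by rewrite rootE horner_coef0 p0.
  by move=> /factor_theorem[q ->]; exists q; rewrite subr0 mulrC.
have [q hq] := boolp.choice pX.
have qk0 : q k0 != 0 by apply: contraNneq pk0 => h; rewrite hq h mulr0.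
have [| |q' hq' [v hv]] := IH q; last first.
- by exists q' => //; exists v.+1 => k; rewrite hq hv exprS mulrA.
- by exists k0.
rewrite -ltnS; apply: leq_trans lt; rewrite ltnS.
rewrite (bigD1 k0) //= [X in (_ < X)%N](bigD1 k0) //= hq mulrC size_mulX // -addSn.
rewrite leq_add2l leq_sum // => k _; rewrite hq mulrC.
by have [->|h] := eqVneq (q k) 0; rewrite ?mul0r // size_mulX.
Qed.

Lemma polyX_factor (p : {poly K}) : p != 0 ->
  exists v q, p = 'X^v * q /\ q`_0 != 0.
Proof.
move=> p0; have [|q [k hk] [v hv]] := @polyX_factor_family 1 (fun=> p).
  by exists 0.
by exists v, (q k); rewrite (hv k).
Qed.

Variables (t : E) (t0 : t != 0) (Mt : M t) (D : nat) (hD : bounded_rank t D).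

(** A common power of [t] is cancelled, so that the coefficients of the relation have residues that
    are not all zero. *)
Lemma bounded_rank_relation (o : 'I_D.+1 -> E) :
  exists p : 'I_D.+1 -> {poly K},
    (exists k, (p k)`_0 != 0) /\ \sum_k ev (p k) t * o k = 0.
Proof.
have [p [hp rel]] := hD o.
have [q hq [v hv]] := polyX_factor_family hp; exists q; split => //.
have tv : t ^+ v != 0 by rewrite expf_neq0.
apply: (mulfI tv); rewrite mulr0 -[RHS]rel mulr_sumr; apply: eq_bigr => k _.
by rewrite hv rmorphM /= map_polyXn hornerM hornerXn mulrA.
Qed.

(** Without a uniformizer there are arbitrarily long chains in [M] of strictly decreasing value
    below [t]. More than [D] such elements would be linearly independent over K(t): this is the
    bound of the ramification index by the degree. *)
Lemma place_uniformizer : exists pi, [/\ pi != 0, M pi & forall x, M x -> O (x / pi)].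
Proof.
apply: boolp.contrapT => no.
have step m : M m -> m != 0 -> exists m', [/\ M m', m' != 0 & M (m / m')].
  move=> Mm m0; apply: boolp.contrapT => no'; apply: no; exists m; split=> // x Mx.
  have [->|x0] := eqVneq x 0; first by rewrite mul0r; apply: (local_ring0 hM).
  case: (place_cases pM (x / m)) => // h; exfalso; apply: no'; exists x; split=> //.
  by rewrite -(invf_div x m).
(* The chain starts at [t] so that [t / s l] lies in [M] for all later [l]; this absorbs the terms
   whose coefficient is divisible by [t]. *)
have {step}chain n : exists s : nat -> E, [/\ s 0 = t,
    forall k, (k <= n)%N -> M (s k) /\ s k != 0 &
    forall k l, (k < l <= n)%N -> M (s k / s l)].
  elim: n => [|n [s [s0 hs hsd]]].
    exists (fun=> t); split=> // k l /andP[kl l0].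
    by move: (leq_trans kl l0).
  have [Mn nn] := hs n (leqnn n); have [m [Mm m0 hm]] := step _ Mn nn.
  exists (fun k => if k == n.+1 then m else s k); split=> //.
    move=> k; rewrite leq_eqVlt; case: eqP => //= _; exact: hs.
  move=> k l /andP[kl]; rewrite leq_eqVlt => /orP[/eqP le|ln]; last first.
    by rewrite !ltn_eqF // ?(ltn_trans kl) //; apply: hsd; rewrite kl -ltnS.
  rewrite le eqxx; rewrite le ltnS in kl; rewrite ltn_eqF //.
  have [->|kn] := eqVneq k n; first by [].
  have : M (s k / s n) by apply: hsd; rewrite ltn_neqAle kn kl leqnn.
  move=> /(subalgM hM)/(_ hm); rewrite mulrA mulfVK //.
have [s [s0 hs hsd]] := chain D.+1.
have [p [hp rel]] := bounded_rank_relation (fun k : 'I_D.+1 => s k.+1).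
(* Among the terms with unit coefficient the last one has the smallest value, so it dominates after
   division by [s k0.+1]. *)
have [k0 hk0 maxk0] : exists2 k0 : 'I_D.+1, (p k0)`_0 != 0 &
    forall k : 'I_D.+1, (k0 < k)%N -> (p k)`_0 = 0.
  case: hp => k hk; case: (arg_maxnP (fun k : 'I_D.+1 => k : nat) (P := fun k => (p k)`_0 != 0) hk).
  move=> k0 hk0 hmax; exists k0 => // l lt; apply/eqP; apply: contraLR lt => /hmax.
  by rewrite -leqNgt.
have [Mk0 nk0] := hs k0.+1 (ltn_ord k0).
suff : M (i (p k0)`_0) by move=> /(subalgC hM)/eqP; rewrite (negbTE hk0).
move: rel => /(congr1 (fun x => x / s k0.+1)); rewrite mul0r mulr_suml (bigD1 k0) //=.
rewrite mulfK // => /eqP; rewrite addr_eq0 => /eqP e.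
rewrite -(subKr (ev (p k0) t) (i _)); apply: (subalgB hM); last exact: subalg_horner_sub.
rewrite e; apply: (subalgN hM); apply: (subalg_sum hM) => k nk.
have Ot : O (ev (p k) t) by apply: local_ring_horner; apply: subalg_local.
have [lt|gt|/val_inj eq] := ltngtP k k0; last by rewrite eq eqxx in nk.
  by rewrite -mulrA; apply: (subalgMl hM) => //; apply: hsd; rewrite ltnS lt /=.
have [q qE] : exists q, p k = q * 'X.
  have : root (p k) 0 by rewrite rootE horner_coef0 maxk0.
  by move=> /factor_theorem[q ->]; exists q; rewrite subr0.
rewrite qE rmorphM /= map_polyX hornerM hornerX.
have -> : ev q t * t * s k.+1 / s k0.+1 = ev q t * (s k.+1 * (s 0 / s k0.+1)).
  by rewrite s0; ring.
apply: (subalgMl hM); first by apply: local_ring_horner; apply: subalg_local.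
apply: (subalgM hM); first by have [] := hs k.+1 (ltn_ord k).
by apply: hsd; apply: ltn_ord.
Qed.

Variables (pi : E) (pi0 : pi != 0) (Mpi : M pi) (divpi : forall x, M x -> O (x / pi)).

Let order_of x : O x -> ~ (forall n, O (x / pi ^+ n)) ->
  exists n, O (x / pi ^+ n) /\ ~ M (x / pi ^+ n).
Proof.
move=> Ox no; apply: boolp.contrapT => no'; apply: no; elim=> [|n IH].
  by rewrite expr0 divr1.
apply: boolp.contrapT => h; apply: no'; exists n; split=> // /divpi.
by rewrite -mulrA -invfM -exprSr.
Qed.

(** If [t] were divisible by every power of [pi], the powers of [pi] up to [D] would be linearly
    independent over K(t). *)
Let order_t : exists e, O (t / pi ^+ e) /\ ~ M (t / pi ^+ e).
Proof.
apply: order_of => [|h]; first exact: subalg_local.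
have [p [hp rel]] := bounded_rank_relation (fun k : 'I_D.+1 => pi ^+ k).
have [k0 hk0 mink0] : exists2 k0 : 'I_D.+1, (p k0)`_0 != 0 &
    forall k : 'I_D.+1, (k < k0)%N -> (p k)`_0 = 0.
  case: hp => k hk; case: (arg_minnP (fun k : 'I_D.+1 => k : nat) (P := fun k => (p k)`_0 != 0) hk).
  move=> k0 hk0 hmax; exists k0 => // l lt; apply/eqP; apply: contraLR lt => /hmax.
  by rewrite -leqNgt.
suff : M (i (p k0)`_0) by move=> /(subalgC hM)/eqP; rewrite (negbTE hk0).
have pk0 : pi ^+ k0 != 0 by rewrite expf_neq0.
move: rel => /(congr1 (fun x => x / pi ^+ k0)); rewrite mul0r mulr_suml (bigD1 k0) //=.
rewrite mulfK // => /eqP; rewrite addr_eq0 => /eqP e.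
rewrite -(subKr (ev (p k0) t) (i _)); apply: (subalgB hM); last exact: subalg_horner_sub.
rewrite e; apply: (subalgN hM); apply: (subalg_sum hM) => k nk.
have [gt|lt|/val_inj eq] := ltngtP k0 k; last by rewrite eq eqxx in nk.
  rewrite -mulrA; apply: (subalgMl hM).
    by apply: local_ring_horner; apply: subalg_local.
  by rewrite -(subnK (ltnW gt)) exprD mulfK // -(subnSK gt); apply: (subalgX hM).
have [q qE] : exists q, p k = q * 'X.
  have : root (p k) 0 by rewrite rootE horner_coef0 mink0.
  by move=> /factor_theorem[q ->]; exists q; rewrite subr0.
rewrite qE rmorphM /= map_polyX hornerM hornerX.
have -> : ev q t * t * pi ^+ k / pi ^+ k0 = ev q t * (t / pi ^+ k0 * pi ^+ k) by ring.
apply: (subalgMl hM); first by apply: local_ring_horner; apply: subalg_local.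
apply: (subalgMr hM); last by apply: (local_ringX hM); apply: subalg_local.
have -> : t / pi ^+ k0 = t / pi ^+ k0.+1 * pi by rewrite exprSr; field; rewrite pi0.
by apply: (subalgMl hM).
Qed.

(** A relation between the powers of [x], divided by one power more than its lowest one, shows that
    [x] divides a nonzero polynomial in [t]. The order [e * v] of that polynomial is known, so [x]
    is not divisible by [pi ^+ (e * v).+1]. *)
Lemma place_order x : x != 0 -> O x -> exists n, O (x / pi ^+ n) /\ ~ M (x / pi ^+ n).
Proof.
move=> x0 Ox; apply: order_of => // h.
have [e [Ou Mu]] := order_t.
have [p [hp rel]] := hD (fun k => x ^+ k).
have [k0 hk0 mink0] : exists2 k0 : 'I_D.+1, p k0 != 0 &
    forall k : 'I_D.+1, (k < k0)%N -> p k = 0.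
  case: hp => k hk; case: (arg_minnP (fun k : 'I_D.+1 => k : nat) (P := fun k => p k != 0) hk).
  move=> k0 hk0 hmax; exists k0 => // l lt; apply/eqP; apply: contraLR lt => /hmax.
  by rewrite -leqNgt.
have xk0 : x ^+ k0 != 0 by rewrite expf_neq0.
have Ot q : O (ev q t) by apply: local_ring_horner; apply: subalg_local.
have : O (ev (p k0) t / x).
  move: rel => /(congr1 (fun y => y / x ^+ k0)); rewrite mul0r mulr_suml (bigD1 k0) //=.
  rewrite mulfK // => /eqP; rewrite addr_eq0 => /eqP ->.
  rewrite mulNr mulr_suml; apply: (local_ringN hM); apply: (local_ring_sum hM) => k nk.
  have [gt|lt|/val_inj eq] := ltngtP k0 k; last by rewrite eq eqxx in nk.
    rewrite -(subnK gt) exprD exprS.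
    have -> : ev (p k) t * (x ^+ (k - k0.+1) * (x * x ^+ k0)) / x ^+ k0 / x
      = ev (p k) t * x ^+ (k - k0.+1) by field; rewrite x0 xk0.
    by apply: (local_ringM hM) => //; apply: (local_ringX hM).
  by rewrite mink0 // rmorph0 horner0 !mul0r; apply: (local_ring0 hM).
have [v [q [-> q0]]] := polyX_factor hk0.
set u := t / pi ^+ e in Ou Mu.
have tE : t = u * pi ^+ e by rewrite mulfVK // expf_neq0.
have Ow : O (ev q t) by [].
move=> /(local_ringM hM)/(_ (h (e * v).+1)).
rewrite rmorphM /= map_polyXn hornerM hornerXn {1}tE.
have pev : pi ^+ (e * v) != 0 by rewrite expf_neq0.
have -> : (u * pi ^+ e) ^+ v * ev q t / x * (x / pi ^+ (e * v).+1) = u ^+ v * ev q t / pi.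
  by rewrite exprMn -exprM exprS; field; rewrite x0 pi0 pev.
move=> /(subalgMl hM)/(_ Mpi); rewrite mulfVK // => /(subalg_prime hM)[||| /(subalgB hM)/(_ (subalg_horner_sub q Mt))] //.
- exact: (local_ringX hM).
- elim: v {h hk0 pev} => [|v IH]; first by rewrite expr0 => /(subalg1 hM).
  by rewrite exprS => /(subalg_prime hM Ou (local_ringX hM v Ou))[/Mu|].
- by rewrite subKr => /(subalgC hM)/eqP; rewrite (negbTE q0).
Qed.

End Discrete.

(** * Infinitely many constants and finite field extensions *)

Section InfiniteField.
Variables (K : closedFieldType) (E : fieldType) (i : {rmorphism K -> E}).

Lemma closed_field_fresh (s : seq K) : exists c, c \notin s.
Proof.
pose p := \prod_(x <- s) ('X - x%:P) + 1.
have [s0|s0] := posnP (size s).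
  by exists 0; rewrite (size0nil s0).
have sp : size p != 1.
  rewrite size_polyDl size_prod_XsubC; first by rewrite eqSS -lt0n.
  by rewrite size_poly1 ltnS.
have [c rc] := closed_rootP p sp; exists c; apply: contraL rc => cs.
have : root (\prod_(x <- s) ('X - x%:P)) c by rewrite root_prod_XsubC.
by rewrite !rootE hornerD hornerC => /eqP ->; rewrite add0r oner_eq0.
Qed.

Lemma closed_field_uniq n : exists s : seq K, uniq s /\ size s = n.
Proof.
elim: n => [|n [s [us ss]]]; first by exists [::].
by have [c hc] := closed_field_fresh s; exists (c :: s); rewrite /= hc us ss.
Qed.

Lemma poly_nonroot (p : {poly E}) : p != 0 -> exists c, p.[i c] != 0.
Proof.
move=> p0; apply: boolp.contrapT => no.
have [s [us ss]] := closed_field_uniq (size p).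
have ur : uniq (map i s) by rewrite map_inj_uniq //; apply: fmorph_inj.
have ar : all (root p) (map i s).
  apply/allP => _ /mapP[c _ ->]; rewrite rootE; apply: contra_notT no => h.
  by exists c.
by move: (max_poly_roots p0 ar ur); rewrite size_map ss ltnn.
Qed.

End InfiniteField.

Definition finite_over (E E' : fieldType) (j : {rmorphism E -> E'}) :=
  exists n (s : 'I_n -> E'), forall z, exists c : 'I_n -> E, z = \sum_k j (c k) * s k.

Lemma finite_over_id (E : fieldType) (j : {rmorphism E -> E}) : j =1 id -> finite_over j.
Proof.
move=> jid; exists 1, (fun=> 1) => z; exists (fun=> z).
by rewrite big_ord1 mulr1 jid.
Qed.

Lemma finite_over_comp (E1 E2 E3 : fieldType) (j : {rmorphism E1 -> E2})
    (j' : {rmorphism E2 -> E3}) :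
  finite_over j -> finite_over j' -> finite_over (j' \o j : {rmorphism E1 -> E3}).
Proof.
move=> [n [s hs]] [n' [s' hs']].
exists #|{: 'I_n * 'I_n'}|, (fun k => j' (s (enum_val k).1) * s' (enum_val k).2) => z.
have [c ->] := hs' z.
have [c' hc'] := boolp.choice (fun k => hs (c k)).
exists (fun k => c' (enum_val k).2 (enum_val k).1).
rewrite (eq_bigr (fun k => \sum_l j' (j (c' k l)) * (j' (s l) * s' k))); last first.
  move=> k _; rewrite hc' rmorph_sum mulr_suml; apply: eq_bigr => l _.
  by rewrite rmorphM mulrA.
rewrite exchange_big pair_bigA /= (reindex (@enum_val _ {: 'I_n * 'I_n'})) //=.
exact/onW_bij/enum_val_bij.
Qed.

Lemma finite_root (E : fieldType) (p : {poly E}) : (1 < size p)%N ->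
  exists (E' : fieldType) (j : {rmorphism E -> E'}),
    finite_over j /\ exists x, root (map_poly j p) x.
Proof.
have [n] := ubnP (size p); elim: n p => // n IH p lt sp.
case: (boolp.EM (irreducible_poly p)) => [/irredp_FAdjoin[L _ [z rz _]]|red].
  exists L, (in_alg L); split; last by exists z.
  exists (\dim {:L}), (fun k => tnth (vbasis {:L}) k) => y.
  exists (fun k => coord (vbasis {:L}) k y).
  rewrite {1}(coord_vbasis (memvf y)); apply: eq_bigr => k _ /=.
  by rewrite -(tnth_nth 0) mulr_algl.
have p0 : p != 0 by rewrite -size_poly_gt0 ltnW.
have [q [sq dq nq]] : exists q : {poly E}, [/\ size q != 1, q %| p & ~ q %= p].
  apply: boolp.contrapT => no; apply: red; split=> // q sq dq.
  by apply: boolp.contrapT => nq; apply: no; exists q.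
have q0 : q != 0 by apply: contraTneq dq => ->; rewrite dvd0p.
have lq : (size q < size p)%N.
  by rewrite ltn_neqAle dvdp_leq // andbT; apply/eqP => h; apply: nq; rewrite -(dvdp_size_eqp dq) h.
have [||E' [j [fj [x rx]]]] := IH q.
- by rewrite -ltnS; apply: leq_trans lt; rewrite ltnS.
- by rewrite ltn_neqAle eq_sym sq size_poly_gt0.
exists E', j; split=> //; exists x; move: dq => /dvdpP[r ->].
by rewrite rmorphM rootM rx orbT.
Qed.

Lemma finite_split (E : fieldType) (p : {poly E}) : p != 0 ->
  exists (E' : fieldType) (j : {rmorphism E -> E'}),
    finite_over j /\ exists s : seq E',
      map_poly j p = j (lead_coef p) *: \prod_(x <- s) ('X - x%:P).
Proof.
have [n] := ubnP (size p); elim: n E p => // n IH E p lt p0.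
have [sp|sp] := leqP (size p) 1.
  exists E, idfun; split; first exact: finite_over_id.
  exists [::]; rewrite big_nil alg_polyC.
  by rewrite (size1_polyC sp) map_polyC lead_coefC.
have [E1 [j1 [f1 [x /factor_theorem[q hq]]]]] := finite_root sp.
have q0 : q != 0.
  by apply: contraNneq p0 => q0; move/eqP: hq; rewrite q0 mul0r map_poly_eq0.
have sq : (size q < n)%N.
  rewrite -ltnS; apply: leq_trans lt.
  by rewrite -(size_map_poly j1 p) hq size_Mmonic ?monicXsubC // size_XsubC addn2.
have [E2 [j2 [f2 [s hs]]]] := IH _ _ sq q0.
exists E2, (j2 \o j1 : {rmorphism E -> E2}); split; first exact: finite_over_comp.
exists (j2 x :: s); rewrite big_cons mulrC scalerAl /= map_poly_comp hq rmorphM /= hs.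
rewrite rmorphB /= map_polyX map_polyC /=; congr (_ *: _ * _).
by rewrite -(lead_coef_map j1) hq lead_coef_Mmonic ?monicXsubC.
Qed.

(** * Extension of homomorphisms from subalgebras *)

Section PartialHom.
Variables (K F : fieldType) (iF : {rmorphism K -> F}).
Implicit Types (D : F -> Prop) (p q : {poly F}).

Definition subalgebra D :=
  [/\ forall c, D (iF c), forall x y, D x -> D y -> D (x + y) &
      forall x y, D x -> D y -> D (x * y)].

(** A homomorphism on [D] is a total function with arbitrary values outside [D], so that the many
    subrings of [F] need no type of their own. *)
Definition partial_hom D (E : fieldType) (iE : {rmorphism K -> E}) (H : F -> E) :=
  [/\ forall c, H (iF c) = iE c,
      forall x y, D x -> D y -> H (x + y) = H x + H y &
      forall x y, D x -> D y -> H (x * y) = H x * H y].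

Definition coefs_in D p := forall k, D p`_k.

Definition adjoin D (u z : F) := exists p, coefs_in D p /\ z = p.[u].

Section Subalgebra.
Variable D : F -> Prop.
Hypothesis hD : subalgebra D.

Lemma subalgebraC c : D (iF c). Proof. by case: hD. Qed.
Lemma subalgebraD x y : D x -> D y -> D (x + y). Proof. by case: hD => _ + _; apply. Qed.
Lemma subalgebraM x y : D x -> D y -> D (x * y). Proof. by case: hD => _ _; apply. Qed.
Lemma subalgebra0 : D 0. Proof. by rewrite -(rmorph0 iF); apply: subalgebraC. Qed.
Lemma subalgebra1 : D 1. Proof. by rewrite -(rmorph1 iF); apply: subalgebraC. Qed.
Lemma subalgebraN x : D x -> D (- x).
Proof.
by move=> h; rewrite -mulN1r -(rmorphN1 iF); apply: subalgebraM => //; apply: subalgebraC.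
Qed.
Lemma subalgebra_sum I (r : seq I) (P : pred I) (G : I -> F) :
  (forall j, P j -> D (G j)) -> D (\sum_(j <- r | P j) G j).
Proof. by move=> h; elim/big_ind: _ => //; [apply: subalgebra0|apply: subalgebraD]. Qed.
Lemma subalgebraX x n : D x -> D (x ^+ n).
Proof.
move=> h; elim: n => [|n IH]; first exact: subalgebra1.
by rewrite exprS; apply: subalgebraM.
Qed.

Lemma coefs_in0 : coefs_in D 0. Proof. by move=> k; rewrite coef0; apply: subalgebra0. Qed.
Lemma coefs_inC c : D c -> coefs_in D c%:P.
Proof. by move=> h k; rewrite coefC; case: eqP => // _; apply: subalgebra0. Qed.
Lemma coefs_inX : coefs_in D 'X.
Proof. by move=> k; rewrite coefX; case: eqP => _; [apply: subalgebra1|apply: subalgebra0]. Qed.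
Lemma coefs_inD p q : coefs_in D p -> coefs_in D q -> coefs_in D (p + q).
Proof. by move=> hp hq k; rewrite coefD; apply: subalgebraD. Qed.
Lemma coefs_inM p q : coefs_in D p -> coefs_in D q -> coefs_in D (p * q).
Proof.
by move=> hp hq k; rewrite coefM; apply: subalgebra_sum => j _; apply: subalgebraM.
Qed.
Lemma coefs_inN p : coefs_in D p -> coefs_in D (- p).
Proof. by move=> hp k; rewrite coefN; apply: subalgebraN. Qed.
Lemma coefs_inZ c p : D c -> coefs_in D p -> coefs_in D (c *: p).
Proof. by move=> hc hp k; rewrite coefZ; apply: subalgebraM. Qed.
Lemma coefs_inXn n : coefs_in D 'X^n.
Proof. by move=> k; rewrite coefXn; case: eqP => _; [apply: subalgebra1|apply: subalgebra0]. Qed.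

Lemma adjoin_subalgebra u : subalgebra (adjoin D u).
Proof.
split.
- by move=> c; exists (iF c)%:P; rewrite hornerC; split=> //; apply/coefs_inC/subalgebraC.
- by move=> _ _ [p [hp ->]] [q [hq ->]]; exists (p + q); rewrite hornerD; split=> //; apply: coefs_inD.
- by move=> _ _ [p [hp ->]] [q [hq ->]]; exists (p * q); rewrite hornerM; split=> //; apply: coefs_inM.
Qed.

Lemma sub_adjoin u x : D x -> adjoin D u x.
Proof. by move=> h; exists x%:P; rewrite hornerC; split=> //; apply: coefs_inC. Qed.

Lemma mem_adjoin u : adjoin D u u.
Proof. by exists 'X; rewrite hornerX; split=> //; apply: coefs_inX. Qed.

Lemma pseudo_division p q : q != 0 -> coefs_in D p -> coefs_in D q ->
  exists n h r, [/\ coefs_in D h, coefs_in D r,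
    (lead_coef q ^+ n) *: p = h * q + r & (size r < size q)%N].
Proof.
move=> q0; have [m] := ubnP (size p); elim: m p => // m IH p lt hp hq.
have [le|le] := ltnP (size p) (size q).
  by exists 0, 0, p; rewrite expr0 scale1r mul0r add0r; split=> //; apply: coefs_in0.
have p0 : p != 0 by rewrite -size_poly_gt0; apply: leq_trans le; rewrite size_poly_gt0.
have Dl : D (lead_coef q) by apply: hq.
pose g := lead_coef p *: 'X^(size p - size q).
have hg : coefs_in D g by apply: coefs_inZ; [apply: hp|apply: coefs_inXn].
have hp' : coefs_in D (lead_coef q *: p - g * q).
  by apply: coefs_inD; [apply: coefs_inZ|apply/coefs_inN/coefs_inM].
have sg : size (g * q) = size p.
  rewrite size_mul ?size_scale ?lead_coef_eq0 // ?scaler_eq0 ?lead_coef_eq0 ?negb_or ?p0 ?monic_neq0 ?monicXn //.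
  by rewrite size_polyXn addSn /= subnK.
have lg : lead_coef (g * q) = lead_coef p * lead_coef q.
  by rewrite lead_coefM lead_coefZ lead_coefXn mulr1.
have [|n [h [r [hh hr e sr]]]] := IH (lead_coef q *: p - g * q) _ hp' hq.
  rewrite -ltnS; apply: leq_trans lt; rewrite ltnS.
  case sp: (size p) p0 => [|s]; first by move/eqP: sp; rewrite size_poly_eq0 => ->.
  move=> _; rewrite ltnS; apply/leq_sizeP => k; rewrite leq_eqVlt => /orP[/eqP <-|lk].
    rewrite coefB coefZ.
    have -> : p`_s = lead_coef p by rewrite lead_coefE sp.
    have -> : (g * q)`_s = lead_coef (g * q) by rewrite lead_coefE sg sp.
    by rewrite lg mulrC subrr.
  by rewrite coefB coefZ !nth_default ?mulr0 ?subr0 // ?sg sp.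
exists n.+1, (lead_coef q ^+ n *: g + h), r; split=> //.
  by apply: coefs_inD => //; apply: coefs_inZ => //; apply: subalgebraX.
by rewrite mulrDl -addrA -e scalerBr -(scalerAl _ g) addrCA subrr addr0 scalerA -exprSr.
Qed.

Section Extend.
Variables (E : fieldType) (iE : {rmorphism K -> E}) (H : F -> E).
Hypothesis hH : partial_hom D iE H.

Lemma partial_homC c : H (iF c) = iE c. Proof. by case: hH. Qed.
Lemma partial_homD x y : D x -> D y -> H (x + y) = H x + H y.
Proof. by case: hH => _ + _; apply. Qed.
Lemma partial_homM x y : D x -> D y -> H (x * y) = H x * H y.
Proof. by case: hH => _ _; apply. Qed.
Lemma partial_hom0 : H 0 = 0. Proof. by rewrite -(rmorph0 iF) partial_homC rmorph0. Qed.
Lemma partial_hom1 : H 1 = 1. Proof. by rewrite -(rmorph1 iF) partial_homC rmorph1. Qed.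
Lemma partial_homN x : D x -> H (- x) = - H x.
Proof.
move=> h; rewrite -mulN1r -(rmorphN1 iF) partial_homM ?partial_homC //.
  by rewrite rmorphN1 mulN1r.
exact: subalgebraC.
Qed.
Lemma partial_homX x n : D x -> H (x ^+ n) = H x ^+ n.
Proof.
move=> h; elim: n => [|n IH]; first exact: partial_hom1.
by rewrite !exprS partial_homM ?IH //; apply: subalgebraX.
Qed.
Lemma partial_hom_sum I (r : seq I) (G : I -> F) :
  (forall j, D (G j)) -> H (\sum_(j <- r) G j) = \sum_(j <- r) H (G j).
Proof.
move=> h; elim: r => [|a r IH]; first by rewrite !big_nil partial_hom0.
by rewrite !big_cons partial_homD ?IH //; apply: subalgebra_sum.
Qed.

Let coef_mapH p k : (map_poly H p)`_k = H p`_k.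
Proof. by rewrite coef_map_id0 // partial_hom0. Qed.

Lemma partial_hom_polyC c : map_poly H c%:P = (H c)%:P.
Proof. by apply/polyP => k; rewrite coef_mapH !coefC; case: eqP => // _; apply: partial_hom0. Qed.
Lemma partial_hom_polyD p q : coefs_in D p -> coefs_in D q ->
  map_poly H (p + q) = map_poly H p + map_poly H q.
Proof.
by move=> hp hq; apply/polyP => k; rewrite coefD !coef_mapH coefD partial_homD.
Qed.
Lemma partial_hom_polyN p : coefs_in D p -> map_poly H (- p) = - map_poly H p.
Proof. by move=> hp; apply/polyP => k; rewrite coefN !coef_mapH coefN partial_homN. Qed.
Lemma partial_hom_polyM p q : coefs_in D p -> coefs_in D q ->
  map_poly H (p * q) = map_poly H p * map_poly H q.
Proof.
move=> hp hq; apply/polyP => k; rewrite coefM coef_mapH coefM partial_hom_sum.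
  by apply: eq_bigr => j _; rewrite !coef_mapH partial_homM.
by move=> j; apply: subalgebraM.
Qed.
Lemma partial_hom_polyZ c p : D c -> coefs_in D p ->
  map_poly H (c *: p) = H c *: map_poly H p.
Proof. by move=> hc hp; apply/polyP => k; rewrite coefZ !coef_mapH coefZ partial_homM. Qed.

Lemma partial_hom_adjoin u x :
  (forall p, coefs_in D p -> p.[u] = 0 -> (map_poly H p).[x] = 0) ->
  exists H' : F -> E, partial_hom (adjoin D u) iE H' /\
    forall p, coefs_in D p -> H' p.[u] = (map_poly H p).[x].
Proof.
move=> kill.
(* The value at [z] is read off any polynomial that represents [z], and [kill] makes it independent
   of the choice; outside [D[u]] it is 0. *)
have ex z : exists y, forall p, coefs_in D p -> z = p.[u] -> y = (map_poly H p).[x].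
  case: (boolp.EM (adjoin D u z)) => [[p [hp zp]]|no]; last first.
    by exists 0 => p hp zp; exfalso; apply: no; exists p.
  exists (map_poly H p).[x] => q hq zq; apply/eqP; rewrite -subr_eq0.
  rewrite -hornerN -hornerD -partial_hom_polyN // -partial_hom_polyD //; last exact: coefs_inN.
  by rewrite kill //; [apply: coefs_inD => //; apply: coefs_inN|rewrite hornerD hornerN -zp -zq subrr].
have [H' hH'] := boolp.choice ex.
have H'E p : coefs_in D p -> H' p.[u] = (map_poly H p).[x] by move=> hp; apply: hH'.
exists H'; split=> //; split.
- move=> c; rewrite -[iF c](hornerC _ u) H'E; last exact/coefs_inC/subalgebraC.
  by rewrite partial_hom_polyC hornerC partial_homC.
- move=> _ _ [p [hp ->]] [q [hq ->]]; rewrite -hornerD !H'E //; last exact: coefs_inD.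
  by rewrite partial_hom_polyD // hornerD.
- move=> _ _ [p [hp ->]] [q [hq ->]]; rewrite -hornerM !H'E //; last exact: coefs_inM.
  by rewrite partial_hom_polyM // hornerM.
Qed.

End Extend.

(* [f] plays the role of the minimal polynomial of [u] over the fraction field of [D]. *)
Definition minimal_annihilator (f : {poly F}) (u : F) :=
  [/\ f != 0, coefs_in D f, f.[u] = 0 &
      forall g, coefs_in D g -> g.[u] = 0 -> (size g < size f)%N -> g = 0].

Lemma minimal_annihilator_exists u (g : {poly F}) :
  g != 0 -> coefs_in D g -> g.[u] = 0 -> exists f, minimal_annihilator f u.
Proof.
have [n] := ubnP (size g); elim: n g => // n IH g lt g0 hg gu.
case: (boolp.EM (exists h, [/\ h != 0, coefs_in D h, h.[u] = 0 & (size h < size g)%N])).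
  by move=> [h [h0 hh hu lh]]; apply: (IH h) => //; apply: leq_trans lh _.
move=> no; exists g; split=> // h hh hu lh; apply/eqP; apply: contra_notT no => h0.
by exists h.
Qed.

(** Up to a power of the leading coefficient of [f], pseudo-division makes every relation of [u] a
    multiple of [f]. When that coefficient survives under [H], a root of the image of [f] therefore
    kills all relations. *)
Lemma minimal_annihilator_kill f u (E : fieldType) (iE : {rmorphism K -> E}) (H : F -> E) x :
  minimal_annihilator f u -> partial_hom D iE H -> H (lead_coef f) != 0 ->
  (map_poly H f).[x] = 0 ->
  forall p, coefs_in D p -> p.[u] = 0 -> (map_poly H p).[x] = 0.
Proof.
move=> [f0 hf fu min] hH lf fx p hp pu.
have [n [h [r [hh hr e sr]]]] := pseudo_division f0 hp hf.
have r0 : r = 0.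
  apply: min => //; move: e => /(congr1 (fun q => q.[u])).
  by rewrite hornerZ pu mulr0 hornerD hornerM fu mulr0 add0r.
move: e => /(congr1 (map_poly H)); rewrite r0 addr0 (partial_hom_polyM hH) //.
have Dl : D (lead_coef f) by apply: hf.
rewrite (partial_hom_polyZ hH) //; last exact: subalgebraX.
move=> /(congr1 (fun q : {poly E} => q.[x])); rewrite hornerZ hornerM fx mulr0 => /eqP.
by rewrite mulf_eq0 (partial_homX hH) // expf_eq0 (negbTE lf) andbF => /eqP.
Qed.

(** Euclid's algorithm on [f] and a representative of [v]: each pseudo-remainder of [f] has at [u] a
    value that is a multiple of the preceding one and nonzero by minimality, until a constant is
    reached. This carries nonvanishing from [D[u]] down to [D]. *)
Lemma algebraic_divides f u v : minimal_annihilator f u -> adjoin D u v -> v != 0 ->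
  exists2 s, D s /\ s != 0 & exists2 w, adjoin D u w & v * w = s.
Proof.
move=> [f0 hf fu min] [p [hp ->]] {v}.
have aD := adjoin_subalgebra u.
have small q : coefs_in D q -> q != 0 -> (size q < size f)%N ->
    exists2 s, D s /\ s != 0 & exists2 w, adjoin D u w & q.[u] * w = s.
  have [n] := ubnP (size q); elim: n q => // n IH q lt hq q0 lq.
  have [sq|sq] := leqP (size q) 1.
    exists q`_0; first by split; [apply: hq|move: q0; rewrite {1}[q]size1_polyC // polyC_eq0].
    exists 1; first by have := @sub_adjoin u 1; apply; apply: subalgebra1.
    by rewrite {1}[q]size1_polyC // hornerC mulr1.
  have [m [h [r [hh hr e sr]]]] := pseudo_division q0 hf hq.
  have h0 : h != 0.
    apply: contraTneq lq => h0; move: e; rewrite h0 mul0r add0r => e.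
    rewrite -leqNgt ltnW // -(size_scale f (_ : lead_coef q ^+ m != 0)) ?e //.
    by rewrite expf_neq0 // lead_coef_eq0.
  have lh : (size h < size f)%N.
    have : size (h * q + r) = size f by rewrite -e size_scale // expf_neq0 // lead_coef_eq0.
    have sM : size (h * q) = (size h + size q).-1 by rewrite size_mul.
    have rhq : (size r < size (h * q)%R)%N.
      apply: leq_trans sr _; rewrite sM.
      have : (0 < size h)%N by rewrite size_poly_gt0.
      by case: (size h) => // a _; rewrite addSn leq_addl.
    rewrite size_polyDl // sM => <-.
    by case: (size q) sq => [|[|a]] // _; rewrite !addnS /= ltnS leq_addr.
  have hu : h.[u] != 0.
    by apply: contraNneq h0 => hu; rewrite (min h).
  have qu : q.[u] != 0.
    by apply: contraNneq q0 => qu; rewrite (min q).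
  have ru : r.[u] = - (h.[u] * q.[u]).
    move: e => /(congr1 (fun g => g.[u])); rewrite hornerZ fu mulr0 hornerD hornerM.
    by move=> /esym/eqP; rewrite addrC addr_eq0 => /eqP.
  have r0 : r != 0.
    by apply: contraTneq (mulf_neq0 hu qu) => r0; rewrite negbK -oppr_eq0 -ru r0 horner0.
  have [||s [Ds s0] [w Dw e']] := IH r _ hr r0.
  - by rewrite -ltnS; apply: leq_trans lt; rewrite ltnS.
  - exact: ltn_trans lq.
  exists s => //; exists (- (h.[u] * w)); last by rewrite -e' ru; ring.
  case: aD => aC aA aM; rewrite -mulN1r -(rmorphN1 iF); apply: (aM) => //.
  by apply: (aM) => //; exists h.
move=> pu.
have [n [h [r [hh hr e sr]]]] := pseudo_division f0 hp hf.
have ru : r.[u] = lead_coef f ^+ n * p.[u].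
  move: e => /(congr1 (fun g => g.[u])).
  by rewrite hornerZ hornerD hornerM fu mulr0 add0r.
have r0 : r != 0.
  apply: contraNneq pu => r0; move/esym/eqP: ru; rewrite r0 horner0 mulf_eq0.
  by rewrite expf_eq0 lead_coef_eq0 (negbTE f0) andbF.
have [s hs [w Dw e']] := small r hr r0 sr.
exists s => //; exists (lead_coef f ^+ n * w); last by rewrite -e' ru; ring.
case: aD => aC aA aM; apply: aM => //; apply: sub_adjoin.
by apply: subalgebraX; apply: hf.
Qed.

End Subalgebra.
End PartialHom.

(** If [u] is algebraic over [D], it goes to a root of the image of its annihilator, and [s] is the
    leading coefficient times a multiple of [v] that lies in [D]. Otherwise [u] goes to a constant
    avoiding the roots of the image of [p], and [s] is the leading coefficient of [p]. *)
Lemma partial_hom_extend (K : closedFieldType) (F : fieldType) (iF : {rmorphism K -> F})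
    (D : F -> Prop) (u v : F) : subalgebra iF D -> adjoin D u v -> v != 0 ->
  exists2 s, D s /\ s != 0 &
    forall (E : fieldType) (iE : {rmorphism K -> E}) (H : F -> E),
    partial_hom iF D iE H -> H s != 0 ->
    exists (E' : fieldType) (j : {rmorphism E -> E'}) (H' : F -> E'),
      [/\ finite_over j, partial_hom iF (adjoin D u) (j \o iE) H',
          forall z, D z -> H' z = j (H z) & H' v != 0].
Proof.
move=> hD [p [hp ->]] {v} pu.
have p0 : p != 0 by apply: contraNneq pu => ->; rewrite horner0.
case: (boolp.EM (exists g, [/\ g != 0, coefs_in D g & g.[u] = 0])) => [[g [g0 hg gu]]|tr].
  have [f fmin] := minimal_annihilator_exists g0 hg gu.
  have Dpu : adjoin D u p.[u] by exists p.
  have [s [Ds s0] [w Dw e]] := algebraic_divides hD fmin Dpu pu.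
  have [f0 hf fu _] := fmin.
  have Dl : D (lead_coef f) by apply: hf.
  exists (lead_coef f * s).
    by split; [apply: (subalgebraM hD)|rewrite mulf_neq0 // lead_coef_eq0].
  move=> E iE H hH; rewrite (partial_homM hH) // mulf_eq0 negb_or => /andP[lf Hs].
  have sf : size (map_poly H f) = size f.
    by rewrite size_poly_eq.
  have sf1 : (1 < size (map_poly H f))%N.
    rewrite sf ltnNge; apply: contra f0 => sf1; move: fu; rewrite [f]size1_polyC // hornerC.
    by move=> ->; rewrite polyC0.
  have [E' [j [fj [x /eqP rx]]]] := finite_root sf1.
  pose jH := (fun z => j (H z)).
  have hjH : partial_hom iF D (j \o iE : {rmorphism K -> E'}) jH.
    split=> [c|a b Da Db|a b Da Db]; rewrite /jH /=.
    - by rewrite (partial_homC hH).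
    - by rewrite (partial_homD hH) // rmorphD.
    - by rewrite (partial_homM hH) // rmorphM.
  have mapjH q : map_poly jH q = map_poly j (map_poly H q).
    apply/polyP => k; rewrite coef_map_id0 ?coef_map ?coef_map_id0 //.
      by rewrite (partial_hom0 hH).
    exact: (partial_hom0 hjH).
  have kill := minimal_annihilator_kill hD fmin hjH (x := x).
  have [|H' [hH' H'E]] := partial_hom_adjoin hD hjH (u := u) (x := x).
    by apply: kill; rewrite ?fmorph_eq0 // mapjH.
  have ext z : D z -> H' z = j (H z).
    move=> Dz; rewrite -[z in LHS](hornerC _ u) H'E; last exact: (coefs_inC hD).
    by rewrite (partial_hom_polyC hjH) hornerC.
  exists E', j, H'; split=> //.
  have : H' s != 0 by rewrite ext // fmorph_eq0.
  rewrite -e (partial_homM hH') //; by rewrite mulf_eq0 negb_or => /andP[].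
have {}tr g : coefs_in D g -> g.[u] = 0 -> g = 0.
  move=> hg gu; apply/eqP; apply: contra_notT tr => g0; by exists g.
exists (lead_coef p); first by split; [apply: hp|rewrite lead_coef_eq0].
move=> E iE H hH lp.
have [c hc] : exists c, (map_poly H p).[iE c] != 0.
  apply: poly_nonroot; rewrite -size_poly_eq0 size_poly_eq //.
  by rewrite size_poly_eq0.
have [|H' [hH' H'E]] := partial_hom_adjoin hD hH (u := u) (x := iE c).
  by move=> q hq /(tr _ hq) ->; rewrite map_poly0 horner0.
exists E, idfun, H'; split.
- exact: finite_over_id.
- by case: hH' => h1 h2 h3; split.
- move=> z Dz; rewrite -[z in LHS](hornerC _ u) H'E; last exact: (coefs_inC hD).
  by rewrite (partial_hom_polyC hH) hornerC.
- by rewrite H'E.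
Qed.
Local Notation widen := (widen_ord (leqnSn _)).
(** * Noether normalization *)

Section MpolyExtra.
Variables (R : comNzRingType) (S : comNzRingType).

Lemma mpoly_rmorph_ext n (f g : {rmorphism {mpoly R[n]} -> S}) :
  (forall c, f c%:MP = g c%:MP) -> (forall j, f 'X_j = g 'X_j) -> f =1 g.
Proof.
move=> hC hX p; rewrite [p]mpolyE !rmorph_sum; apply: eq_bigr => m _.
rewrite -mul_mpolyC !rmorphM hC mpolyXE_id !rmorph_prod; congr (_ * _).
by apply: eq_bigr => j _; rewrite !rmorphXn hX.
Qed.

Lemma mmap_muni n (f : {rmorphism R -> S}) (h : 'I_n.+1 -> S) (p : {mpoly R[n.+1]}) :
  mmap f h p = (map_poly (mmap f (h \o widen)) (muni p)).[h ord_max].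
Proof.
pose g : {rmorphism {mpoly R[n.+1]} -> S} :=
  (horner_eval (h ord_max) \o map_poly (mmap f (h \o widen)) \o @muni n R).
rewrite (_ : _.[_] = g p) //; apply: (mpoly_rmorph_ext (f := mmap f h)) => [c|j].
  by rewrite /g /= muniC map_polyC /= !mmapC /horner_eval hornerC.
rewrite /g /= mmapX mmap1U muniE msuppX big_seq1 mcoeffX eqxx scale1r.
rewrite map_polyZ /= map_polyXn /horner_eval hornerZ hornerXn mmapX.
have [k ->|] := unliftP ord_max j.
  have -> : lift ord_max k = widen k by apply: val_inj; rewrite /= /bump leqNgt ltn_ord.
  have -> : [multinom U_(widen k)%MM (widen i) | i < n] = U_(k)%MM.
    by apply/mnmP => i; rewrite mnmE !mnm1E -!val_eqE.
  by rewrite mmap1U mnm1E -val_eqE /= ltn_eqF ?ltn_ord // expr0 mulr1.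
move=> ->.
have -> : [multinom U_(ord_max)%MM (widen i) | i < n] = 0%MM.
  by apply/mnmP => i; rewrite mnmE mnm1E mnm0E -val_eqE /= gtn_eqF ?ltn_ord.
by rewrite mmap11 mul1r mnm1E eqxx expr1.
Qed.

End MpolyExtra.

Lemma muni_retract (R : comNzRingType) n : exists g : {rmorphism {poly {mpoly R[n]}} -> {mpoly R[n.+1]}},
  cancel (@muni n R) g.
Proof.
exists (horner_eval 'X_ord_max \o map_poly (mmap (@mpolyC n.+1 R) ((fun j => 'X_j) \o widen))).
move=> p; rewrite -[RHS](comp_mpoly_id p) /comp_mpoly.
have -> : mmap (@mpolyC n.+1 R) (tnth [tuple 'X_i | i < n.+1]) p =
   mmap (@mpolyC n.+1 R) (fun j => 'X_j) p.
  by apply: eq_bigr => m _; congr (_ * _); apply: mmap1_eq => j; rewrite tnth_mktuple.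
by rewrite mmap_muni.
Qed.

Lemma mpoly_nonroot (K : closedFieldType) n (p : {mpoly K[n]}) : p != 0 ->
  exists v : 'I_n -> K, p.@[v] != 0.
Proof.
elim: n p => [|n IH] p p0.
  exists (fun=> 0); move: p0; rewrite [p]nvar0_mpolyC mevalC.
  by apply: contraNneq => ->.
have [g gK] := muni_retract K n.
have m0 : muni p != 0 by apply: contraNneq p0 => h; rewrite -[p]gK h rmorph0.
have /IH[v hv] : lead_coef (muni p) != 0 by rewrite lead_coef_eq0.
have mp0 : map_poly (meval v) (muni p) != 0.
  by rewrite -size_poly_eq0 size_poly_eq ?size_poly_eq0.
have [c hc] := @poly_nonroot K K idfun _ mp0.
exists (fun j => if unlift ord_max j is Some k then v k else c).
rewrite /meval mmap_muni unlift_none; apply: contraNneq hc => <-.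
apply/eqP; congr (horner _ _); apply: eq_map_poly => q; apply: eq_bigr => m _; congr (_ * _).
apply: mmap1_eq => j /=.
have -> : widen j = lift ord_max j by apply: val_inj; rewrite /= /bump leqNgt ltn_ord.
by rewrite liftK.
Qed.

(** * Integral closedness of polynomial rings *)

Lemma fraction_repr (A : idomainType) (c : {fraction A}) :
  exists u v : A, v != 0 /\ c = tofrac u / tofrac v.
Proof.
elim/quotW: c => x; exists (frac x).1, (frac x).2; split; first exact: denom_ratioP.
have d0 : tofrac (frac x).2 != 0 by rewrite tofrac_eq0 denom_ratioP.
apply: (mulIf d0); rewrite mulfVK //.
change (FracField.mul (\pi_(FracField.type A)%qT x) (tofrac (frac x).2) = tofrac (frac x).1).
rewrite !piE; apply/eqP; rewrite !piE /= FracField.equivfE /FracField.mulf.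
rewrite !numden_Ratio ?oner_eq0 ?mulf_neq0 ?denom_ratioP ?oner_neq0 //.
by rewrite !mulr1 mulrC.
Qed.

Lemma tofrac_inj (A : idomainType) : injective (@tofrac A).
Proof. by move=> x y /eqP; rewrite tofrac_eq => /eqP. Qed.

(* Integral closedness in the fraction field, phrased without fractions. *)
Definition integrally_closed (A : idomainType) :=
  forall (a b : A) (G : {poly A}), b != 0 -> G \is monic ->
  \sum_(k < size G) G`_k * a ^+ k * b ^+ ((size G).-1 - k) = 0 ->
  exists q, a = b * q.

Lemma integrally_closed_poly_field (F : fieldType) : integrally_closed {poly F}.
Proof.
move=> a b G b0 mG rel; set n := (size G).-1.
have sG : size G = n.+1 by rewrite /n prednK // size_poly_gt0 monic_neq0.
set g := gcdp a b.
have g0 : g != 0 by rewrite gcdp_eq0 negb_and b0 orbT.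
have ga : a %/ g * g = a by rewrite divpK // dvdp_gcdl.
have gb : b %/ g * g = b by rewrite divpK // dvdp_gcdr.
move: ga gb; set a' := a %/ g; set b' := b %/ g => ga gb.
have cop : coprimep a' b' by apply: coprimep_div_gcd; rewrite b0 orbT.
have : b' %| a' ^+ n.
  have : \sum_(k < n.+1) G`_k * a' ^+ k * b' ^+ (n - k) = 0.
    have gn : g ^+ n != 0 by rewrite expf_neq0.
    apply: (mulfI gn); rewrite mulr0 -[RHS]rel sG mulr_sumr; apply: eq_bigr => k _.
    rewrite -/n -ga -gb !exprMn.
    have -> : g ^+ n = g ^+ k * g ^+ (n - k) by rewrite -exprD subnKC // -ltnS.
    by ring.
  rewrite big_ord_recr /= subnn expr0 mulr1.
  have -> : G`_n = 1 by move/monicP: mG; rewrite lead_coefE sG.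
  rewrite mul1r addrC => /eqP; rewrite addr_eq0 => /eqP ->.
  rewrite dvdpNr; elim/big_ind: _ => [|x y|k _]; [exact: dvdp0|exact: dvdp_add|].
  by apply: dvdp_mull; rewrite -(subnSK (ltn_ord k)) exprS dvdp_mulr.
have cop' : coprimep b' (a' ^+ n) by rewrite coprimep_expr // coprimep_sym.
move=> dv; have /coprimepP/(_ b' (dvdpp _) dv) := cop'.
move=> /eqpP[[c1 c2] /= /andP[c10 c20] e].
exists ((c2^-1 * c1) *: a').
have b'E : b' = (c1^-1 * c2)%:P.
  by rewrite -[b']scale1r -(mulVf c10) -scalerA e scalerA alg_polyC.
rewrite -ga -gb b'E -scalerAr -mul_polyC !mulrA -polyCM.
have -> : c2^-1 * c1 * (c1^-1 * c2) = 1 by field; rewrite c10 c20.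
by rewrite mul1r mulrC.
Qed.

Section IntegrallyClosedPoly.
Variables (K : closedFieldType) (A : idomainType) (i : {rmorphism K -> A}).

(** In [Q = Q1 * ('X - c) + Q(c)] the value of [Q1] at another constant [c'] is [Q(c') - Q(c)]
    divided by the unit [c' - c]. So [Q1], of smaller degree, inherits the hypothesis away from
    [c]. *)
Lemma poly_dvd_values (s : A) (Q : {poly A}) (bad : seq K) :
  (forall c, c \notin bad -> exists y, Q.[i c] = s * y) -> exists Q', Q = s *: Q'.
Proof.
have [n] := ubnP (size Q); elim: n Q bad => // n IH Q bad lt hQ.
have [c hc] := closed_field_fresh bad.
have [y hy] := hQ c hc.
have /factor_theorem[Q1 hQ1] : root (Q - (Q.[i c])%:P) (i c).
  by rewrite rootE !hornerE subrr.
have QE : Q = Q1 * ('X - (i c)%:P) + (Q.[i c])%:P by rewrite -hQ1 subrK.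
have [Q10|Q10] := eqVneq Q1 0.
  by exists y%:P; rewrite QE Q10 mul0r add0r hy -mul_polyC -polyCM.
have [||Q1' hQ1'] := IH Q1 (c :: bad).
- rewrite -ltnS; apply: leq_trans lt; rewrite QE size_polyDl; last first.
    rewrite size_Mmonic ?monicXsubC // size_XsubC addn2 /=.
    apply: leq_ltn_trans (size_polyC_leq1 _) _; by rewrite ltnS size_poly_gt0.
  by rewrite size_Mmonic ?monicXsubC // size_XsubC addn2.
- move=> c'; rewrite inE negb_or => /andP[cc' /hQ[y' hy']].
  have cc0 : c' - c != 0 by rewrite subr_eq0.
  exists (i (c' - c)^-1 * (y' - y)).
  have e : Q1.[i c'] * i (c' - c) = s * (y' - y).
    by rewrite mulrBr -hy' -hy QE !hornerE subrr mulr0 add0r rmorphB addrK.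
  by rewrite mulrCA -e mulrCA -rmorphM mulVf // rmorph1 mulr1.
exists (Q1' * ('X - (i c)%:P) + y%:P).
by rewrite {1}QE hQ1' -scalerAl scalerDr hy -(mul_polyC _ (y%:P)) -polyCM.
Qed.

(** A quotient integral over [A[X]] is a polynomial over the fraction field of [A]. Its values at
    constants of [K] are integral over [A], hence in [A], and interpolation brings its coefficients
    into [A]; no factorization theory is involved. *)
Lemma integrally_closed_poly : integrally_closed A -> integrally_closed {poly A}.
Proof.
move=> nA a b G b0 mG rel; set n := (size G).-1 in rel.
have sG : size G = n.+1 by rewrite /n prednK // size_poly_gt0 monic_neq0.
pose t : {rmorphism {poly A} -> {poly {fraction A}}} := map_poly (@tofrac A).
have tinj : injective t.
  move=> p q /polyP h; apply/polyP => k; apply: tofrac_inj.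
  by have := h k; rewrite !coef_map.
have tX : t 'X = 'X by exact: map_polyX.
have tC c : t c%:P = (tofrac c)%:P by exact: map_polyC.
have tZ c p : t (c *: p) = tofrac c *: t p by exact: map_polyZ.
have tb0 : t b != 0 by rewrite -(rmorph0 t) (inj_eq tinj).
have [|Q hQ] := @integrally_closed_poly_field {fraction A} (t a) (t b) (map_poly t G) tb0 (monic_map _ mG).
  rewrite size_map_inj_poly ?rmorph0 // -[RHS](rmorph0 t) -rel rmorph_sum; apply: eq_bigr => k _.
  by rewrite coef_map !rmorphM !rmorphXn.
have [s [s0 [Q' hQ']]] : exists s : A, s != 0 /\ exists Q', (tofrac s) *: Q = t Q'.
  elim/poly_ind: Q {hQ} => [|Q c [s [s0 [Q' hQ']]]].
    by exists 1; rewrite oner_neq0; split=> //; exists 0; rewrite rmorph0 scaler0.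
  have [u [v [v0 cE]]] := fraction_repr c.
  exists (s * v); rewrite mulf_neq0 //; split=> //.
  exists ((v *: Q') * 'X + (s * u)%:P).
  rewrite (rmorphD t) (rmorphM t) tX tC tZ -hQ' scalerDr scalerAl scalerA; congr (_ * _ + _).
    by rewrite (rmorphM (@tofrac A)) mulrC.
  rewrite -mul_polyC -polyCM cE; congr (_%:P); rewrite !(rmorphM (@tofrac A)); field.
  by rewrite tofrac_eq0.
have sab : s%:P * a = b * Q'.
  by apply: tinj; rewrite !(rmorphM t) hQ -hQ' tC -mul_polyC; ring.
have relQ : \sum_(k < size G) G`_k * Q' ^+ k * s%:P ^+ (n - k) = 0.
  have bn : b ^+ n != 0 by rewrite expf_neq0.
  apply: (mulfI bn); rewrite mulr0 -[RHS](mulr0 (s%:P ^+ n)) -[X in _ = _ * X]rel !mulr_sumr.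
  apply: eq_bigr => k _.
  have kn : (k <= n)%N by rewrite -ltnS -sG.
  have -> : b ^+ n = b ^+ k * b ^+ (n - k) by rewrite -exprD subnKC.
  have -> : s%:P ^+ n = s%:P ^+ k * s%:P ^+ (n - k) by rewrite -exprD subnKC.
  have : (b * Q') ^+ k = (s%:P * a) ^+ k by rewrite sab.
  rewrite !exprMn => e.
  transitivity (G`_k * (b ^+ k * Q' ^+ k) * b ^+ (n - k) * s%:P ^+ (n - k)); first by ring.
  by rewrite e; ring.
have [|Q'' hQ''] := @poly_dvd_values s Q' [::].
  move=> c _; apply: (nA _ _ (map_poly (horner_eval (i c)) G) s0); first exact: monic_map.
  rewrite size_map_poly_id0; last by rewrite (monicP mG) /horner_eval hornerC oner_eq0.
  rewrite -[RHS](horner0 (i c)) -relQ horner_sum; apply: eq_bigr => k _.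
  by rewrite coef_map !hornerM !horner_exp hornerC.
exists Q''; apply: (mulfI (_ : s%:P != 0)); first by rewrite polyC_eq0.
by rewrite sab hQ'' -mul_polyC mulrCA.
Qed.

End IntegrallyClosedPoly.

Lemma integrally_closed_mpoly (K : closedFieldType) n : integrally_closed {mpoly K[n]}.
Proof.
elim: n => [|n IH] a b G b0 mG rel.
  have := nvar0_mpolyC b; set c := b@_0%MM => bE.
  exists (c^-1 *: a); rewrite bE -scalerAr mul_mpolyC scalerA mulVf ?scale1r //.
  by apply: contraNneq b0 => c0; rewrite bE c0.
have [g gK] := muni_retract K n.
have mb0 : muni b != 0 by apply: contraNneq b0 => h; rewrite -[b]gK h rmorph0.
have [|q hq] := integrally_closed_poly (@mpolyC n K) IH
  (a := muni a) mb0 (monic_map (@muni n K) mG).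
  rewrite size_map_poly_id0; last by rewrite (monicP mG) rmorph1 oner_eq0.
  rewrite -[RHS](rmorph0 (@muni n K)) -rel rmorph_sum; apply: eq_bigr => k _.
  by rewrite coef_map !rmorphM !rmorphXn.
by exists (g q); rewrite -[a]gK hq rmorphM gK.
Qed.

Lemma integral_bigsum (R S : comNzRingType) (f : {rmorphism R -> S}) I (r : seq I) (G : I -> S) :
  (forall j, integralOver f (G j)) -> integralOver f (\sum_(j <- r) G j).
Proof.
by move=> h; elim/big_ind: _ => //; [apply: integral0|move=> *; apply: integral_add].
Qed.

Lemma integral_bigprod (R S : comNzRingType) (f : {rmorphism R -> S}) I (r : seq I) (G : I -> S) :
  (forall j, integralOver f (G j)) -> integralOver f (\prod_(j <- r) G j).
Proof.
by move=> h; elim/big_ind: _ => //; [apply: integral1|move=> *; apply: integral_mul].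
Qed.

Lemma integral_exp (R S : comNzRingType) (f : {rmorphism R -> S}) x n :
  integralOver f x -> integralOver f (x ^+ n).
Proof.
move=> h; elim: n => [|n IH]; first exact: integral1.
by rewrite exprS; apply: integral_mul.
Qed.

Lemma integral_mmap (K R S : comNzRingType) (f : {rmorphism R -> S}) (i : {rmorphism K -> S})
    n (q : 'I_n -> S) (p : {mpoly K[n]}) :
  (forall c, integralOver f (i c)) -> (forall j, integralOver f (q j)) ->
  integralOver f (mmap i q p).
Proof.
move=> hi hq; apply: integral_bigsum => m; apply: integral_mul => //.
by apply: integral_bigprod => j; apply: integral_exp.
Qed.

Section MonicMinimal.
Variables (K F : fieldType) (iF : {rmorphism K -> F}) (A : idomainType).
Variables (ev : {rmorphism A -> F}) (ev_inj : injective ev).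
Let D z := exists a, z = ev a.
Hypothesis hD : subalgebra iF D.

(** The conjugates of [x] in a splitting field satisfy the same monic equation, so the normalized
    coefficients of [f] are integral over [A]; lying in its fraction field, they come from [A]. *)
Lemma monic_minimal_annihilator x : integrally_closed A -> integralOver ev x ->
  exists2 f, minimal_annihilator D f x & f \is monic.
Proof.
move=> icA [G mG /eqP Gx].
have evz a : (ev a == 0) = (a == 0) by rewrite -(rmorph0 ev) (inj_eq ev_inj).
pose G' := map_poly ev G.
have mG' : G' \is monic by apply: monic_map.
have DG' : coefs_in D G' by move=> k; rewrite coef_map; exists G`_k.
have [f fmin] := minimal_annihilator_exists (monic_neq0 mG') DG' Gx.
have [f0 hf fx min] := fmin.
have [n [h [r [hh hr e sr]]]] := pseudo_division hD f0 DG' hf.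
have r0 : r = 0.
  apply: min => //; move: e => /(congr1 (fun q => q.[x])).
  by rewrite hornerZ Gx mulr0 hornerD hornerM fx mulr0 add0r.
have [E [j [_ [s js]]]] := finite_split f0.
have jz z : (j z == 0) = (z == 0) by apply: fmorph_eq0.
have lf0 : lead_coef f != 0 by rewrite lead_coef_eq0.
have sint y : y \in s -> integralOver (j \o ev : {rmorphism A -> E}) y.
  move=> ys; exists G => //.
  have : root (map_poly j f) y.
    by rewrite js rootZ ?jz // root_prod_XsubC.
  move=> /eqP fy; move: e => /(congr1 (map_poly j)).
  rewrite r0 addr0 rmorphM map_polyZ => /(congr1 (fun q => q.[y])).
  rewrite hornerM fy mulr0 hornerZ => /eqP; rewrite mulf_eq0 jz expf_eq0 (negbTE lf0) andbF /=.
  by rewrite /G' -map_poly_comp.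
have cint k : integralOver (j \o ev : {rmorphism A -> E}) (\prod_(y <- s) ('X - y%:P))`_k.
  elim: s {js} sint k => [_ k|y s IH sint k].
    by rewrite big_nil coef1; case: eqP => _; [apply: integral1|apply: integral0].
  rewrite big_cons mulrBl coefB coefXM mul_polyC coefZ.
  have hs : forall k, integralOver (j \o ev : {rmorphism A -> E}) (\prod_(y <- s) ('X - y%:P))`_k.
    by apply: IH => z zs; apply: sint; rewrite inE zs orbT.
  apply: integral_sub; first by case: eqP => _; [apply: integral0|apply: hs].
  by apply: integral_mul; [apply: sint; rewrite mem_head|apply: hs].
have [b hb] : D (lead_coef f) by apply: hf.
have b0 : b != 0 by rewrite -evz -hb.
have Dk k : D (f`_k / lead_coef f).
  have [a ha] := hf k.
  have [P mP rP] := cint k.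
  have zE : (\prod_(y <- s) ('X - y%:P))`_k = j (ev a) / j (ev b).
    have := congr1 (fun q : {poly E} => q`_k) js; rewrite coef_map coefZ /= -hb ha => ->.
    by rewrite mulrC mulKf // jz hb -?hb ?lead_coef_eq0.
  have [q hq] : exists q, a = b * q.
    apply: (icA _ _ P b0 mP); apply: ev_inj; apply: (fmorph_inj j); rewrite !rmorph0.
    rewrite !rmorph_sum.
    have bn : j (ev b) ^+ (size P).-1 != 0 by rewrite expf_neq0 // jz -hb.
    move/eqP: rP; rewrite zE horner_coef size_map_poly_id0; last first.
      by rewrite (monicP mP) rmorph1 oner_eq0.
    move=> /(congr1 (fun z => j (ev b) ^+ (size P).-1 * z)); rewrite mulr0 mulr_sumr => e'; rewrite -[RHS]e'.
    apply: eq_bigr => l _; rewrite coef_map /= !rmorphM !rmorphXn.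
    have ll : (l <= (size P).-1)%N.
      by rewrite -ltnS prednK // size_poly_gt0 monic_neq0.
    rewrite -{2}(subnKC ll) exprD expr_div_n.
    have bl : j (ev b) ^+ l != 0 by rewrite expf_neq0 // jz -hb.
    by field.
  by exists q; rewrite ha hq hb rmorphM mulrC mulKf // evz.
exists ((lead_coef f)^-1 *: f); last by rewrite monicE lead_coefZ mulVf.
split.
- by rewrite scaler_eq0 invr_eq0 negb_or lf0.
- by move=> k; rewrite coefZ mulrC.
- by rewrite hornerZ fx mulr0.
- by move=> g hg gx; rewrite size_scale ?invr_eq0 //; apply: min.
Qed.

End MonicMinimal.

Section Noether.
Variables (K : closedFieldType) (F : fieldType) (i : {rmorphism K -> F}).

Let top (R : comNzRingType) (P : {poly R}) d c := (size P <= d.+1)%N /\ P`_d = c.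

Let topM (R : comNzRingType) (P Q : {poly R}) d e c c' :
  top P d c -> top Q e c' -> top (P * Q) (d + e) (c * c').
Proof.
move=> [sP hP] [sQ hQ]; split.
  apply: leq_trans (size_polyMleq _ _) _.
  by case: (_ + _)%N (leq_add sP sQ) => // n; rewrite addSn addnS.
rewrite coefM (bigD1 (inord d)) //= inordK ?ltnS ?leq_addr // addKn hP hQ big1 ?addr0 //.
move=> [k lk] /= /eqP nk; have {}nk : k <> d by move=> e'; apply: nk; apply: val_inj; rewrite /= inordK // ltnS leq_addr.
have [lt|ge] := ltnP k d.
  rewrite [Q`_ _]nth_default ?mulr0 //; apply: leq_trans sQ _.
  by rewrite -addnBAC ?(ltnW lt) // -addn1 addnC leq_add2r subn_gt0.
rewrite nth_default ?mul0r //; apply: leq_trans sP _.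
by rewrite ltn_neqAle ge andbT; apply/eqP => e'; apply: nk.
Qed.

(** A linear change of coordinates suffices because [K] is infinite. The last clause records that
    the [y k] are linear combinations of the [q j] without constant term, so a maximal ideal that
    contains [q] contains [y]. *)
Lemma noether_normalization N (q : 'I_N -> F) : exists r (y : 'I_r -> F),
  [/\ injective (mmap i y), forall j, integralOver (mmap i y) (q j) &
    forall P : F -> Prop, P 0 -> (forall x z, P x -> P z -> P (x + z)) ->
      (forall c x, P x -> P (i c * x)) -> (forall j, P (q j)) -> forall k, P (y k)].
Proof.
elim: N q => [|N IH] q.
  exists 0, q; split=> [p p'||]; [|by case|by move=> P _ _ _ h; apply: h].
  rewrite [p]nvar0_mpolyC [p']nvar0_mpolyC !mmapC => /(fmorph_inj i) h.
  by rewrite h.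
case: (boolp.EM (injective (mmap i q))) => [qi|nqi].
  exists N.+1, q; split=> // j.
  by have := integral_id (mmap i q) 'X_j; rewrite /= mmapX mmap1U.
have [p p0 qp] : exists2 p, p != 0 & mmap i q p = 0.
  apply: boolp.contrapT => no; apply: nqi => p p' e; apply/eqP; rewrite -subr_eq0.
  apply: contra_notT no => h; exists (p - p') => //.
  by rewrite rmorphB /= e subrr.
pose d := (msize p).-1.
have dp : mdeg (mlead p) = d by rewrite /d -(mlead_deg p0).
pose pd := \sum_(m <- msupp p | mdeg m == d) p@_m *: 'X_[m].
(* The top form [pd] of the relation does not vanish in the direction [v]; along it the relation
   becomes, up to a constant, monic in the new coordinate [T]. *)
have [v hv] : exists v : 'I_N.+1 -> K, pd.@[v] != 0.
  apply: mpoly_nonroot; apply/eqP => /(congr1 (fun r => r@_(mlead p))).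
  rewrite mcoeff0 raddf_sum /= big_mkcond (bigD1_seq (mlead p)) ?msupp_uniq ?mlead_supp ?dp ?eqxx //=.
  rewrite mcoeffZ mcoeffX eqxx mulr1 big1 ?addr0.
    by move/eqP; rewrite mleadc_eq0 (negbTE p0).
  by move=> m nm; rewrite mcoeffZ mcoeffX (negbTE nm) mulr0 if_same.
have d0 : (0 < d)%N.
  rewrite lt0n; apply/eqP => d0; move/eqP: p0; apply; move: qp.
  have : (msize p <= 1)%N by move: d0; rewrite /d; case: (msize p) => [|[]].
  move=> /msize1_polyC ->; rewrite mmapC => /eqP; rewrite fmorph_eq0 => /eqP ->.
  by rewrite mpolyC0.
have [j0 vj0] : exists j0, v j0 != 0.
  apply: boolp.contrapT => no; move/eqP: hv; apply.
  rewrite raddf_sum big1 //= => m /eqP md; rewrite mevalZ mevalX.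
  have [k mk] : exists k, (m k != 0)%N.
    apply: boolp.contrapT => no'; move: d0; rewrite -md mdegE big1 // => k _.
    by apply/eqP; apply: contra_notT no' => h; exists k.
  rewrite (bigD1 k) //= (_ : v k = 0) ?expr0n ?(negbTE mk) ?mul0r ?mulr0 //.
  by apply/eqP; apply: contra_notT no => h; exists k.
have [T Tq] : exists T, q j0 = i (v j0) * T.
  by exists (q j0 / i (v j0)); rewrite mulrC divfK // fmorph_eq0.
pose q' k := q (lift j0 k) - i (v (lift j0 k)) * T.
pose h j : {poly {mpoly K[N]}} := (v j)%:MP%:P * 'X +
  (if unlift j0 j is Some k then ('X_k)%:P else 0).
pose P := mmap (polyC \o @mpolyC N K : {rmorphism _ -> _}) h p.
have PT : (map_poly (mmap i q') P).[T] = 0.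
  rewrite -qp.
  pose g : {rmorphism {mpoly K[N.+1]} -> F} := horner_eval T \o map_poly (mmap i q') \o
     mmap (polyC \o @mpolyC N K : {rmorphism _ -> _}) h.
  apply: (mpoly_rmorph_ext (f := g) (g := mmap i q)) => [c|j]; rewrite /g /=.
    by rewrite !mmapC /= map_polyC /= mmapC /horner_eval hornerC.
  rewrite !mmapX !mmap1U /h rmorphD rmorphM /= map_polyC map_polyX /= mmapC.
  rewrite /horner_eval !hornerE.
  case: unliftP => [k ->|->] /=.
    by rewrite map_polyC /= mmapX mmap1U hornerC /q' addrCA subrr addr0.
  by rewrite rmorph0 horner0 addr0.
have topP : top P d (pd.@[v])%:MP.
  have tm m : top (mmap1 h m) (mdeg m) (\prod_j v j ^+ m j)%:MP.
    rewrite /mmap1 mdegE rmorph_prod.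
    have : forall r : seq 'I_N.+1, top (\prod_(j <- r) h j ^+ m j) (\sum_(j <- r) m j)%N
       (\prod_(j <- r) (v j ^+ m j)%:MP_[N]).
      elim=> [|j r IHr]; first by rewrite !big_nil; split; rewrite ?size_poly1 ?coef1.
      rewrite !big_cons; apply: topM => // {IHr}.
      elim: (m j) => [|e IHe]; first by rewrite !expr0; split; rewrite ?size_poly1 ?coef1 ?mpolyC1.
      rewrite !exprS -add1n mpolyCM; apply: topM => //.
      split.
        apply: leq_trans (size_polyD _ _) _; rewrite geq_max.
        rewrite (leq_trans (size_polyMleq _ _)) /=; last first.
          by rewrite size_polyX addn2 /= ltnS size_polyC_leq1.
        case: unliftP => [k _|_]; last by rewrite size_poly0.
        exact: leq_trans (size_polyC_leq1 _) _.
      rewrite coefD coefMX /= coefC eqxx.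
      by case: unliftP => [k _|_]; rewrite ?coefC ?coef0 addr0.
    exact.
  have sizes m : m \in msupp p -> (mdeg m <= d)%N.
    by move=> /msize_mdeg_lt; rewrite /d; case: (msize p).
  have -> : pd.@[v] = \sum_(m <- msupp p | mdeg m == d) p@_m * \prod_j v j ^+ m j.
    by rewrite raddf_sum /=; apply: eq_bigr => m _; rewrite mevalZ mevalX.
  rewrite /P /mmap; split.
    rewrite big_seq; elim/big_ind: _ => [|x z sx sz|m mp]; first by rewrite size_poly0.
      by apply: leq_trans (size_polyD _ _) _; rewrite geq_max sx.
    rewrite /= mul_polyC; apply: leq_trans (size_scale_leq _ _) _.
    by have [sm _] := tm m; apply: leq_trans sm _; rewrite ltnS sizes.
  rewrite coef_sum [RHS]raddf_sum [RHS]big_mkcond /= big_seq [RHS]big_seq.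
  apply: eq_bigr => m /sizes; rewrite mul_polyC coefZ leq_eqVlt.
  have [sm cm] := tm m.
  case: eqP => [<- _|_ /= lt]; first by rewrite cm mpolyCM.
  by rewrite nth_default ?mulr0 //; apply: leq_trans sm _.
have [sP lP] := topP; set cc := pd.@[v] in hv lP.
pose P' := (cc^-1)%:MP_[N]%:P * P.
have lP' : P'`_d = 1 by rewrite /P' mul_polyC coefZ lP -mpolyCM mulVf // mpolyC1.
have mP' : P' \is monic.
  have sP' : size P' = d.+1.
    apply/eqP; rewrite eqn_leq {1}/P' mul_polyC (leq_trans (size_scale_leq _ _)) //=.
    rewrite ltnNge; apply/negP => /leq_sizeP/(_ d (leqnn d))/eqP.
    by rewrite lP' oner_eq0.
  by rewrite monicE lead_coefE sP' lP'.
have rP' : root (map_poly (mmap i q') P') T.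
  by rewrite rootE rmorphM hornerM PT mulr0.
have [r [y [yinj yint ygen]]] := IH q'.
have iint c : integralOver (mmap i y) (i c) by rewrite -(mmapC y i c); apply: (integral_id (mmap i y)).
have Tint : integralOver (mmap i y) T.
  apply: integral_root_monic (monic_map (mmap i q') mP') rP' _; apply/integral_poly => k.
  by rewrite coef_map; apply: integral_mmap.
exists r, y; split=> // [j|B B0 BD BZ hB].
  have [k ->|->] := unliftP j0 j; last by rewrite Tq; apply: integral_mul.
  have -> : q (lift j0 k) = q' k + i (v (lift j0 k)) * T by rewrite /q' subrK.
  by apply: integral_add; [apply: yint|apply: integral_mul].
have BT : B T.
  have -> : T = i (v j0)^-1 * q j0 by rewrite Tq fmorphV mulKf // fmorph_eq0.
  exact: BZ.
apply: ygen => // k; rewrite /q' -mulNr -rmorphN.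
by apply: (BD) => //; apply: BZ.
Qed.
End Noether.

Lemma finite_over_bounded_rank (K : closedFieldType) (E : fieldType)
    (j : {rmorphism {fraction {poly K}} -> E}) (i : {rmorphism K -> E}) :
  (forall c, i c = j (tofrac c%:P)) -> finite_over j ->
  exists D, bounded_rank i (j (tofrac 'X)) D.
Proof.
move=> ij [n [s hs]]; exists n => o.
have evE p : (map_poly i p).[j (tofrac 'X)] = j (tofrac p).
  elim/poly_ind: p => [|p c IH]; first by rewrite !rmorph0 horner0.
  rewrite !rmorphD !rmorphM /= map_polyX map_polyC !hornerE IH; congr (_ + _); apply: ij.
have [c hc] := boolp.choice (fun k => hs (o k)).
pose C := \matrix_(k < n.+1, l < n) c k l.
have ker0 : kermx C != 0.
  rewrite -mxrank_eq0 mxrank_ker subn_eq0 -ltnNge.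
  by apply: leq_ltn_trans (rank_leq_col C) _.
have [u hk0 uC] : exists2 u : 'rV_n.+1, u != 0 & u *m C = 0.
  apply: boolp.contrapT => no; move/eqP: ker0; apply; apply/row_matrixP => k.
  rewrite row0; apply/eqP; apply: contra_notT no => h.
  by exists (row k (kermx C)); rewrite // -row_mul mulmx_ker row0.
have [ab hab] := boolp.choice (fun k => fraction_repr (u 0 k)).
have [b hb] := boolp.choice hab.
pose B := \prod_k b k.
have B0 : B != 0 by apply/prodf_neq0 => k _; case: (hb k).
have ex k : exists p, tofrac p = tofrac B * u 0 k.
  have [bk0 ->] := hb k; exists (ab k * \prod_(l | l != k) b l).
  have -> : B = b k * \prod_(l | l != k) b l by rewrite /B (bigD1 k).
  move: (\prod_(l | l != k) b l) => z.
  rewrite !(rmorphM (@tofrac {poly K})).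
  have cancel (x1 x2 x3 : {fraction {poly K}}) : x1 != 0 -> x3 * x2 = x1 * x2 * (x3 / x1).
    by move=> x10; rewrite [x1 * x2]mulrC -mulrA (mulrCA x1) mulfV // mulr1 mulrC.
  by apply: cancel; rewrite tofrac_eq0.
have [p hp] := boolp.choice ex; exists p; split.
  apply: boolp.contrapT => no; move/eqP: hk0; apply; apply/rowP => k; rewrite [RHS]mxE.
  have pk : p k = 0 by apply/eqP; apply: contra_notT no => h; exists k.
  have := hp k; rewrite pk rmorph0 => /esym/eqP.
  by rewrite mulf_eq0 tofrac_eq0 (negbTE B0) => /eqP.
rewrite (eq_bigr (fun k => \sum_l j (tofrac B * (u 0 k * c k l)) * s l)); last first.
  move=> k _; rewrite evE hp hc mulr_sumr; apply: eq_bigr => l _.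
  by rewrite !rmorphM !mulrA.
rewrite exchange_big big1 // => l _; rewrite -mulr_suml -rmorph_sum -mulr_sumr.
have := congr1 (fun A : 'rV_n => A 0 l) uC; rewrite !mxE => e.
rewrite (eq_bigr (fun k => u 0 k * C k l)); last by move=> k _; rewrite mxE.
by rewrite e mulr0 rmorph0 mul0r.
Qed.

Section MmapSubalg.
Variables (K : closedFieldType) (E : fieldType) (i : {rmorphism K -> E}) (M : E -> Prop).
Hypothesis hM : proper_subalg i M.

Lemma subalg_mmap_sub n (y : 'I_n -> E) (a : {mpoly K[n]}) :
  (forall k, M (y k)) -> M (mmap i y a - i a.@[fun=> 0]).
Proof.
move=> hy; rewrite /meval /mmap raddf_sum -sumrB; apply: (subalg_sum hM) => m _.
rewrite /= rmorphM /= -mulrBr; apply: (subalgZ hM).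
rewrite /mmap1 rmorph_prod.
have : forall r : seq 'I_n, M (\prod_(k <- r) y k ^+ m k - \prod_(k <- r) i (0 ^+ m k)).
  elim=> [|k r IH]; first by rewrite !big_nil subrr; apply: (subalg0 hM).
  rewrite !big_cons; case: (m k) => [|e]; first by rewrite !expr0 rmorph1 !mul1r.
  rewrite expr0n rmorph0 mul0r subr0; apply: (subalgMr hM); first exact: (subalgX hM).
  apply: (local_ring_prod hM) => l _; apply: (local_ringX hM); exact: subalg_local.
exact.
Qed.

Lemma local_ring_mmap n (y : 'I_n -> E) (a : {mpoly K[n]}) :
  (forall k, M (y k)) -> local_ring i M (mmap i y a).
Proof. by move=> hy; exists (a.@[fun=> 0]); apply: subalg_mmap_sub. Qed.

Lemma subalg_mmap n (y : 'I_n -> E) (a : {mpoly K[n]}) :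
  (forall k, M (y k)) -> a.@[fun=> 0] = 0 -> M (mmap i y a).
Proof. by move=> hy a0; have := subalg_mmap_sub a hy; rewrite a0 rmorph0 subr0. Qed.

Lemma proper_subalg_image (E' : fieldType) (j : {rmorphism E -> E'}) :
  proper_subalg (j \o i : {rmorphism K -> E'}) (fun z => exists2 w, M w & z = j w).
Proof.
split.
- by exists 0; rewrite ?rmorph0 //; apply: (subalg0 hM).
- by move=> _ _ [a Ma ->] [b Mb ->]; exists (a + b); rewrite ?rmorphD //; apply: (subalgD hM).
- by move=> _ _ [a Ma ->] [b Mb ->]; exists (a * b); rewrite ?rmorphM //; apply: (subalgM hM).
- by move=> c _ [a Ma ->]; exists (i c * a); rewrite ?rmorphM //; apply: (subalgZ hM).
- move=> [w Mw e]; apply: (subalg1 hM); rewrite (_ : 1 = w) //.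
  by apply: (fmorph_inj j); rewrite rmorph1.
Qed.

End MmapSubalg.

Lemma partial_hom_extend_seq (K : closedFieldType) (F : fieldType) (iF : {rmorphism K -> F})
    (s : seq F) (D : F -> Prop) (v : F) :
  subalgebra iF D -> foldl (@adjoin F) D s v -> v != 0 ->
  exists2 s0, D s0 /\ s0 != 0 &
    forall (E : fieldType) (iE : {rmorphism K -> E}) (H : F -> E),
    partial_hom iF D iE H -> H s0 != 0 ->
    exists (E' : fieldType) (j : {rmorphism E -> E'}) (H' : F -> E'),
      [/\ finite_over j, partial_hom iF (foldl (@adjoin F) D s) (j \o iE) H',
          forall z, D z -> H' z = j (H z) & H' v != 0].
Proof.
elim: s D v => [|u s IH] D v hD /= Dv v0.
  exists v => // E iE H hH Hv; exists E, idfun, H; split=> //.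
  exact: finite_over_id.
have [s1 [Ds1 s10] h1] := IH _ v (adjoin_subalgebra hD u) Dv v0.
have [s0 hs0 h0] := partial_hom_extend hD Ds1 s10.
exists s0 => // E iE H hH Hs0.
have [E1 [j1 [H1 [f1 hH1 e1 Hs1]]]] := h0 E iE H hH Hs0.
have [E2 [j2 [H2 [f2 hH2 e2 Hv]]]] := h1 E1 _ H1 hH1 Hs1.
exists E2, (j2 \o j1 : {rmorphism E -> E2}), H2; split=> //.
- exact: finite_over_comp.
- by move=> z Dz; rewrite e2 ?e1 //; apply: (sub_adjoin hD).
Qed.

Lemma sub_adjoin_seq (K F : fieldType) (iF : {rmorphism K -> F}) (s : seq F) (D : F -> Prop) :
  subalgebra iF D -> [/\ subalgebra iF (foldl (@adjoin F) D s),
    forall z, D z -> foldl (@adjoin F) D s z & forall u, u \in s -> foldl (@adjoin F) D s u].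
Proof.
elim: s D => [|u s IH] D hD //=.
have [h1 h2 h3] := IH _ (adjoin_subalgebra hD u); split=> //.
- by move=> z Dz; apply: h2; apply: (sub_adjoin hD).
- move=> w; rewrite inE => /orP[/eqP ->|]; last exact: h3.
  by apply: h2; apply: (mem_adjoin hD).
Qed.

(** * Curve selection *)

Section CurveSelection.
Variables (K : closedFieldType) (F : fieldType) (iF : {rmorphism K -> F}).

(* Normalized part of [G] prime to ['X]; at a place centred at [y = 0], a root of a
   lift of [G] lies in the maximal ideal or kills this part. *)
Lemma monic_local_factor (G : {poly K}) : G \is monic ->
  exists (m : nat) (c : K) (h : {poly K}), [/\ c != 0, h`_0 = 1 & G = 'X^m * (c *: h)].
Proof.
move=> mG; have [m [q [GE q0]]] := polyX_factor (monic_neq0 mG).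
exists m, (q`_0), ((q`_0)^-1 *: q); split=> //; first by rewrite coefZ mulVf.
by rewrite scalerA mulfV // scale1r.
Qed.

(** The output is a curve through the centre of [MF0]: [H] restricts functions to it, the [q j] tend
    to 0 at the place [M], and [v] does not vanish identically. *)
Lemma curve_selection (MF0 : F -> Prop) (N : nat) (q : 'I_N -> F) (us : seq F) (v : F) :
  proper_subalg iF MF0 -> (forall j, MF0 (q j)) -> v != 0 ->
  (forall D, subalgebra iF D -> (forall u, u \in us -> D u) -> D v) ->
  exists (E : fieldType) (iE : {rmorphism K -> E}) (M : E -> Prop) (t : E) (n : nat)
    (D : F -> Prop) (H : F -> E),
    [/\ is_place iE M, [/\ t != 0, M t & bounded_rank iE t n],
        [/\ subalgebra iF D, partial_hom iF D iE H, forall j, D (q j) & forall u, u \in us -> D u],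
        forall j, M (H (q j)) & H v != 0].
Proof.
move=> hMF0 hq0 v0 hv.
have [MF pMF sub0] := place_exists hMF0.
have hq j : MF (q j) by apply/sub0/hq0.
have hMF : proper_subalg iF MF by case: pMF.
have [r [y [ev_inj qint ygen]]] := noether_normalization iF q.
have yM k : MF (y k).
  apply: ygen => //; [exact: (subalg0 hMF)|exact: (subalgD hMF)|exact: (subalgZ hMF)].
pose ev : {rmorphism {mpoly K[r]} -> F} := mmap iF y.
have evC c : ev c%:MP = iF c by rewrite /ev /= mmapC.
pose D0 z := exists a, z = ev a.
have hD0 : subalgebra iF D0.
  split; first by move=> c; exists c%:MP; rewrite evC.
    by move=> _ _ [a ->] [b ->]; exists (a + b); rewrite rmorphD.
  by move=> _ _ [a ->] [b ->]; exists (a * b); rewrite rmorphM.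
have iint c : integralOver ev (iF c) by rewrite -evC; apply: integral_id.
have ev0 a : (ev a == 0) = (a == 0) by rewrite -(rmorph0 ev) (inj_eq ev_inj).
(* the element [x] whose smallness forces all [q j] to be small *)
have /boolp.choice[G hG] j : exists G : {poly {mpoly K[r]}}, G \is monic /\ (map_poly ev G).[q j] = 0.
  by have [G mG /eqP rG] := qint j; exists G.
pose at0 : {rmorphism {mpoly K[r]} -> K} := meval (fun=> 0).
have /boolp.choice[m /boolp.choice[cst /boolp.choice[h hh]]] j := monic_local_factor (monic_map at0 (proj1 (hG j))).
(* Over the origin the equation of [q j] becomes ['X^m (cst *: h)], so [q j] is small there as soon
   as [b j] is a unit. At [MF] itself [q j] is small and [h] has constant term 1, whence [b j] has
   residue 1 and [x] is small. *)
pose b j := (map_poly iF (h j)).[q j].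
pose x := 1 - \prod_j b j.
have bM j : MF (b j - 1).
  have [_ h1 _] := hh j.
  by have := subalg_horner_sub pMF (h j) (hq j); rewrite h1 rmorph1.
have xM : MF x.
  have : MF (\prod_j b j - 1).
    elim/big_ind: _ => [|a c ha hc|j _]; last exact: bM.
      by rewrite subrr; apply: (subalg0 hMF).
    have -> : a * c - 1 = (a - 1) * c + (c - 1) by ring.
    apply: (subalgD hMF) => //; apply: (subalgMr hMF) => //.
    by exists 1; rewrite rmorph1.
  by move=> /(subalgN hMF); rewrite opprB.
have bint j : integralOver ev (b j).
  rewrite /b horner_coef; apply: integral_bigsum => k; rewrite coef_map.
  by apply: integral_mul; [apply: iint|apply: integral_exp; apply: qint].
have xint : integralOver ev x.
  by apply: integral_sub; [apply: integral1|apply: integral_bigprod].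
have [f fmin mf] := monic_minimal_annihilator ev_inj hD0 (@integrally_closed_mpoly K r) xint.
have [f0 hf fx _] := fmin.
have [a ha] := boolp.choice hf.
pose fA := \poly_(k < size f) a k.
have fE : f = map_poly ev fA.
  apply/polyP => k; rewrite coef_map coef_poly; case: ltnP => [_|sf]; first exact: ha.
  by rewrite nth_default //; apply/esym/(rmorph0 ev).
have sf1 : (0 < size f)%N by rewrite size_poly_gt0.
(* As [x] lies in [MF], so does the constant term of its equation; that term therefore vanishes at
   the origin. This produces a small root over the line. *)
have a00 : at0 (a 0) = 0.
  have : MF (ev (a 0)).
    have := fx; rewrite horner_coef -(prednK sf1) big_ord_recl expr0 mulr1 /= ha => /eqP.
    rewrite addr_eq0 => /eqP ->; apply: (subalgN hMF); apply: (subalg_sum hMF) => k _.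
    rewrite ha; apply: (subalgMl hMF); first exact: local_ring_mmap.
    exact: (subalgX hMF).
  move=> Ma; apply: (subalgC hMF).
  have := subalgB hMF Ma (subalg_mmap_sub hMF (a 0) yM); rewrite subKr; exact.
have [hD1s hD1sub hD1us] := sub_adjoin_seq (codom q ++ us) (adjoin_subalgebra hD0 x).
set D := foldl (@adjoin F) (adjoin D0 x) (codom q ++ us) in hD1s hD1sub hD1us.
have Dv : D v.
  by apply: hv => // u uus; apply: hD1us; rewrite mem_cat uus orbT.
(* The condition [v != 0] is pushed down to [s1] over the ring generated by [y] and [x], then to the
   polynomial [as_] in [y]; the direction [c] of the line is chosen off the zeros of [as_]. *)
have [s1 [Ds1 s10] ext] := partial_hom_extend_seq (adjoin_subalgebra hD0 x) Dv v0.
have [s [[as_ asE] s0] [w Dw sE]] := algebraic_divides hD0 fmin Ds1 s10.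
have as0 : as_ != 0 by rewrite -ev0 -asE.
have [c hc] := mpoly_nonroot as0.
pose i0 : {rmorphism K -> {fraction {poly K}}} := @tofrac {poly K} \o polyC.
pose T : {fraction {poly K}} := tofrac 'X.
pose line k : {poly K} := c k *: 'X.
pose eta k := tofrac (line k).
pose ev1 : {rmorphism {mpoly K[r]} -> {fraction {poly K}}} := mmap i0 eta.
have ev1E p : ev1 p = tofrac (mmap (@polyC K) line p).
  apply: (mpoly_rmorph_ext (f := mmap i0 eta) (g := @tofrac {poly K} \o mmap (@polyC K) line)) => [z|j] /=.
    by rewrite !mmapC.
  by rewrite !mmapX !mmap1U.
have ev1s : ev1 as_ != 0.
  rewrite ev1E tofrac_eq0; apply: contraNneq hc => /(congr1 (horner_eval 1)).
  rewrite rmorph0 => <-; apply/eqP.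
  apply: (mpoly_rmorph_ext (f := meval c) (g := horner_eval 1 \o mmap (@polyC K) line)) => [z|j] /=.
    by rewrite mmapC mevalC /horner_eval hornerC.
  by rewrite mevalXU mmapX mmap1U /horner_eval /line hornerZ hornerX mulr1.
have /boolp.choice[H0 hH0] z : exists e, forall p, z = ev p -> e = ev1 p.
  case: (boolp.EM (D0 z)) => [[p ->]|no]; last first.
    by exists 0 => p zp; exfalso; apply: no; exists p.
  by exists (ev1 p) => p' /ev_inj ->.
have H0E p : H0 (ev p) = ev1 p by apply: hH0.
have hH0' : partial_hom iF D0 i0 H0.
  split.
  - by move=> z; rewrite -evC H0E /ev1 /= mmapC.
  - by move=> _ _ [p ->] [p' ->]; rewrite -rmorphD !H0E rmorphD.
  - by move=> _ _ [p ->] [p' ->]; rewrite -rmorphM !H0E rmorphM.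
have mfA : fA \is monic.
  have sA : size fA = size f by rewrite fE size_map_inj_poly ?rmorph0.
  apply/monicP/ev_inj; rewrite rmorph1 -(monicP mf) !lead_coefE sA coef_poly.
  by rewrite prednK // leqnn ha.
have [E1 [j1 [fin1 [rs rsE]]]] := finite_split (monic_neq0 (monic_map ev1 mfA)).
rewrite (monicP (monic_map ev1 mfA)) rmorph1 scale1r in rsE.
pose i1 : {rmorphism K -> E1} := j1 \o i0.
(* The origin of the line; places of the successive extensions are taken above it. *)
have hM0 : proper_subalg i0 (fun z => exists2 p : {poly K}, p`_0 = 0 & z = tofrac p).
  split.
  - by exists 0; rewrite ?coef0 ?rmorph0.
  - by move=> _ _ [p p0 ->] [p' p0' ->]; exists (p + p'); rewrite ?rmorphD // coefD p0 p0' addr0.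
  - move=> _ _ [p p0 ->] [p' p0' ->]; exists (p * p'); rewrite ?rmorphM //.
    by rewrite coefM big_ord1 p0 mul0r.
  - move=> z _ [p p0 ->]; exists (z%:P * p); rewrite ?rmorphM //.
    by rewrite coefCM p0 mulr0.
  - move=> [p p0 /eqP]; rewrite -(rmorph1 (@tofrac {poly K})) tofrac_eq => /eqP p1.
    by move: p0; rewrite -p1 coef1 => /eqP; rewrite oner_eq0.
have [M1 pM1 sub1] := place_exists (proper_subalg_image hM0 j1).
have hM1 : proper_subalg i1 M1 by case: pM1.
have eta1 k : M1 (j1 (eta k)).
  apply: sub1; exists (eta k) => //; exists (line k) => //.
  by rewrite /line coefZ coefX mulr0.
have ev1j p : j1 (ev1 p) = mmap i1 (j1 \o eta) p.
  apply: (mpoly_rmorph_ext (f := j1 \o ev1) (g := mmap i1 (j1 \o eta))) => [z|j] /=.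
    by rewrite /ev1 /= !mmapC.
  by rewrite /ev1 /= !mmapX !mmap1U.
have f1E : map_poly j1 (map_poly ev1 fA) = map_poly (j1 \o ev1) fA by rewrite -map_poly_comp.
have rsO z : z \in rs -> local_ring i1 M1 z.
  move=> zrs; apply: (place_integral pM1 (p := map_poly (j1 \o ev1) fA)).
  - exact: monic_map.
  - by rewrite -f1E rsE root_prod_XsubC.
  - by move=> k; rewrite coef_map /= ev1j; apply: local_ring_mmap.
(* Up to sign the product of the roots is the constant term, which is small on the line; as [M1] is
   prime, one of the roots is small. *)
have [x' x'rs Mx'] : exists2 x', x' \in rs & M1 x'.
  have : M1 (\prod_(z <- rs) (0 - z)).
    have -> : \prod_(z <- rs) (0 - z) = j1 (ev1 (a 0)).
      have := congr1 (fun p : {poly E1} => p.[0]) rsE.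
      rewrite horner_prod f1E horner_coef0 coef_map coef_poly sf1 /= => ->.
      by apply: eq_bigr => z _; rewrite !hornerE.
    by rewrite ev1j; apply: subalg_mmap.
  move=> /(subalg_prime_prod hM1)[|z zrs Mz].
    by move=> z zrs; apply: (local_ringB hM1); [apply: (local_ring0 hM1)|apply: rsO].
  by exists z => //; move: (subalgN hM1 Mz); rewrite sub0r opprK.
pose jH0 z := j1 (H0 z).
have hjH0 : partial_hom iF D0 i1 jH0.
  case: hH0' => h1 h2 h3; split.
  - by move=> z; rewrite /jH0 h1.
  - by move=> z z' Dz Dz'; rewrite /jH0 h2 // rmorphD.
  - by move=> z z' Dz Dz'; rewrite /jH0 h3 // rmorphM.
have jHf : map_poly jH0 f = map_poly (j1 \o ev1) fA.
  apply/polyP => k; rewrite coef_map_id0 ?(partial_hom0 hjH0) // fE !coef_map.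
  by rewrite /jH0 H0E.
have [|H1 [hH1 H1E]] := partial_hom_adjoin hD0 hjH0 (u := x) (x := x').
  apply: (minimal_annihilator_kill hD0 fmin hjH0).
    by rewrite (monicP mf) (partial_hom1 hjH0) oner_eq0.
  by apply/rootP; rewrite jHf -f1E rsE root_prod_XsubC.
have H1D0 p : H1 (ev p) = j1 (ev1 p).
  rewrite -[ev p](hornerC _ x) H1E; last by apply: (coefs_inC hD0); exists p.
  by rewrite (partial_hom_polyC hjH0) hornerC /jH0 H0E.
have H1x : H1 x = x'.
  rewrite -[x in LHS]hornerX H1E; last exact: (coefs_inX hD0).
  suff -> : map_poly jH0 'X = 'X by rewrite hornerX.
  apply/polyP => k; rewrite coef_map_id0 ?(partial_hom0 hjH0) // !coefX.
  by case: eqP => _; rewrite ?(partial_hom0 hjH0) ?(partial_hom1 hjH0).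
have H1s1 : H1 s1 != 0.
  have : H1 s != 0 by rewrite asE H1D0 fmorph_eq0.
  by rewrite -sE (partial_homM hH1) // mulf_eq0 negb_or => /andP[].
have [E2 [j2 [H2 [fin2 hH2 ext2 H2v]]]] := ext E1 i1 H1 hH1 H1s1.
pose i2 : {rmorphism K -> E2} := j2 \o i1.
have {}hH2 : partial_hom iF D i2 H2 by [].
have [M2 pM2 sub2] := place_exists (proper_subalg_image hM1 j2).
have hM2 : proper_subalg i2 M2 by case: pM2.
have H2D0 p : H2 (ev p) = mmap i2 (j2 \o (j1 \o eta)) p.
  rewrite ext2; last by apply: (sub_adjoin hD0); exists p.
  rewrite H1D0 ev1j.
  apply: (mpoly_rmorph_ext (f := j2 \o mmap i1 (j1 \o eta)) (g := mmap i2 (j2 \o (j1 \o eta)))) => [z|j] /=.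
    by rewrite !mmapC.
  by rewrite !mmapX !mmap1U.
have eta2 k : M2 ((j2 \o (j1 \o eta)) k).
  by apply: sub2; exists (j1 (eta k)).
have H2x : M2 (H2 x).
  rewrite ext2; last exact: (mem_adjoin hD0).
  by apply: sub2; exists x' => //; rewrite H1x.
have Dq j : D (q j) by apply: hD1us; rewrite mem_cat codom_f.
have D0D p : D (ev p) by apply/hD1sub/(sub_adjoin hD0); exists p.
have H2horner (p : {poly F}) u : D u -> coefs_in D p ->
    H2 p.[u] = (map_poly H2 p).[H2 u].
  move=> Du hp.
  have sp : (size (map_poly H2 p) <= size p)%N by apply: size_poly.
  rewrite (horner_coef_wide _ sp) horner_coef (partial_hom_sum hD1s hH2); last first.
    by move=> k; apply: (subalgebraM hD1s) => //; apply: (subalgebraX hD1s).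
  apply: eq_bigr => k _; rewrite (partial_homM hH2) ?(partial_homX hD1s hH2) //.
    by rewrite coef_map_id0 // (partial_hom0 hH2).
  exact: (subalgebraX hD1s).
pose ev2 : {rmorphism {mpoly K[r]} -> E2} := mmap i2 (j2 \o (j1 \o eta)).
have mapev2 (p : {poly {mpoly K[r]}}) : map_poly H2 (map_poly ev p) = map_poly ev2 p.
  apply/polyP => k; rewrite coef_map_id0 ?(partial_hom0 hH2) // !coef_map.
  exact: H2D0.
have rootG j : (map_poly ev2 (G j)).[H2 (q j)] = 0.
  rewrite -mapev2 -H2horner //; last by move=> k; rewrite coef_map; apply: D0D.
  by have [_ ->] := hG j; rewrite (partial_hom0 hH2).
have OH2q j : local_ring i2 M2 (H2 (q j)).
  apply: (place_integral pM2 (p := map_poly ev2 (G j))).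
  - by apply: monic_map; case: (hG j).
  - exact/rootP.
  - by move=> k; rewrite coef_map; apply: local_ring_mmap.
have evi2 (p : {poly K}) j : H2 (map_poly iF p).[q j] = (map_poly i2 p).[H2 (q j)].
  rewrite H2horner //; last by move=> k; rewrite coef_map; apply: (subalgebraC hD1s).
  congr (_.[_]); apply/polyP => k; rewrite coef_map_id0 ?(partial_hom0 hH2) // !coef_map.
  exact: (partial_homC hH2).
have Db j : D (b j).
  rewrite /b horner_coef; apply: (subalgebra_sum hD1s) => k _; rewrite coef_map.
  by apply: (subalgebraM hD1s); [apply: (subalgebraC hD1s)|apply: (subalgebraX hD1s)].
have Ob j : local_ring i2 M2 (H2 (b j)).
  by rewrite /b evi2; apply: local_ring_horner.
(* Since [1 = x + prod b] and [x] stays small on the curve, no factor [b j] can be small. *)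
have nb j : ~ M2 (H2 (b j)).
  move=> Mb; apply: (subalg1 hM2).
  have -> : 1 = H2 x + \prod_k H2 (b k).
    have [-> Dp] : \prod_k H2 (b k) = H2 (\prod_k b k) /\ D (\prod_k b k).
      elim: (index_enum _) => [|k l [IH Dl]].
        by rewrite !big_nil (partial_hom1 hH2); split=> //; apply: (subalgebra1 hD1s).
      rewrite !big_cons IH (partial_homM hH2) //.
      by split=> //; apply: (subalgebraM hD1s).
    rewrite -(partial_homD hH2) //; last by apply/hD1sub/(mem_adjoin hD0).
    by rewrite /x subrK (partial_hom1 hH2).
  apply: (subalgD hM2) => //; rewrite (bigD1 j) //=; apply: (subalgMr hM2) => //.
  exact: (local_ring_prod hM2).
(* Modulo [M2] the coefficients of [G j] on the line may be replaced by their values at the origin.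
   The factor coming from [h j] is [b j], a unit, so the power of [q j] is small. *)
have H2q j : M2 (H2 (q j)).
  have [c0 h1 GE] := hh j.
  have : M2 ((map_poly i2 (map_poly at0 (G j))).[H2 (q j)]).
    rewrite -[_.[_]](subKr ((map_poly ev2 (G j)).[H2 (q j)])) rootG sub0r.
    apply: (subalgN hM2).
    have sG1 : (size (map_poly i2 (map_poly at0 (G j))) <= size (G j))%N.
      by apply: leq_trans (size_poly _ _) (size_poly _ _).
    have sG2 : (size (map_poly ev2 (G j)) <= size (G j))%N by apply: size_poly.
    rewrite -(rootG j) (horner_coef_wide _ sG1) (horner_coef_wide _ sG2) -sumrB.
    apply: (subalg_sum hM2) => k _; rewrite -mulrBl; apply: (subalgMr hM2).
      by rewrite !coef_map; apply: subalg_mmap_sub.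
    exact: (local_ringX hM2).
  rewrite GE (rmorphM (map_poly i2)) /= map_polyXn map_polyZ hornerM hornerXn hornerZ.
  move=> /(subalg_prime hM2)[| | |].
  - exact: (local_ringX hM2).
  - by apply: (local_ringM hM2); [apply: (local_ringC hM2)|apply: local_ring_horner].
  - elim: (m j) => [|e IH]; first by rewrite expr0 => /(subalg1 hM2).
    by rewrite exprS => /(subalg_prime hM2)[|||/IH] //; apply: (local_ringX hM2).
  - move=> Mh; exfalso; apply: (nb j); rewrite /b evi2.
    by move: (subalgZ hM2 (cst j)^-1 Mh); rewrite mulrA -rmorphM mulVf // rmorph1 mul1r.
have [n hn] := @finite_over_bounded_rank K E2 (j2 \o j1) i2 (fun=> erefl) (finite_over_comp fin1 fin2).
exists E2, i2, M2, (j2 (j1 T)), n, D, H2; split=> //.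
  split=> //; first by rewrite !fmorph_eq0 tofrac_eq0 polyX_eq0.
  apply: sub2; exists (j1 T) => //; apply: sub1; exists T => //; exists 'X => //.
  by rewrite coefX.
split=> //; move=> u uus; apply: hD1us; by rewrite mem_cat uus orbT.
Qed.

End CurveSelection.

(** The numerator [h] does not depend on [f]: an identity found in the fraction field can be
    evaluated at every point where the denominator survives. *)
Lemma mmap_common_denominator (K R : comNzRingType) (i : {rmorphism K -> R}) N
    (num : 'I_N -> R) (den : R) (p : {mpoly K[N]}) :
  exists n h, forall (S : fieldType) (f : {rmorphism R -> S}), f den != 0 ->
    f h = f den ^+ n * mmap (f \o i) (fun k => f (num k) / f den) p.
Proof.
pose P p := exists n h, forall (S : fieldType) (f : {rmorphism R -> S}), f den != 0 ->
    f h = f den ^+ n * mmap (f \o i : {rmorphism K -> S}) (fun k => f (num k) / f den) p.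
have PC c : P c%:MP by exists 0, (i c) => S f _; rewrite mmapC mul1r.
have PD a b : P a -> P b -> P (a + b).
  move=> [n [h e]] [n' [h' e']]; exists (n + n'), (den ^+ n' * h + den ^+ n * h') => S f fd.
  by rewrite !rmorphD !rmorphM !rmorphXn e // e' // exprD /=; ring.
have PM a b : P a -> P b -> P (a * b).
  move=> [n [h e]] [n' [h' e']]; exists (n + n'), (h * h') => S f fd.
  by rewrite !rmorphM e // e' // exprD /=; ring.
have PX k : P 'X_k.
  by exists 1, (num k) => S f fd; rewrite mmapX mmap1U expr1 mulrC divfK.
have : P p; last by [].
rewrite [p]mpolyE; elim/big_ind: _ => [||m _]; [by rewrite -mpolyC0|exact: (PD)|].
rewrite -mul_mpolyC; apply: (PM) => //; rewrite mpolyXE_id.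
elim/big_ind: _ => [||k _]; [by rewrite -mpolyC1|exact: (PM)|].
by elim: (m k) => [|e IH]; [rewrite expr0 -mpolyC1|rewrite exprS; apply: (PM)].
Qed.

(** * Expansions in a uniformizer *)

Section Expansion.
Variables (K : closedFieldType) (E : fieldType) (i : {rmorphism K -> E}).
Variables (M : E -> Prop) (pM : is_place i M).
Let hM : proper_subalg i M := proj1 pM.
Local Notation O := (local_ring i M).
Variables (pi : E) (pi0 : pi != 0) (Mpi : M pi) (divpi : forall x, M x -> O (x / pi)).
Local Notation ev p := (map_poly i p).[pi].

Lemma local_ring_expansion n z : O z -> exists p, O ((z - ev p) / pi ^+ n).
Proof.
elim: n z => [|n IH] z Oz.
  by exists 0; rewrite rmorph0 horner0 subr0 expr0 divr1.
have [c hc] := Oz; have [p hp] := IH _ (divpi hc).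
exists (c%:P + 'X * p); rewrite rmorphD rmorphM /= map_polyC map_polyX !hornerE.
have pin : pi ^+ n != 0 by rewrite expf_neq0.
have -> : (z - (i c + pi * ev p)) / pi ^+ n.+1 = ((z - i c) / pi - ev p) / pi ^+ n.
  by rewrite exprS; field; rewrite pi0 pin.
by [].
Qed.

(** A polynomial with small value at [pi] has no constant term, that term being the residue of the
    value. Orders at the place thus turn into divisibility by powers of ['X]. *)
Lemma polyX_dvd_of_value n (p : {poly K}) w : ev p = pi ^+ n * w -> O w ->
  exists2 q, p = 'X^n * q & ev q = w.
Proof.
elim: n p => [|n IH] p; first by move=> e Ow; exists p; rewrite ?mul1r // e mul1r.
move=> e Ow.
have p0 : p`_0 = 0.
  apply: (subalgC hM); have := subalg_horner_sub pM p Mpi.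
  have Mp : M (ev p).
    by rewrite e; apply: (subalgMr hM) => //; apply: (subalgX hM).
  by move=> /(subalgB hM Mp); rewrite subKr.
have [q pE] : exists q, p = q * 'X.
  have : root p 0 by rewrite rootE horner_coef0 p0.
  by move=> /factor_theorem[q ->]; exists q; rewrite subr0.
have [//|r qE re] := IH q _ Ow.
  apply: (mulIf pi0); move: e; rewrite pE rmorphM /= map_polyX hornerM hornerX => ->.
  by rewrite exprSr; ring.
by exists r => //; rewrite pE qE exprSr; ring.
Qed.

Lemma local_ring_scale z :
  (forall x, x != 0 -> O x -> exists k, O (x / pi ^+ k) /\ ~ M (x / pi ^+ k)) ->
  exists n, O (pi ^+ n * z).
Proof.
move=> ord; have [->|z0] := eqVneq z 0.
  by exists 0; rewrite mulr0; apply: (local_ring0 hM).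
have [Oz|Mz] := place_cases pM z; first by exists 0; rewrite mul1r.
have [||n [Ou Mu]] := ord z^-1; first by rewrite invr_eq0.
  exact: subalg_local.
exists n; have [|] := place_cases pM (pi ^+ n * z) => //.
by rewrite invfM mulrC => /Mu.
Qed.

Section Congruence.
Variable n : nat.
Let cong a b := [/\ O a, O b & O ((a - b) / pi ^+ n)].

Let congD a b a' b' : cong a b -> cong a' b' -> cong (a + a') (b + b').
Proof.
move=> [h1 h2 h3] [h1' h2' h3']; split; [exact: (local_ringD hM)|exact: (local_ringD hM)|].
by rewrite opprD addrACA mulrDl; apply: (local_ringD hM).
Qed.

Let congM a b a' b' : cong a b -> cong a' b' -> cong (a * a') (b * b').
Proof.
move=> [h1 h2 h3] [h1' h2' h3']; split; [exact: (local_ringM hM)|exact: (local_ringM hM)|].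
have -> : (a * a' - b * b') / pi ^+ n = (a - b) / pi ^+ n * a' + b * ((a' - b') / pi ^+ n) by ring.
by apply: (local_ringD hM); apply: (local_ringM hM).
Qed.

Let congC c : cong (i c) (i c).
Proof.
by split; rewrite ?subrr ?mul0r; [apply: (local_ringC hM)|apply: (local_ringC hM)|apply: (local_ring0 hM)].
Qed.

Let cong_det d (A B : 'M[E]_d) : (forall k l, cong (A k l) (B k l)) -> cong (\det A) (\det B).
Proof.
move=> h; rewrite /determinant.
elim/big_rec2: _ => [|s x y _ hxy]; first by rewrite -(rmorph0 i); apply: congC.
apply: congD => //; apply: congM.
  by rewrite -(rmorphN1 i) -rmorphXn; apply: congC.
elim/big_rec2: _ => [|k a b _ hab]; first by rewrite -(rmorph1 i); apply: congC.
exact: congM.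
Qed.

Lemma local_ring_det_cong d (A B : 'M[E]_d) :
  (forall k l, O (A k l)) -> (forall k l, O (B k l)) ->
  (forall k l, O ((A k l - B k l) / pi ^+ n)) ->
  O (\det A) /\ O ((\det A - \det B) / pi ^+ n).
Proof. by move=> hA hB h; have [] := @cong_det d A B (fun k l => And3 (hA k l) (hB k l) (h k l)). Qed.

Lemma local_ring_conj_cong d (A B : 'M[E]_d) (C : 'M[K]_d) :
  (forall k l, O (A k l)) -> (forall k l, O (B k l)) ->
  (forall k l, O ((A k l - B k l) / pi ^+ n)) ->
  forall k l, O (((A *m map_mx i C *m \adj A) k l - (B *m map_mx i C *m \adj B) k l) / pi ^+ n).
Proof.
move=> hA hB h k l; have c k' l' : cong (A k' l') (B k' l') by split.
suff : cong ((A *m map_mx i C *m \adj A) k l) ((B *m map_mx i C *m \adj B) k l) by case.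
rewrite !mxE; elim/big_rec2: _ => [|m x y _ hxy]; first by rewrite -(rmorph0 i); apply: congC.
apply: congD => //; apply: congM; rewrite !mxE.
  elim/big_rec2: _ => [|m' x' y' _ hxy']; first by rewrite -(rmorph0 i); apply: congC.
  by apply: congD => //; rewrite mxE; apply: congM.
rewrite /cofactor; apply: congM.
  by rewrite -(rmorphN1 i) -rmorphXn; apply: congC.
by apply: cong_det => k' l'; rewrite !mxE.
Qed.

End Congruence.
End Expansion.

Section PartialHomMatrix.
Variables (K F : fieldType) (iF : {rmorphism K -> F}) (D : F -> Prop).
Hypothesis hD : subalgebra iF D.

Lemma subalgebra_prod I (r : seq I) (G : I -> F) : (forall k, D (G k)) -> D (\prod_(k <- r) G k).
Proof.
by move=> hG; elim/big_ind: _ => //; [apply: (subalgebra1 hD)|apply: (subalgebraM hD)].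
Qed.

Lemma subalgebra_det d (A : 'M[F]_d) : (forall k l, D (A k l)) -> D (\det A).
Proof.
move=> hA; apply: (subalgebra_sum hD) => s _; apply: (subalgebraM hD).
  by rewrite -(rmorphN1 iF) -rmorphXn; apply: (subalgebraC hD).
exact: subalgebra_prod.
Qed.

Variables (E : fieldType) (iE : {rmorphism K -> E}) (H : F -> E).
Hypothesis hH : partial_hom iF D iE H.

Lemma partial_hom_prod I (r : seq I) (G : I -> F) : (forall k, D (G k)) ->
  H (\prod_(k <- r) G k) = \prod_(k <- r) H (G k).
Proof.
move=> hG; elim: r => [|k r e]; first by rewrite !big_nil (partial_hom1 hH).
by rewrite !big_cons (partial_homM hH) ?e //; apply: subalgebra_prod.
Qed.

Lemma partial_hom_det d (A : 'M[F]_d) : (forall k l, D (A k l)) ->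
  H (\det A) = \det (map_mx H A).
Proof.
move=> hA; have Dp (s : {perm 'I_d}) : D (\prod_k A k (s k)) by apply: subalgebra_prod.
have Ds (b : bool) : D ((-1) ^+ b).
  by rewrite -(rmorphN1 iF) -rmorphXn; apply: (subalgebraC hD).
rewrite /determinant (partial_hom_sum hD hH) => [|s]; last exact: (subalgebraM hD).
apply: eq_bigr => s _; rewrite (partial_homM hH) //.
rewrite -(rmorphN1 iF) -rmorphXn (partial_homC hH) rmorphXn rmorphN1; congr (_ * _).
rewrite partial_hom_prod //; by apply: eq_bigr => k _; rewrite mxE.
Qed.

Lemma partial_hom_mulmx m n p (A : 'M[F]_(m, n)) (B : 'M[F]_(n, p)) :
  (forall k l, D (A k l)) -> (forall k l, D (B k l)) ->
  map_mx H (A *m B) = map_mx H A *m map_mx H B.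
Proof.
move=> hA hB; apply/matrixP => k l; rewrite !mxE (partial_hom_sum hD hH).
  by apply: eq_bigr => j _; rewrite (partial_homM hH) // !mxE.
by move=> j; apply: (subalgebraM hD).
Qed.

End PartialHomMatrix.

(** * The generic triangular matrix *)

Section Generic.
Variables (K : closedFieldType) (L : falgType K) (d : nat) (mu nu : L -> 'M[K]_d).
Hypothesis mu_lin : forall (a : K) (x y : L), mu (a *: x + y) = a *: mu x + mu y.
Hypothesis nu_lin : forall (a : K) (x y : L), nu (a *: x + y) = a *: nu x + nu y.

Let basis (r : 'I_(\dim {: L})) : L := tnth (vbasis fullv) r.

Let lin_coord (rho : L -> 'M[K]_d) :
  (forall (a : K) (x y : L), rho (a *: x + y) = a *: rho x + rho y) ->
  forall x, rho x = \sum_r coord (vbasis fullv) r x *: rho (basis r).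
Proof.
move=> lin x.
have rho0 : rho 0 = 0.
  have := lin 1 0 0; rewrite !scale1r addr0 => /esym/eqP.
  by rewrite -subr_eq0 addrK => /eqP.
have rhoS I (s : seq I) (a : I -> K) (v : I -> L) :
    rho (\sum_(k <- s) a k *: v k) = \sum_(k <- s) a k *: rho (v k).
  by elim: s => [|k s IH]; rewrite ?big_nil // !big_cons lin IH.
rewrite {1}(coord_vbasis (memvf x)) rhoS; apply: eq_bigr => r _.
by rewrite /basis -tnth_nth.
Qed.

(** The last clause is [T mu T^-1 = nu + Q] with [Q] small, freed of the inverse. *)
Lemma place_degeneration :
  zariski_closure (fun nu' => exists2 g, Ud g & nu' =1 conj_act g mu) nu ->
  exists (E : fieldType) (i : {rmorphism K -> E}) (M : E -> Prop) (t : E) (n : nat)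
    (T : 'M[E]_d),
    [/\ is_place i M, [/\ t != 0, M t & bounded_rank i t n],
        forall k l : 'I_d, (l < k)%N -> T k l = 0, \det T != 0 &
        forall x, exists2 Q : 'M[E]_d, forall k l, M (Q k l) &
          T *m map_mx i (mu x) = (Q + map_mx i (nu x)) *m T].
Proof.
move=> cl.
pose n2 := #|{: 'I_d * 'I_d}|.
pose R := {mpoly K[n2]}.
(* The generic point of the triangular group: a variable exists for every position, and those on or
   above the diagonal are used. *)
pose T : 'M[R]_d := \matrix_(k, l) if (k <= l)%N then 'X_(enum_rank (k, l)) else 0.
pose toC : K -> R := @mpolyC n2 K.
pose at_ (g : 'M[K]_d) : {rmorphism R -> K} := meval (fun k => g (enum_val k).1 (enum_val k).2).
have at_C g c : at_ g (toC c) = c by rewrite /at_ /= mevalC.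
have at_T g : Ud g -> map_mx (at_ g) T = g.
  move=> [ug _]; apply/matrixP => k l; rewrite !mxE; case: leqP => [_|lt].
    by rewrite /at_ /= mevalXU enum_rankK.
  by rewrite rmorph0 ug.
have detT : \det T != 0.
  apply/eqP => /(congr1 (at_ 1%:M)); rewrite rmorph0 -det_map_mx at_T.
    by rewrite det1 => /eqP; rewrite oner_eq0.
  split; last exact: unitmx1.
  by move=> k l lt; rewrite mxE; case: eqP => // e; rewrite e ltnn in lt.
pose F := {fraction R}.
pose iF : {rmorphism K -> F} := @tofrac R \o @mpolyC n2 K.
pose TF : 'M[F]_d := map_mx (@tofrac R) T.
pose num r : 'M[R]_d := T *m map_mx toC (mu (basis r)) *m \adj T - \det T *: map_mx toC (nu (basis r)).
pose numk (k : 'I_#|{: coord_index L d}|) : R :=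
  let: (r, a, b) := enum_val k in num r a b.
pose q k : F := tofrac (numk k) / tofrac (\det T).
have dT0 : tofrac (\det T) != 0 :> F by rewrite tofrac_eq0.
pose Q r : 'M[F]_d := \matrix_(a, b) q (enum_rank (r, a, b)).
have QE r : map_mx (@tofrac R) (num r) = tofrac (\det T) *: Q r.
  apply/matrixP => a b; rewrite [LHS]mxE [RHS]mxE [Q r a b]mxE /q /numk enum_rankK.
  by rewrite [RHS]mulrC divfK.
have relT r : TF *m map_mx iF (mu (basis r)) = (Q r + map_mx iF (nu (basis r))) *m TF.
  have mapiF (A : 'M[K]_d) : map_mx iF A = map_mx (@tofrac R) (map_mx toC A).
    by apply/matrixP => a b; rewrite !mxE.
  have : num r *m T = \det T *: (T *m map_mx toC (mu (basis r)) - map_mx toC (nu (basis r)) *m T).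
    rewrite /num mulmxBl -(mulmxA _ (\adj T)) mul_adj_mx mul_mx_scalar scalerBr.
    by rewrite -scalemxAl.
  move=> /(congr1 (map_mx (@tofrac R))); rewrite map_mxM QE map_mxZ map_mxB !map_mxM -!mapiF.
  rewrite -scalemxAl => /(congr1 (fun A => (tofrac (\det T))^-1 *: A)).
  rewrite !scalerA mulVf // !scale1r => e.
  by rewrite mulmxDl e subrK.
(* The coordinates [q] of the generic [g mu g^-1 - nu] generate this subalgebra. If it contained
   [1], then [p - 1], shifted by [nu], would vanish on the orbit and take the value -1 at [nu],
   against membership in the closure. *)
pose MF z := exists2 p : {mpoly K[#|{: coord_index L d}|]}, p.@[fun=> 0] = 0 & z = mmap iF q p.
have hMF : proper_subalg iF MF.
  split.
  - by exists 0; rewrite ?meval0 ?mmap0.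
  - by move=> _ _ [p p0 ->] [p' p0' ->]; exists (p + p'); rewrite ?mevalD ?p0 ?p0' ?addr0 ?mmapD.
  - by move=> _ _ [p p0 ->] [p' p0' ->]; exists (p * p'); rewrite ?mevalM ?p0 ?mul0r ?rmorphM.
  - by move=> c _ [p p0 ->]; exists (c *: p); rewrite ?mevalZ ?p0 ?mulr0 ?mmapZ.
  - move=> [p p0 p1].
    pose shift k : {mpoly K[#|{: coord_index L d}|]} := 'X_k - (coords nu k)%:MP.
    pose p' := mmap (@mpolyC _ K) shift p - 1.
    have p'E w : p'.@[w] = p.@[fun k => w k - coords nu k] - 1.
      rewrite /p' mevalB meval1; congr (_ - _).
      apply: (mpoly_rmorph_ext (f := meval w \o mmap (@mpolyC _ K) shift)
         (g := meval (fun k => w k - coords nu k))) => [c|k] /=.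
        by rewrite mmapC !mevalC.
      by rewrite mmapX mmap1U mevalB !mevalXU mevalC.
    have : p'.@[coords nu] = 0.
      apply: cl => nu' [g Ug nu'E]; rewrite p'E.
      have [m [h hh]] := mmap_common_denominator (@mpolyC n2 K) numk (\det T) p.
      have h1 : h = \det T ^+ m.
        apply: tofrac_inj; rewrite hh // rmorphXn.
        have -> : mmap (@tofrac R \o @mpolyC n2 K) (fun k => tofrac (numk k) / tofrac (\det T)) p = 1.
          by rewrite p1.
        by rewrite mulr1.
      have dg : at_ g (\det T) = \det g by rewrite -det_map_mx at_T.
      have [_ gu] := Ug.
      have dg0 : \det g != 0 by move: gu; rewrite unitmxE unitfE.
      have := hh K (at_ g); rewrite dg => /(_ dg0).
      rewrite h1 rmorphXn dg => /(congr1 (fun z => z / \det g ^+ m)).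
      rewrite mulfV ?expf_neq0 // mulrAC mulfV ?expf_neq0 // mul1r => e.
      apply/eqP; rewrite subr_eq0; apply/eqP; rewrite [RHS]e.
      rewrite -[RHS]/(mmap _ _ _).
      transitivity (mmap (at_ g \o @mpolyC n2 K) (fun k => coords nu' k - coords nu k) p).
        by apply: eq_bigr => x _; congr (_ * _); rewrite /= mevalC.
      apply: eq_bigr => x _; congr (_ * _); apply: mmap1_eq => k.
      rewrite /coords /numk; case: (enum_val k) => [[r a] b].
      rewrite nu'E /conj_act /invmx gu /num !mxE rmorphB rmorphM at_C dg.
      rewrite mulrBl mulrAC mulfV // mul1r; congr (_ - _).
      have -> : at_ g (\sum_j (T *m map_mx toC (mu (basis r))) a j * (\adj T) j b) =
          (g *m mu (basis r) *m \adj g) a b.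
        have -> : \sum_j (T *m map_mx toC (mu (basis r))) a j * (\adj T) j b =
          (T *m map_mx toC (mu (basis r)) *m \adj T) a b by rewrite mxE.
        have mE (A : 'M[R]_d) : at_ g (A a b) = (map_mx (at_ g) A) a b by rewrite mxE.
        rewrite mE !map_mxM map_mx_adj at_T //; congr ((_ *m _ *m _) _ _).
        by apply/matrixP => x' y'; rewrite !mxE at_C.
      rewrite mxE mulr_suml; apply: eq_bigr => j _.
      by rewrite [X in _ * X = _]mxE /basis; ring.
    rewrite p'E; rewrite (meval_eq (v2 := fun=> 0)); last by move=> k; rewrite subrr.
    by rewrite p0 sub0r => /eqP; rewrite oppr_eq0 oner_eq0.
have qM k : MF (q k).
  by exists 'X_k; rewrite ?mevalXU // mmapX mmap1U.
pose us := codom (fun ab : 'I_d * 'I_d => TF ab.1 ab.2).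
have TFus a b : TF a b \in us by apply: (codom_f (fun ab => TF ab.1 ab.2) (a, b)).
have [||E [i [M [t [n [D [H [pM ht [hD hH Dq Du] Mq Hv]]]]]]]] :=
  @curve_selection K F iF MF _ q us (\det TF) hMF qM _ _.
- by rewrite det_map_mx.
- by move=> D hD Du; apply: (subalgebra_det hD) => a b; apply: Du.
have DTF a b : D (TF a b) by apply: Du.
have DQ r a b : D (Q r a b) by rewrite mxE.
have Hmap (A : 'M[K]_d) : map_mx H (map_mx iF A) = map_mx i A.
  by apply/matrixP => a b; rewrite !mxE (partial_homC hH).
have Dmap (A : 'M[K]_d) a b : D (map_mx iF A a b) by rewrite mxE; apply: (subalgebraC hD).
have relE r : map_mx H TF *m map_mx i (mu (basis r)) = (map_mx H (Q r) + map_mx i (nu (basis r))) *m map_mx H TF.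
  rewrite -!Hmap -(partial_hom_mulmx hD hH) // relT (partial_hom_mulmx hD hH) //.
    congr (_ *m _); apply/matrixP => a b; rewrite !mxE (partial_homD hH) //.
    exact: (subalgebraC hD).
  by move=> a b; rewrite mxE; apply: (subalgebraD hD).
exists E, i, M, t, n, (map_mx H TF); split=> //.
- move=> k l lt; rewrite !mxE leqNgt lt /= rmorph0; exact: (partial_hom0 hH).
- by rewrite -(partial_hom_det hD hH).
have hM : proper_subalg i M by case: pM.
move=> x; pose cx r := coord (vbasis fullv) r x.
exists (\sum_r i (cx r) *: map_mx H (Q r)).
  move=> k l; rewrite summxE; apply: (subalg_sum hM) => r _; rewrite !mxE.
  by apply: (subalgZ hM).
have mapsum (rho : L -> 'M[K]_d) :
    (forall (a : K) (x y : L), rho (a *: x + y) = a *: rho x + rho y) ->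
    map_mx i (rho x) = \sum_r i (cx r) *: map_mx i (rho (basis r)).
  move=> lin; rewrite (lin_coord lin) map_mx_sum; apply: eq_bigr => r _.
  by rewrite map_mxZ.
rewrite (mapsum _ mu_lin) (mapsum _ nu_lin) mulmx_sumr -big_split mulmx_suml.
by apply: eq_bigr => r _; rewrite /= -scalemxAr relE -scalerDr scalemxAl.
Qed.

End Generic.

(** * Polynomial degenerations *)

Section PolyDegeneration.
Variables (K : closedFieldType) (L : falgType K) (d : nat) (mu nu : L -> 'M[K]_d).
Hypothesis mu_lin : forall (a : K) (x y : L), mu (a *: x + y) = a *: mu x + mu y.
Hypothesis nu_lin : forall (a : K) (x y : L), nu (a *: x + y) = a *: nu x + nu y.

(* A one-parameter degeneration of [mu] to [nu] given by a polynomial matrix [g]: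
   [g mu g^-1] is defined at [0], where its value is [nu]. *)
Definition polynomial_degeneration (g : 'M[{poly K}]_d) (e : nat) (u : {poly K})
    (W : L -> 'M[{poly K}]_d) :=
  [/\ forall k l : 'I_d, (l < k)%N -> g k l = 0, \det g = 'X^e * u, u`_0 != 0,
      forall x, g *m map_mx polyC (mu x) *m \adj g = 'X^e *: W x &
      forall x k l, (W x k l)`_0 = u`_0 * nu x k l].

Lemma polynomial_degeneration_exists :
  zariski_closure (fun nu' => exists2 g, Ud g & nu' =1 conj_act g mu) nu ->
  exists g e u W, polynomial_degeneration g e u W.
Proof.
move=> /(place_degeneration mu_lin nu_lin)[E [i [M [t [n [T [pM [t0 Mt rk] triT dT relT]]]]]]].
have hM : proper_subalg i M by case: pM.
have [pi [pi0 Mpi divpi]] := place_uniformizer pM t0 Mt rk.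
have ord := place_order pM t0 Mt rk pi0 Mpi divpi.
have Opi k : local_ring i M (pi ^+ k).
  by apply: (local_ringX hM); apply: subalg_local.
have [S [OS triS dS relS]] : exists S : 'M[E]_d, [/\ forall k l, local_ring i M (S k l),
    forall k l : 'I_d, (l < k)%N -> S k l = 0, \det S != 0 &
    forall x, exists2 Q : 'M[E]_d, forall k l, M (Q k l) &
      S *m map_mx i (mu x) = (Q + map_mx i (nu x)) *m S].
  have [N hN] := boolp.choice (fun ab : 'I_d * 'I_d => local_ring_scale pM (T ab.1 ab.2) ord).
  pose B := (\sum_ab N ab)%N.
  exists (pi ^+ B *: T); split.
  - move=> k l; rewrite mxE.
    have le : (N (k, l) <= B)%N by rewrite /B (bigD1 (k, l)) //= leq_addr.
    rewrite -(subnK le) exprD -mulrA; by apply: (local_ringM hM) => //; apply: (hN (k, l)).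
  - by move=> k l lt; rewrite mxE triT // mulr0.
  - by rewrite detZ mulf_neq0 // !expf_neq0.
  - move=> x; have [Q hQ e] := relT x; exists Q => //.
    by rewrite -scalemxAl e scalemxAr.
have OdS : local_ring i M (\det S).
  have h k l : local_ring i M ((S k l - S k l) / pi ^+ 0).
    by rewrite subrr mul0r; apply: (local_ring0 hM).
  by have [] := local_ring_det_cong pM OS OS h.
have [e [Ow0 Mw0]] := ord _ dS OdS.
set w0 := \det S / pi ^+ e in Ow0 Mw0.
have pie : pi ^+ e != 0 by rewrite expf_neq0.
have dSE : \det S = pi ^+ e * w0 by rewrite mulrC divfK.
clearbody w0.
(* Precision [e.+1], one more than the order of the determinant, preserves that order and the
   leading residue; it also preserves the residue of the conjugate after division by [pi ^+ e]. *)
have [P hP] := boolp.choice (fun ab : 'I_d * 'I_d => local_ring_expansion pi0 divpi e.+1 (OS ab.1 ab.2)).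
pose g : 'M[{poly K}]_d := \matrix_(k, l) if (k <= l)%N then P (k, l) else 0.
pose ev : {rmorphism {poly K} -> E} := horner_eval pi \o map_poly i.
have evE p : ev p = (map_poly i p).[pi] by [].
have Oev p : local_ring i M (ev p) by rewrite evE; apply: local_ring_horner => //; apply: subalg_local.
pose G := map_mx ev g.
have OG k l : local_ring i M (G k l) by rewrite mxE.
have GS k l : local_ring i M ((G k l - S k l) / pi ^+ e.+1).
  rewrite mxE [g k l]mxE; case: leqP => [_|lt].
    rewrite -opprB mulNr; apply: (local_ringN hM); exact: (hP (k, l)).
  by rewrite rmorph0 triS // subrr mul0r; apply: (local_ring0 hM).
have evC (A : 'M[K]_d) : map_mx ev (map_mx polyC A) = map_mx i A.
  by apply/matrixP => k l; rewrite !mxE /= map_polyC /horner_eval hornerC.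
have small z : local_ring i M z -> M (z * pi) by move=> Oz; apply: (subalgMl hM).
have near_det : exists2 o, local_ring i M o & ev (\det g) = pi ^+ e * (w0 + pi * o).
  have [_ Oo] := local_ring_det_cong pM OG OS GS.
  exists ((\det G - \det S) / pi ^+ e.+1) => //.
  rewrite -det_map_mx mulrDr -dSE mulrA -exprSr mulrC.
  by rewrite -/G mulrC [pi ^+ _ * _]mulrC divfK ?expf_neq0 // addrC subrK.
have [o Oo dgE] := near_det.
have Ow : local_ring i M (w0 + pi * o).
  by apply: (local_ringD hM) => //; apply: (local_ringM hM) => //; apply: subalg_local.
have [u uE evu] := polyX_dvd_of_value pM pi0 Mpi dgE Ow.
have u0w0 : M (w0 - i u`_0).
  have := subalg_horner_sub pM u Mpi; rewrite evu => h.
  have -> : w0 - i u`_0 = w0 + pi * o - i u`_0 - o * pi by ring.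
  by apply: (subalgB hM) => //; apply: small.
have entry x k l : exists2 W : {poly K}, (g *m map_mx polyC (mu x) *m \adj g) k l = 'X^e * W &
    W`_0 = u`_0 * nu x k l.
  have [Q MQ eQ] := relS x.
  have SE : (S *m map_mx i (mu x) *m \adj S) k l = pi ^+ e * (w0 * (Q k l + i (nu x k l))).
    rewrite eQ -mulmxA mul_mx_adj mul_mx_scalar dSE 2!mxE [map_mx _ _ _ _]mxE.
    by rewrite mulrA.
  have Oc := local_ring_conj_cong pM (mu x) OG OS GS k l.
  set o' := (_ / pi ^+ e.+1) in Oc.
  have evW : ev ((g *m map_mx polyC (mu x) *m \adj g) k l) =
      pi ^+ e * (w0 * (Q k l + i (nu x k l)) + pi * o').
    have -> : ev ((g *m map_mx polyC (mu x) *m \adj g) k l) = (G *m map_mx i (mu x) *m \adj G) k l.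
      have mE (A : 'M[{poly K}]_d) : ev (A k l) = (map_mx ev A) k l by rewrite mxE.
      by rewrite mE !map_mxM map_mx_adj evC.
    rewrite mulrDr -SE mulrA -exprSr /o' [pi ^+ _ * _]mulrC divfK ?expf_neq0 //.
    by rewrite addrC subrK.
  have OW : local_ring i M (w0 * (Q k l + i (nu x k l)) + pi * o').
    apply: (local_ringD hM); last by apply: (local_ringM hM) => //; apply: subalg_local.
    apply: (local_ringM hM) => //; apply: (local_ringD hM); last exact: (local_ringC hM).
    exact: subalg_local.
  have [W WE evWE] := polyX_dvd_of_value pM pi0 Mpi evW OW.
  exists W => //; apply/eqP; rewrite -subr_eq0; apply/eqP; apply: (subalgC hM).
  have := subalg_horner_sub pM W Mpi; rewrite evWE => h.
  have -> : i (W`_0 - u`_0 * nu x k l) = w0 * Q k l + o' * pi + (w0 - i u`_0) * i (nu x k l)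
      - (w0 * (Q k l + i (nu x k l)) + pi * o' - i W`_0).
    by rewrite rmorphB rmorphM; ring.
  apply: (subalgB hM) => //; apply: (subalgD hM).
    by apply: (subalgD hM); [apply: (subalgMl hM)|apply: small].
  by apply: (subalgMr hM) => //; apply: (local_ringC hM).
have [W hW] : exists W : L -> 'M[{poly K}]_d, forall x k l,
    (g *m map_mx polyC (mu x) *m \adj g) k l = 'X^e * W x k l /\ (W x k l)`_0 = u`_0 * nu x k l.
  have /boolp.choice[f hf] (z : L * 'I_d * 'I_d) : exists w : {poly K},
     (g *m map_mx polyC (mu z.1.1) *m \adj g) z.1.2 z.2 = 'X^e * w /\ w`_0 = u`_0 * nu z.1.1 z.1.2 z.2.
    by have [w h1 h2] := entry z.1.1 z.1.2 z.2; exists w.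
  exists (fun x => \matrix_(k, l) f (x, k, l)) => x k l; rewrite mxE.
  exact: (hf (x, k, l)).
exists g, e, u, W; split.
- by move=> k l lt; rewrite mxE leqNgt lt.
- exact: uE.
- apply: contra_notN Mw0 => /eqP u0; move: u0w0; rewrite u0 rmorph0 subr0; exact.
- by move=> x; apply/matrixP => k l; rewrite [RHS]mxE; case: (hW x k l).
- by move=> x k l; case: (hW x k l).
Qed.

End PolyDegeneration.

(** * Coordinates for subspaces, triangular matrices, standard inclusions *)

Section LinearAlgebra.
Variable K : fieldType.

(** Supplies coordinates for the modules [X_l], which arise as subspaces but have to be given as
    matrix representations. *)
Lemma subspace_param (V : vectType K) (P : V -> Prop) :
  P 0 -> (forall c v w, P v -> P w -> P (c *: v + w)) ->
  exists x (f : 'cV[K]_x -> V), [/\ forall c v w, f (c *: v + w) = c *: f v + f w,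
    injective f & forall v, P v <-> exists w, v = f w].
Proof.
move=> P0 PD.
have [U [UP maxU]] : exists U : {vspace V}, (forall v, v \in U -> P v) /\
    forall U' : {vspace V}, (forall v, v \in U' -> P v) -> (\dim U' <= \dim U)%N.
  suff : forall n (U : {vspace V}), (\dim {:V} - \dim U < n)%N -> (forall v, v \in U -> P v) ->
      exists U : {vspace V}, (forall v, v \in U -> P v) /\
      forall U' : {vspace V}, (forall v, v \in U' -> P v) -> (\dim U' <= \dim U)%N.
    move=> /(_ _ 0%VS (ltnSn _)); apply; by move=> v; rewrite memv0 => /eqP ->.
  elim=> // n IH U lt UP.
  case: (boolp.EM (exists U' : {vspace V}, (forall v, v \in U' -> P v) /\ (\dim U < \dim U')%N)).
    move=> [U' [UP' lt']]; apply: (IH U') => //.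
    rewrite -ltnS; apply: leq_trans lt; rewrite ltnS ltn_sub2l //.
    by apply: leq_trans lt' _; apply/dimvS/subvf.
  move=> no; exists U; split=> // U' UP'; rewrite leqNgt; apply/negP => lt'.
  by apply: no; exists U'.
have PU v : P v -> v \in U.
  move=> Pv.
  have : (\dim (U + <[v]>) <= \dim U)%N.
    apply: maxU => z /memv_addP[a aU [b /vlineP[c ->] ->]].
    by rewrite addrC; apply: PD => //; apply: UP.
  move=> le; have /eqP -> : U == (U + <[v]>)%VS by rewrite eqEdim addvSl.
  by apply: (subvP (addvSr _ _)); apply: memv_line.
exists (\dim U), (fun w : 'cV[K]_(\dim U) => \sum_k w k 0 *: (vbasis U)`_k); split.
- move=> c v w; rewrite scaler_sumr -big_split; apply: eq_bigr => k _ /=.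
  by rewrite !mxE scalerDl scalerA.
- move=> v w e; apply/colP => k.
  have fr : free (vbasis U) := basis_free (vbasisP U).
  by rewrite -(coord_sum_free (fun k => v k 0) k fr) e coord_sum_free.
- move=> v; split=> [/PU vU|[w ->]].
    exists (\col_k coord (vbasis U) k v); rewrite {1}(coord_vbasis vU).
    by apply: eq_bigr => k _; rewrite mxE.
  by apply: UP; apply: memv_suml => k _; apply: memvZ; apply: vbasis_mem; rewrite mem_nth ?size_tuple.
Qed.

(** Yields the matrix of a linear map known only through a relation, for instance through its effect
    after an embedding. *)
Lemma linear_relation_matrix a b (R : 'cV[K]_a -> 'cV[K]_b -> Prop) :
  (forall w, exists z, R w z) ->
  (forall c w w' z z', R w z -> R w' z' -> R (c *: w + w') (c *: z + z')) ->
  (forall z, R 0 z -> z = 0) ->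
  exists A : 'M[K]_(b, a), (forall w, R w (A *m w)) /\ forall w z, R w z -> z = A *m w.
Proof.
move=> tot lin fct.
have uniq w z z' : R w z -> R w z' -> z = z'.
  move=> h h'; have := lin (-1) _ _ _ _ h h'; rewrite !scaleN1r !addNr => /fct/eqP.
  by rewrite addrC subr_eq0 => /eqP ->.
have R00 : R 0 0.
  by have [z hz] := tot 0; move: (hz); rewrite (fct z hz).
have [f hf] := boolp.choice (fun j => tot (delta_mx j 0)).
pose A := \matrix_(i, j) f j i 0.
have RA w : R w (A *m w).
  have -> : A *m w = \sum_j w j 0 *: f j.
    apply/colP => i; rewrite !mxE summxE; apply: eq_bigr => j _.
    by rewrite !mxE mulrC.
  have {1}-> : w = \sum_j w j 0 *: delta_mx j 0.
    rewrite {1}[w]matrix_sum_delta; apply: eq_bigr => j _; by rewrite big_ord1.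
  elim: (index_enum _) => [|j l IH]; first by rewrite !big_nil.
  by rewrite !big_cons; apply: lin.
exists A; split=> // w z Rwz; exact: uniq Rwz (RA w).
Qed.

End LinearAlgebra.

Section UpperTri.
Variable A : idomainType.

Lemma upper_det d (g : 'M[A]_d) : (forall k l : 'I_d, (l < k)%N -> g k l = 0) ->
  \det g = \prod_k g k k.
Proof.
move=> h; rewrite -det_tr det_trig; first by apply: eq_bigr => k _; rewrite mxE.
by apply/is_trig_mxP => k l lt; rewrite mxE h.
Qed.

(** The scalar [c] lets one statement serve the inverse and the adjugate. Rows are treated from the
    last one upwards. *)
Lemma upper_inverse d (g h : 'M[A]_d) c : (forall k l : 'I_d, (l < k)%N -> g k l = 0) ->
  \det g != 0 -> g *m h = c%:M -> forall k l : 'I_d, (l < k)%N -> h k l = 0.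
Proof.
move=> ug; rewrite (upper_det ug) => /prodf_neq0 dg gh.
suff key m : forall k l : 'I_d, (d - k <= m)%N -> (l < k)%N -> h k l = 0.
  by move=> k l; apply: (key d); apply: leq_subr.
elim: m => [|m IH] k l; first by rewrite leqn0 subn_eq0 leqNgt ltn_ord.
move=> le lt.
have /matrixP/(_ k l) := gh; rewrite !mxE -val_eqE /= gtn_eqF //.
rewrite (bigD1 k) //= big1 ?addr0 => [/eqP|j nj].
  by rewrite mulf_eq0 (negbTE (dg k _)) // => /eqP.
have [lj|lj|/val_inj ej] := ltngtP j k; last by rewrite ej eqxx in nj.
  by rewrite ug ?mul0r.
rewrite IH ?mulr0 //; last exact: ltn_trans lj.
by rewrite -ltnS; apply: leq_trans le; rewrite ltn_sub2l // (ltn_trans lj).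
Qed.

Lemma upper_mulmx d (g h : 'M[A]_d) : (forall k l : 'I_d, (l < k)%N -> g k l = 0) ->
  (forall k l : 'I_d, (l < k)%N -> h k l = 0) ->
  forall k l : 'I_d, (l < k)%N -> (g *m h) k l = 0.
Proof.
move=> hg hh k l lt; rewrite mxE big1 // => j _.
have [lj|lj] := ltnP j k; first by rewrite hg // mul0r.
by rewrite hh ?mulr0 // (leq_trans lt).
Qed.

End UpperTri.

(** Newton's iteration: replacing [us] by [us * (2 - us * u)] squares the error. *)
Lemma poly_inverse_mod (K : fieldType) (u : {poly K}) n : u`_0 != 0 ->
  exists us r : {poly K}, us * u = 1 + 'X^n * r.
Proof.
move=> u0; case: n => [|n].
  by exists 0, (-1); rewrite mul0r mul1r subrr.
elim: n => [|n [us [r e]]].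
  have : root ((u`_0)^-1 *: u - 1) 0.
    by rewrite rootE horner_coef0 coefB coefZ coef1 mulVf // subrr.
  move=> /factor_theorem[q]; rewrite subr0 => e.
  exists ((u`_0)^-1)%:P, q; rewrite mul_polyC expr1 mulrC -e addrC subrK //.
exists (us * (2%:R - us * u)), (- ('X^n * r ^+ 2)).
have -> : us * (2%:R - us * u) * u = us * u * (2%:R - us * u) by ring.
by rewrite e !exprS; ring.
Qed.

Lemma mulmx_cV_inj (K : pzSemiRingType) m n (A B : 'M[K]_(m, n)) :
  (forall w : 'cV_n, A *m w = B *m w) -> A = B.
Proof.
move=> h; apply/matrixP => i j.
by have := h (delta_mx j 0); rewrite -!colE => /colP/(_ i); rewrite !mxE.
Qed.

Section Inclusion.
Variables (K : fieldType) (d l : nat) (ld : (l <= d)%N).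

Definition std_incl : 'M[K]_(d, l) := \matrix_(i < d, j < l) (i == j :> nat)%:R.

Lemma std_inclE (v : 'cV[K]_l) (i : 'I_d) (j : 'I_l) :
  i = j :> nat -> (std_incl *m v) i 0 = v j 0.
Proof.
move=> ij; rewrite mxE (bigD1 j) //= mxE ij eqxx mul1r big1 ?addr0 // => k nk.
by rewrite mxE ij val_eqE eq_sym (negbTE nk) mul0r.
Qed.

Lemma std_incl0 (v : 'cV[K]_l) (i : 'I_d) : (l <= i)%N -> (std_incl *m v) i 0 = 0.
Proof.
move=> li; rewrite mxE big1 // => k _; rewrite mxE gtn_eqF ?mul0r //.
exact: leq_trans li.
Qed.

Lemma std_incl_inj (v w : 'cV[K]_l) : std_incl *m v = std_incl *m w -> v = w.
Proof.
move=> e; apply/colP => j; have := congr1 (fun z : 'cV_d => z (widen_ord ld j) 0) e.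
by rewrite (@std_inclE v _ j) // (@std_inclE w _ j).
Qed.

Lemma std_incl_onto (v : 'cV[K]_d) : (forall i : 'I_d, (l <= i)%N -> v i 0 = 0) ->
  exists w, v = std_incl *m w.
Proof.
move=> hv; exists (\col_j v (widen_ord ld j) 0); apply/colP => i.
have [li|li] := leqP l i; first by rewrite std_incl0 // hv.
rewrite (@std_inclE _ i (Ordinal li)) // mxE; congr (v _ 0); exact: val_inj.
Qed.

Lemma std_incl_sub_rep (L : falgType K) (mu : L -> 'M[K]_d) x : upper_tri (mu x) ->
  mu x *m std_incl = std_incl *m sub_rep mu l x.
Proof.
move=> um; apply/matrixP => i j.
have -> : (mu x *m std_incl) i j = mu x i (widen_ord ld j).
  rewrite mxE (bigD1 (widen_ord ld j)) //= mxE eqxx mulr1 big1 ?addr0 // => k nk.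
  by rewrite mxE (_ : (k == j :> nat) = false) ?mulr0 //; apply: contraNF nk => /eqP e; apply/eqP/val_inj.
have sE (k : 'I_l) : sub_rep mu l x k j = mu x (widen_ord ld k) (widen_ord ld j).
  rewrite mxE /mxnat; case: insubP => [a _ ea|]; last by rewrite (leq_trans (ltn_ord k)).
  case: insubP => [b _ eb|]; last by rewrite (leq_trans (ltn_ord j)).
  by congr (mu x _ _); apply: val_inj.
rewrite mxE; have [li|li] := leqP l i.
  rewrite um ?big1 //=; last exact: leq_trans li.
  by move=> k _; rewrite mxE gtn_eqF ?mul0r // (leq_trans _ li).
rewrite (bigD1 (Ordinal li)) //= mxE eqxx mul1r big1 ?addr0 => [|k nk].
  by rewrite sE; congr (mu x _ _); apply: val_inj.
by rewrite mxE (_ : (i == k :> nat) = false) ?mul0r //; apply: contraNF nk => /eqP e; apply/eqP/val_inj.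
Qed.

End Inclusion.

Lemma std_incl_incl (K : fieldType) d l : (l < d)%N ->
  std_incl K d l.+1 *m incl_mx K l = std_incl K d l.
Proof.
move=> ld; apply/matrixP => i j; rewrite !mxE.
rewrite (bigD1 (widen_ord (leqnSn l) j)) //= !mxE eqxx mulr1 big1 ?addr0 // => k nk.
rewrite !mxE (_ : (k == j :> nat) = false) ?mulr0 //.
by apply: contraNF nk => /eqP e; apply/eqP/val_inj.
Qed.

(** * From degenerations to exact sequences *)

(* The module [X_l], embedded in [(K^d)^s], with the two maps of the exact sequence. *)
Record level (K : fieldType) (L : falgType K) (d s l : nat) := Level {
  lv_dim : nat;
  lv_rep : L -> 'M[K]_lv_dim;
  lv_emb : 'cV[K]_lv_dim -> 'M[K]_(d, s);
  lv_a : 'M[K]_(lv_dim + l, lv_dim);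
  lv_b : 'M[K]_(l, lv_dim + l) }.
Arguments lv_emb {K L d s l} _ _.

Section Zwara.
Variables (K : fieldType) (L : falgType K) (d : nat) (mu nu : L -> 'M[K]_d).
Hypothesis hmu : triangular_rep mu.
Hypothesis hnu : triangular_rep nu.
Variables (g : 'M[{poly K}]_d) (e : nat) (u : {poly K}) (W : L -> 'M[{poly K}]_d).
Hypothesis ug : forall k l : 'I_d, (l < k)%N -> g k l = 0.
Hypothesis dg : \det g = 'X^e * u.
Hypothesis u0 : u`_0 != 0.
Hypothesis gW : forall x, g *m map_mx polyC (mu x) *m \adj g = 'X^e *: W x.
Hypothesis W0 : forall x k l, (W x k l)`_0 = u`_0 * nu x k l.

(** Exceeding [e] keeps ['I_s] inhabited even for [e = 0], as [lastc] requires; the extra power of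
    ['X] over ['X^e] is supplied explicitly in [fill]. *)
Let s := e.+1.
Let ga := \adj g.
Let muP x : 'M[{poly K}]_d := map_mx polyC (mu x).

Let un0 : u != 0.
Proof. by apply: contraNneq u0 => ->; rewrite coef0. Qed.
Let dg0 : \det g != 0.
Proof. by rewrite dg mulf_neq0 // monic_neq0 // monicXn. Qed.
Let gga : g *m ga = ('X^e * u)%:M.
Proof. by rewrite mul_mx_adj dg. Qed.
Let gag : ga *m g = ('X^e * u)%:M.
Proof. by rewrite mul_adj_mx dg. Qed.
Let uga : forall k l : 'I_d, (l < k)%N -> ga k l = 0.
Proof. exact: upper_inverse ug dg0 gga. Qed.
Let Xe0 : 'X^e != 0 :> {poly K}.
Proof. by rewrite monic_neq0 // monicXn. Qed.

Let uW x : forall k l : 'I_d, (l < k)%N -> W x k l = 0.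
Proof.
move=> k l lt; apply: (mulfI Xe0); rewrite mulr0.
have -> : 'X^e * W x k l = ('X^e *: W x) k l by rewrite mxE.
rewrite -gW upper_mulmx //; apply: upper_mulmx => // k' l' lt'.
by rewrite mxE; have [_ ->] := hmu.
Qed.

(** So [ga] intertwines [u^-1 W], which is [g mu g^-1], with [mu]; carrying [u] along avoids
    denominators. *)
Let gaW x : ga *m W x = u *: (muP x *m ga).
Proof.
apply/matrixP => k l; apply: (mulfI Xe0).
have E (A : 'M[{poly K}]_d) : 'X^e * A k l = ('X^e *: A) k l by rewrite mxE.
rewrite !E scalemxAr -gW !mulmxA gag scalerA -mul_scalar_mx.
by rewrite !mulmxA.
Qed.

Variables (us r : {poly K}) (usE : us * u = 1 + 'X^(s.+1) * r).

Implicit Types n : 'cV[{poly K}]_d.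
(* A polynomial vector [n] supported on the first [l] coordinates represents [low n] in [X_l],
   [(low n, top n)] in [X_l + M_l], and [at0 n] in [N_l]; [L] acts on [n] by [g mu g^-1], that is
   by [u^-1 W], which is replaced by [us W] as only the class modulo ['X^s.+1] matters. *)
Let low n : 'M[K]_(d, s) := \matrix_(i, k) ((ga *m n) i 0)`_k.
Let top n : 'cV[K]_d := \col_i ((ga *m n) i 0)`_s.
Let at0 n : 'cV[K]_d := \col_i (n i 0)`_0.
Let supp l n := forall i : 'I_d, (l <= i)%N -> n i 0 = 0.
Let shift (m : 'M[K]_(d, s)) : 'M[K]_(d, s) :=
  \matrix_(i, k) if (k : nat) is k'.+1 then m i (inord k') else 0.
Let lastc (m : 'M[K]_(d, s)) : 'cV[K]_d := col ord_max m.

Let scaleE c (v : 'cV[{poly K}]_d) i : (c *: v) i 0 = c * v i 0.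
Proof. by rewrite mxE. Qed.
Let lowE n i k : low n i k = ((ga *m n) i 0)`_k.
Proof. by rewrite mxE. Qed.
Let topE n i : top n i 0 = ((ga *m n) i 0)`_s.
Proof. by rewrite mxE. Qed.
Let lin_entry c (v v' : 'cV[{poly K}]_d) i k :
  ((c%:P *: v + v') i 0)`_k = c * (v i 0)`_k + (v' i 0)`_k.
Proof. by rewrite !mxE coefD coefCM. Qed.
Let low_lin c n n' : low (c%:P *: n + n') = c *: low n + low n'.
Proof.
apply/matrixP => i k; rewrite lowE mulmxDr -scalemxAr lin_entry.
by rewrite [RHS]mxE [(c *: low n) i k]mxE !lowE.
Qed.
Let top_lin c n n' : top (c%:P *: n + n') = c *: top n + top n'.
Proof.
apply/colP => i; rewrite topE mulmxDr -scalemxAr lin_entry.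
by rewrite [RHS]mxE [(c *: top n) i 0]mxE !topE.
Qed.
Let at0_lin c n n' : at0 (c%:P *: n + n') = c *: at0 n + at0 n'.
Proof. by apply/matrixP => i k; rewrite !mxE coefD coefCM. Qed.
Let supp_lin l c n n' : supp l n -> supp l n' -> supp l (c *: n + n').
Proof. by move=> h h' i li; rewrite !mxE h // h' // mulr0 addr0. Qed.

Let supp_mul l n (A : 'M[{poly K}]_d) : (forall k l : 'I_d, (l < k)%N -> A k l = 0) ->
  supp l n -> supp l (A *m n).
Proof.
move=> uA hn i li; rewrite mxE big1 // => j _.
have [lj|lj] := leqP l j; first by rewrite hn // mulr0.
by rewrite uA ?mul0r // (leq_trans lj).
Qed.

(** If ['X^(e+2)] divides [ga n], applying [g] shows that ['X^2] divides [u n], and [u] is a unit at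
    0. This makes the map [b] well defined. *)
Let at0_kill n : low n = 0 -> top n = 0 -> at0 n = 0.
Proof.
move=> l0 t0; apply/colP => i; rewrite !mxE.
have divX j : exists q, (ga *m n) j 0 = 'X^(s.+1) * q.
  exists (drop_poly s.+1 ((ga *m n) j 0)).
  rewrite -{1}(poly_take_drop s.+1 ((ga *m n) j 0)) mulrC -[RHS]add0r; congr (_ + _).
  apply/polyP => k; rewrite coef_take_poly coef0 ltnS leq_eqVlt.
  case: eqP => [->|_] /=; first by have /colP/(_ j) := t0; rewrite topE [RHS]mxE.
  case: ltnP => // lk; by have /matrixP/(_ j (Ordinal lk)) := l0; rewrite lowE [RHS]mxE.
have [q hq] := boolp.choice divX.
have /colP/(_ i) : 'X^e *: (u *: n) = 'X^e *: ('X^2 *: (g *m \col_j q j)).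
  rewrite !scalerA -mul_scalar_mx -gga -mulmxA -exprD addn2 scalemxAr; congr (_ *m _).
  by apply/colP => j; rewrite hq !mxE.
rewrite mxE [RHS]mxE => /(mulfI Xe0) /(congr1 (fun p : {poly K} => p`_0)).
rewrite mxE [in RHS]mxE coef0M [RHS]coefXnM /= => /eqP.
by rewrite mulf_eq0 (negbTE u0) => /eqP.
Qed.

Let low_X n : low ('X *: n) = shift (low n).
Proof.
apply/matrixP => i [k lk]; rewrite lowE -scalemxAr scaleE coefXM [RHS]mxE /=.
by case: k lk => [|k] lk //; rewrite lowE inordK // ltnW.
Qed.
Let top_X n : top ('X *: n) = lastc (low n).
Proof. by apply/colP => i; rewrite topE -scalemxAr scaleE coefXM [RHS]mxE lowE. Qed.
Let at0_X n : at0 ('X *: n) = 0.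
Proof. by apply/colP => i; rewrite !mxE coefXM. Qed.
Let at0_eq0 n : at0 n = 0 -> exists n', n = 'X *: n'.
Proof.
move=> h0; exists (\col_i drop_poly 1 (n i 0)); apply/colP => i; rewrite !mxE.
rewrite -{1}(poly_take_drop 1 (n i 0)) expr1 mulrC -[RHS]add0r; congr (_ + _).
apply/polyP => k; rewrite coef_take_poly coef0; case: k => // /=.
by have /colP/(_ i) := h0; rewrite !mxE.
Qed.
Let shift_inj m : shift m = 0 -> lastc m = 0 -> m = 0.
Proof.
move=> s0 l0; apply/matrixP => i k; rewrite [RHS]mxE.
have [ke|ke] := eqVneq k ord_max; first by have /colP/(_ i) := l0; rewrite !mxE ke.
have lk : (k.+1 < s)%N.
  by rewrite ltn_neqAle ltn_ord andbT; apply: contra ke => /eqP [e']; apply/eqP/val_inj.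
have /matrixP/(_ i (Ordinal lk)) := s0; rewrite !mxE /= => <-.
by congr (m i _); apply: val_inj; rewrite /= inordK // ltn_ord.
Qed.

Let act x n := us *: (W x *m n).
Let ga_act x n : ga *m act x n = (1 + 'X^(s.+1) * r) *: (muP x *m (ga *m n)).
Proof. by rewrite -scalemxAr mulmxA gaW -scalemxAl scalerA usE mulmxA. Qed.
Let coef_unit (p : {poly K}) k : (k <= s)%N -> ((1 + 'X^(s.+1) * r) * p)`_k = p`_k.
Proof. by move=> ks; rewrite mulrDl mul1r coefD -mulrA coefXnM ltnS ks addr0. Qed.
Let coef_muP x n (i : 'I_d) k : ((muP x *m n) i 0)`_k = (mu x *m \col_j (n j 0)`_k) i 0.
Proof. by rewrite !mxE coef_sum; apply: eq_bigr => j _; rewrite !mxE coefCM. Qed.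
Let low_act x n : low (act x n) = mu x *m low n.
Proof.
apply/matrixP => i k; rewrite lowE ga_act scaleE (coef_unit _ (ltnW (ltn_ord k))).
by rewrite coef_muP !mxE; apply: eq_bigr => j _; rewrite !mxE.
Qed.
Let top_act x n : top (act x n) = mu x *m top n.
Proof.
apply/colP => i; rewrite topE ga_act scaleE (coef_unit _ (leqnn s)).
by rewrite coef_muP !mxE; apply: eq_bigr => j _; rewrite !mxE.
Qed.
Let us0 : us`_0 * u`_0 = 1.
Proof.
have := congr1 (fun p : {poly K} => p`_0) usE.
by rewrite coef0M coefD coef1 coefXnM addr0.
Qed.
Let at0_act x n : at0 (act x n) = nu x *m at0 n.
Proof.
apply/colP => i; rewrite !mxE coef0M coef_sum mulr_sumr; apply: eq_bigr => j _.
by rewrite mxE coef0M W0 !mulrA us0 mul1r.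
Qed.
Let supp_act l x n : supp l n -> supp l (act x n).
Proof.
by move=> h i li; rewrite mxE (supp_mul (uW x) h) // mulr0.
Qed.

(** Its image under [ga] is ['X^s v] modulo ['X^(s+1)]: adding it changes the component in [M_l] at
    will and leaves the one in [X_l] alone. *)
Let fill (v : 'cV[K]_d) : 'cV[{poly K}]_d := us *: ('X *: (g *m map_mx polyC v)).
Let ga_fill v (i : 'I_d) : (ga *m fill v) i 0 = (1 + 'X^(s.+1) * r) * ('X^s * (v i 0)%:P).
Proof.
rewrite /fill -!scalemxAr mulmxA gag mul_scalar_mx !scalerA -usE !mxE exprS.
by ring.
Qed.
Let low_fill v : low (fill v) = 0.
Proof.
apply/matrixP => i k; rewrite lowE ga_fill (coef_unit _ (ltnW (ltn_ord k))).
by rewrite coefXnM ltn_ord [RHS]mxE.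
Qed.
Let top_fill v : top (fill v) = v.
Proof.
by apply/colP => i; rewrite topE ga_fill (coef_unit _ (leqnn s)) coefXnM ltnn subnn coefC.
Qed.
Let supp_fill l (v : 'cV[K]_d) : (forall i : 'I_d, (l <= i)%N -> v i 0 = 0) -> supp l (fill v).
Proof.
move=> hv i li; rewrite /fill !scaleE (supp_mul (l := l)) ?mulr0 // => j lj.
by rewrite mxE hv.
Qed.
Let supp_top l n : supp l n -> forall i : 'I_d, (l <= i)%N -> top n i 0 = 0.
Proof. by move=> h i li; rewrite topE (supp_mul uga h) // coef0. Qed.
Let supp_at0 l n : supp l n -> forall i : 'I_d, (l <= i)%N -> at0 n i 0 = 0.
Proof. by move=> h i li; rewrite mxE h // coef0. Qed.
Let supp_low l n : supp l n -> forall i : 'I_d, (l <= i)%N -> lastc (low n) i 0 = 0.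
Proof. by move=> h i li; rewrite /lastc mxE lowE (supp_mul uga h) // coef0. Qed.

(** The last two clauses say that every pair in [X_l + M_l] lifts to a polynomial vector and that
    [lv_b] is the value at 0 of any lift. Independence of the lift later gives compatibility between
    levels. *)
Let level_spec l (Y : level L d s l) :=
  [/\ forall c (v w : 'cV[K]_(lv_dim Y)), lv_emb Y (c *: v + w) = c *: lv_emb Y v + lv_emb Y w,
      injective (lv_emb Y),
      forall m, (exists w, m = lv_emb Y w) <-> (exists2 n, supp l n & m = low n),
      forall x (w : 'cV[K]_(lv_dim Y)), lv_emb Y (lv_rep Y x *m w) = mu x *m lv_emb Y w &
      (forall w : 'cV[K]_(lv_dim Y), lv_emb Y (usubmx (lv_a Y *m w)) = shift (lv_emb Y w) /\
         std_incl K d l *m dsubmx (lv_a Y *m w) = lastc (lv_emb Y w)) /\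
      (forall w : 'cV[K]_(lv_dim Y + l), exists n, [/\ supp l n, low n = lv_emb Y (usubmx w) &
         top n = std_incl K d l *m dsubmx w]) /\
      (forall (w : 'cV[K]_(lv_dim Y + l)) n, supp l n -> low n = lv_emb Y (usubmx w) ->
         top n = std_incl K d l *m dsubmx w -> std_incl K d l *m (lv_b Y *m w) = at0 n)].

Let level_exists l : (l <= d)%N -> exists Y : level L d s l, level_spec Y.
Proof.
move=> ld; set J := std_incl K d l.
have supp0 : supp l 0 by move=> i _; rewrite mxE.
have low0 : low 0 = 0 by apply/matrixP => i k; rewrite lowE mulmx0 !mxE coef0.
have [||x [f [f_lin f_inj f_im]]] := @subspace_param K 'M[K]_(d, s) (fun m => exists2 n, supp l n & m = low n).
- by exists 0.
- move=> c _ _ [n hn ->] [n' hn' ->]; exists (c%:P *: n + n'); first exact: supp_lin.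
  by rewrite low_lin.
have f0 : f 0 = 0.
  have := f_lin 1 0 0; rewrite !scale1r addr0 => /esym/eqP.
  by rewrite -subr_eq0 addrK => /eqP.
have f_low w : exists2 n, supp l n & f w = low n by apply/f_im; exists w.
have f_of n : supp l n -> exists w, low n = f w by move=> h; apply/f_im; exists n.
have shift_lin c m m' : shift (c *: m + m') = c *: shift m + shift m'.
  by apply/matrixP => i [[|k] lk]; rewrite !mxE /= ?mxE ?mulr0 ?addr0 ?mxE.
have lastc_lin c m m' : lastc (c *: m + m') = c *: lastc m + lastc m'.
  by apply/colP => i; rewrite !mxE.
have shift0 : shift 0 = 0 by apply/matrixP => i [[|k] lk]; rewrite !mxE /= ?mxE.
have lastc0 : lastc 0 = 0 by apply/colP => i; rewrite !mxE.
have Jinj v w : J *m v = J *m w -> v = w := @std_incl_inj K d l ld v w.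
have repx y : exists A : 'M[K]_x, forall w, f (A *m w) = mu y *m f w.
  have [|||A [hA _]] := @linear_relation_matrix K x x (fun w z => f z = mu y *m f w).
  - move=> w; have [n hn wE] := f_low w.
    have [z hz] := f_of _ (supp_act y hn); exists z; by rewrite -hz low_act wE.
  - by move=> c w w' z z' h h'; rewrite !f_lin h h' mulmxDr -scalemxAr.
  - by move=> z; rewrite f0 mulmx0 -f0 => /f_inj.
  by exists A.
have [X hX] := boolp.choice repx.
have [|||a [ha _]] := @linear_relation_matrix K x (x + l)
  (fun w z => f (usubmx z) = shift (f w) /\ J *m dsubmx z = lastc (f w)).
- move=> w; have [n hn wE] := f_low w.
  have hXn : supp l ('X *: n) by move=> i li; rewrite mxE hn // mulr0.
  have [z hz] := f_of _ hXn.
  have [v hv] := std_incl_onto ld (supp_low hn).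
  exists (col_mx z v); rewrite col_mxKu col_mxKd -hz low_X wE; by split.
- move=> c w w' z z' [h1 h2] [h1' h2'].
  rewrite !linearP /= !f_lin shift_lin lastc_lin h1 h1' h2 h2'; by split.
- move=> z [h1 h2]; rewrite -[z]vsubmxK.
  have -> : usubmx z = 0 by apply: f_inj; rewrite h1 f0 shift0.
  have -> : dsubmx z = 0 by apply: Jinj; rewrite h2 f0 lastc0 mulmx0.
  by rewrite col_mx0.
(* A pair is lifted by lifting its first component and correcting the second with [fill]; that the
   value at 0 depends on the pair alone is [at0_kill]. *)
have [|||b [hb hb']] := @linear_relation_matrix K (x + l) l
  (fun w z => exists n, [/\ supp l n, low n = f (usubmx w), top n = J *m dsubmx w & J *m z = at0 n]).
- move=> w; have [n hn wE] := f_low (usubmx w).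
  pose v := J *m dsubmx w - top n.
  have hv (i : 'I_d) : (l <= i)%N -> v i 0 = 0.
    by move=> li; rewrite mxE std_incl0 // [(- top n) i 0]mxE (supp_top hn) // subrr.
  have hn' : supp l (1%:P *: fill v + n) by apply: supp_lin => //; apply: supp_fill.
  have [z hz] := std_incl_onto ld (supp_at0 hn').
  exists z, (1%:P *: fill v + n); split=> //.
  + by rewrite low_lin low_fill scaler0 add0r wE.
  + by rewrite top_lin top_fill scale1r /v subrK.
- move=> c w w' z z' [n [h1 h2 h3 h4]] [n' [h1' h2' h3' h4']].
  exists (c%:P *: n + n'); split.
  + exact: supp_lin.
  + by rewrite low_lin linearP /= f_lin h2 h2'.
  + by rewrite top_lin linearP /= mulmxDr -scalemxAr h3 h3'.
  + by rewrite at0_lin mulmxDr -scalemxAr h4 h4'.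
- move=> z [n [h1 h2 h3 h4]]; apply: Jinj; rewrite mulmx0 h4.
  by apply: at0_kill; rewrite ?h2 ?h3 linear0 ?f0 ?mulmx0.
exists (@Level K L d s l x X f a b); split=> //=; first by move=> m; rewrite f_im.
split=> //; split=> [w|w n hn h2 h3].
  by have [n [h1 h2 h3 _]] := hb w; exists n.
have [z hz] := std_incl_onto ld (supp_at0 hn).
by rewrite hz -(hb' w z) //; exists n.
Qed.

Section Level.
Variables (l : nat) (ld : (l <= d)%N) (Y : level L d s l) (hY : level_spec Y).
Let J := std_incl K d l.
Let Jinj v w : J *m v = J *m w -> v = w := @std_incl_inj K d l ld v w.
Let emb_lin c (v w : 'cV[K]_(lv_dim Y)) : lv_emb Y (c *: v + w) = c *: lv_emb Y v + lv_emb Y w.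
Proof. by case: hY. Qed.
Let emb_inj : injective (lv_emb Y). Proof. by case: hY. Qed.
Let emb_im m : (exists w, m = lv_emb Y w) <-> (exists2 n, supp l n & m = low n).
Proof. by case: hY. Qed.
Let emb_rep x (w : 'cV[K]_(lv_dim Y)) : lv_emb Y (lv_rep Y x *m w) = mu x *m lv_emb Y w.
Proof. by case: hY. Qed.
Let emb_a (w : 'cV[K]_(lv_dim Y)) : lv_emb Y (usubmx (lv_a Y *m w)) = shift (lv_emb Y w) /\
         J *m dsubmx (lv_a Y *m w) = lastc (lv_emb Y w).
Proof. by case: hY => _ _ _ _ []. Qed.
Let lift_ex (w : 'cV[K]_(lv_dim Y + l)) : exists n, [/\ supp l n, low n = lv_emb Y (usubmx w) &
         top n = J *m dsubmx w].
Proof. by case: hY => _ _ _ _ [_ []]. Qed.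
Let lift_b (w : 'cV[K]_(lv_dim Y + l)) n : supp l n -> low n = lv_emb Y (usubmx w) ->
         top n = J *m dsubmx w -> J *m (lv_b Y *m w) = at0 n.
Proof. by case: hY => _ _ _ _ [_ [_]]; apply. Qed.
Let emb0 : lv_emb Y 0 = 0.
Proof.
have := emb_lin 1 0 0; rewrite !scale1r addr0 => /esym/eqP.
by rewrite -subr_eq0 addrK => /eqP.
Qed.
Let pair_inj (v w : 'cV[K]_(lv_dim Y + l)) :
  lv_emb Y (usubmx v) = lv_emb Y (usubmx w) -> J *m dsubmx v = J *m dsubmx w -> v = w.
Proof. by move=> /emb_inj h1 /Jinj h2; rewrite -[v]vsubmxK -[w]vsubmxK h1 h2. Qed.
Let Jmu x : mu x *m J = J *m sub_rep mu l x.
Proof. by apply: std_incl_sub_rep => //; case: hmu. Qed.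
Let Jnu x : nu x *m J = J *m sub_rep nu l x.
Proof. by apply: std_incl_sub_rep => //; case: hnu. Qed.
Let dsumE x (w : 'cV[K]_(lv_dim Y + l)) : rep_dsum (lv_rep Y) (sub_rep mu l) x *m w =
  col_mx (lv_rep Y x *m usubmx w) (sub_rep mu l x *m dsubmx w).
Proof.
by rewrite -{1}[w]vsubmxK /rep_dsum mul_block_col !mul0mx addr0 add0r.
Qed.

Lemma level_is_rep : is_rep (lv_rep Y).
Proof.
have [[lin mul one] _] := hmu; split.
- move=> c x y; apply: mulmx_cV_inj => w; apply: emb_inj.
  by rewrite mulmxDl -scalemxAl emb_lin !emb_rep lin mulmxDl -scalemxAl.
- move=> x y; apply: mulmx_cV_inj => w; apply: emb_inj.
  by rewrite -mulmxA !emb_rep mul mulmxA.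
- by apply: mulmx_cV_inj => w; apply: emb_inj; rewrite emb_rep one !mul1mx.
Qed.

(** On polynomial vectors the sequence is multiplication by ['X] followed by evaluation at 0, where
    exactness is evident. *)
Lemma level_exact : short_exact (lv_rep Y) (rep_dsum (lv_rep Y) (sub_rep mu l)) (sub_rep nu l)
  (lv_a Y) (lv_b Y).
Proof.
have shift_mul x m : shift (mu x *m m) = mu x *m shift m.
  apply/matrixP => i [[|k] lk]; rewrite !mxE /= ?mxE.
    by rewrite big1 // => j _; rewrite mxE /= mulr0.
  by apply: eq_bigr => j _; rewrite mxE.
have lastc_mul x m : lastc (mu x *m m) = mu x *m lastc m by rewrite /lastc colE -mulmxA -colE.
split.
- move=> x; apply: mulmx_cV_inj => w; rewrite -!mulmxA; apply: pair_inj.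
    by rewrite dsumE col_mxKu !emb_rep !(proj1 (emb_a _)) emb_rep.
  rewrite dsumE col_mxKd (proj2 (emb_a _)) emb_rep lastc_mul -(proj2 (emb_a _)).
  by rewrite !mulmxA Jmu.
- move=> x; apply: mulmx_cV_inj => w; apply: Jinj.
  have [n [h1 h2 h3]] := lift_ex w.
  rewrite -!mulmxA (lift_b (supp_act x h1)).
  + by rewrite at0_act mulmxA -Jnu -mulmxA (lift_b h1).
  + by rewrite low_act dsumE col_mxKu emb_rep h2.
  + by rewrite top_act dsumE col_mxKd h3 !mulmxA Jmu.
- move=> w aw0; apply: emb_inj; rewrite emb0; have [h1 h2] := emb_a w.
  by apply: shift_inj; rewrite -?h1 -?h2 aw0 linear0 ?emb0 ?mulmx0.
- move=> v; pose n := map_mx polyC (J *m v).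
  have hn : supp l n by move=> i li; rewrite mxE std_incl0.
  have [w hw] : exists w, low n = lv_emb Y w by apply/emb_im; exists n.
  have [v' hv'] := std_incl_onto ld (supp_top hn).
  exists (col_mx w v'); apply: Jinj; rewrite (lift_b hn) ?col_mxKu ?col_mxKd //.
  by apply/colP => i; rewrite mxE [n i 0]mxE coefC.
move=> v; split=> [bv|[w ->]].
  have [n [h1 h2 h3]] := lift_ex v.
  have [n' nE] : exists n', n = 'X *: n'.
    by apply: at0_eq0; rewrite -(lift_b h1 h2 h3) bv mulmx0.
  have hn' : supp l n'.
    move=> i /h1; rewrite nE scaleE => /eqP; rewrite mulf_eq0 polyX_eq0 /= => /eqP; exact.
  have [w hw] : exists w, low n' = lv_emb Y w by apply/emb_im; exists n'.
  exists w; have [e1 e2] := emb_a w; apply: pair_inj.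
    by rewrite e1 -hw -h2 nE low_X.
  by rewrite e2 -hw -h3 nE top_X.
have [n h1 h2] : exists2 n, supp l n & lv_emb Y w = low n by apply/emb_im; exists w.
have [e1 e2] := emb_a w.
apply: Jinj; rewrite mulmx0 (lift_b (n := 'X *: n)) ?at0_X //.
- by move=> i li; rewrite scaleE h1 // mulr0.
- by rewrite low_X e1 h2.
- by rewrite top_X e2 h2.
Qed.

End Level.

Lemma degeneration_sequences :
  exists (x : nat -> nat) (X : forall l, L -> 'M[K]_(x l))
         (h : forall l, 'M[K]_(x l.+1, x l))
         (a : forall l, 'M[K]_(x l + l, x l))
         (b : forall l, 'M[K]_(l, x l + l)),
    [/\ forall l, (1 <= l <= d)%N -> is_rep (X l),
        forall l, (1 <= l < d)%N -> is_hom (X l) (X l.+1) (h l),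
        forall l, (1 <= l <= d)%N ->
          short_exact (X l) (rep_dsum (X l) (sub_rep mu l)) (sub_rep nu l) (a l) (b l),
        forall l, (1 <= l < d)%N ->
          block_mx (h l) 0 0 (incl_mx K l) *m a l = a l.+1 *m h l &
        forall l, (1 <= l < d)%N ->
          incl_mx K l *m b l = b l.+1 *m block_mx (h l) 0 0 (incl_mx K l)].
Proof.
(* The families are indexed by all natural numbers; beyond [d] a zero module serves as default. *)
have pack l : {Y : level L d s l | (l <= d)%N -> level_spec Y}.
  apply: boolp.cid; have [ld|ld] := leqP l d.
    by have [Y hY] := level_exists ld; exists Y.
  by exists (@Level K L d s l 0 (fun=> 0) (fun=> 0) 0 0).
pose Y l := sval (pack l).
have hY l : (l <= d)%N -> level_spec (Y l) by exact: svalP (pack l).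
(* All [X_l] are embedded in the same matrix space, and a vector supported on [l] coordinates is
   also supported on [l.+1]; [h_l] is the resulting inclusion. *)
have hpack l : {h : 'M[K]_(lv_dim (Y l.+1), lv_dim (Y l)) | (l < d)%N ->
    forall w : 'cV_(lv_dim (Y l)), lv_emb (Y l.+1) (h *m w) = lv_emb (Y l) w}.
  apply: boolp.cid; have [ld|ld] := ltnP l d; last by exists 0.
  have [lin1 inj1 im1 _ _] := hY l.+1 ld.
  have [lin0 inj0 im0 _ _] := hY l (ltnW ld).
  have emb00 : lv_emb (Y l) 0 = 0.
    have := lin0 1 0 0; rewrite !scale1r addr0 => /esym/eqP.
    by rewrite -subr_eq0 addrK => /eqP.
  have emb10 : lv_emb (Y l.+1) 0 = 0.
    have := lin1 1 0 0; rewrite !scale1r addr0 => /esym/eqP.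
    by rewrite -subr_eq0 addrK => /eqP.
  have [|||h [hh _]] := @linear_relation_matrix K _ _
      (fun (w : 'cV_(lv_dim (Y l))) (z : 'cV_(lv_dim (Y l.+1))) => lv_emb (Y l.+1) z = lv_emb (Y l) w).
  - move=> w; have [n hn wE] : exists2 n, supp l n & lv_emb (Y l) w = low n.
      by apply/im0; exists w.
    have [z hz] : exists z, low n = lv_emb (Y l.+1) z.
      by apply/im1; exists n => // i li; apply: hn; apply: ltnW.
    by exists z; rewrite wE hz.
  - by move=> c w w' z z' e1 e2; rewrite lin0 lin1 e1 e2.
  - by move=> z; rewrite emb00 -emb10 => /inj1.
  by exists h.
pose h l := sval (hpack l).
have hh l : (l < d)%N -> forall w : 'cV_(lv_dim (Y l)), lv_emb (Y l.+1) (h l *m w) = lv_emb (Y l) w.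
  exact: svalP (hpack l).
exists (fun l => lv_dim (Y l)), (fun l => @lv_rep K L d s l (Y l)), h,
  (fun l => @lv_a K L d s l (Y l)), (fun l => @lv_b K L d s l (Y l)).
split.
- by move=> l /andP[_ ld]; apply: (level_is_rep (hY l ld)).
- move=> l /andP[_ ld] x; apply: mulmx_cV_inj => w.
  have [_ inj1 _ rep1 _] := hY l.+1 ld; have [_ _ _ rep0 _] := hY l (ltnW ld).
  by apply: inj1; rewrite -!mulmxA hh // rep0 rep1 hh.
- by move=> l /andP[_ ld]; apply: (level_exact ld (hY l ld)).
- move=> l /andP[_ ld]; apply: mulmx_cV_inj => w; rewrite -!mulmxA.
  have [_ inj1 _ _ [a1 _]] := hY l.+1 ld; have [_ _ _ _ [a0 _]] := hY l (ltnW ld).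
  rewrite -[lv_a (Y l) *m w]vsubmxK mul_block_col !mul0mx addr0 add0r.
  rewrite -[RHS]vsubmxK; congr col_mx.
    by apply: inj1; rewrite hh // (proj1 (a0 w)) (proj1 (a1 _)) hh.
  apply: (std_incl_inj ld); rewrite mulmxA std_incl_incl //.
  by rewrite (proj2 (a0 w)) (proj2 (a1 _)) hh.
- move=> l /andP[_ ld]; apply: mulmx_cV_inj => w; rewrite -!mulmxA.
  have [_ _ _ _ [_ [_ b1]]] := hY l.+1 ld; have [_ _ _ _ [_ [ex0 b0]]] := hY l (ltnW ld).
  have [n [h1 h2 h3]] := ex0 w.
  apply: (std_incl_inj ld); rewrite mulmxA std_incl_incl // (b0 w n) //.
  rewrite -[w in RHS]vsubmxK mul_block_col !mul0mx addr0 add0r (b1 _ n) //.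
  + by move=> i li; apply: h1; apply: ltnW.
  + by rewrite col_mxKu hh.
  + by rewrite col_mxKd mulmxA std_incl_incl.
Qed.

End Zwara.

Lemma unitmx_inj (K : fieldType) n (A : 'M[K]_n) :
  (forall w : 'cV_n, A *m w = 0 -> w = 0) -> A \in unitmx.
Proof.
move=> h; rewrite unitmxE unitfE -det_tr; apply/det0P => -[v v0 vA].
move/eqP: v0; apply; rewrite -[v]trmxK (h v^T) ?trmx0 //.
by rewrite -[A]trmxK -trmx_mul vA trmx0.
Qed.

Lemma col_mul (R : pzSemiRingType) m n p (A : 'M[R]_(m, n)) (B : 'M[R]_(n, p)) j :
  col j (A *m B) = A *m col j B.
Proof. by rewrite !colE mulmxA. Qed.

(** * From exact sequences to degenerations *)

Section Normalizer.
Variables (K : fieldType) (L : falgType K) (n d : nat) (e : 'I_n -> L) (c : 'I_d -> 'I_n).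

Lemma upper_tri_invmx (g : 'M[K]_d) : Ud g -> upper_tri (invmx g).
Proof.
move=> [ug gu]; apply: (upper_inverse ug) (mulmxV gu).
by rewrite -unitfE -unitmxE.
Qed.

Lemma conj_act_Tc (g : 'M[K]_d) (mu : L -> 'M[K]_d) : Ud g ->
  (forall i, g *m Amx K c i = Amx K c i *m g) -> Tc e c mu -> Tc e c (conj_act g mu).
Proof.
move=> [ug gu] gA [[[lin mul one] um] mue]; split; first split; first split.
- by move=> a x y; rewrite /conj_act lin mulmxDr mulmxDl -scalemxAr -scalemxAl.
- by move=> x y; rewrite /conj_act mul !mulmxA mulmxKV.
- by rewrite /conj_act one mulmx1 mulmxV.
- move=> x; apply: upper_mulmx; first by apply: upper_mulmx => //; apply: um.
  exact: upper_tri_invmx.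
- by move=> i; rewrite /conj_act mue gA mulmxK.
Qed.

Lemma normalizer_of_commute (g : 'M[K]_d) : Ud g ->
  (forall i, g *m Amx K c i = Amx K c i *m g) -> normalizer_Tc e c g.
Proof.
move=> Ug gA; have [ug gu] := Ug; split=> //.
  by move=> mu; apply: conj_act_Tc.
move=> nu hnu; exists (conj_act (invmx g) nu).
  apply: conj_act_Tc => //; first by split; [apply: upper_tri_invmx|rewrite unitmx_inv].
  by move=> i; rewrite -[RHS](mulKmx gu) (mulmxA g) gA -(mulmxA _ g) mulmxV // mulmx1.
by move=> x; rewrite /conj_act invmxK !mulmxA mulmxV // mul1mx mulmxK.
Qed.

End Normalizer.

Lemma AmxE (K : fieldType) (n d : nat) (c : 'I_d -> 'I_n) i (v : 'cV[K]_d) k :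
  (Amx K c i *m v) k 0 = (c k == i)%:R * v k 0.
Proof.
rewrite mxE (bigD1 k) //= mxE eqxx big1 ?addr0 // => l lk.
by rewrite mxE eq_sym (negbTE lk) mul0r.
Qed.

Section Riedtmann.
Variables (K : closedFieldType) (L : falgType K) (n d : nat) (e : 'I_n -> L) (c : 'I_d -> 'I_n).
Variables (mu nu : L -> 'M[K]_d).
Hypothesis hmu : Tc e c mu.
Hypothesis hnu : Tc e c nu.
Hypothesis d0 : (0 < d)%N.
Variables (x : nat -> nat) (X : forall l, L -> 'M[K]_(x l)) (h : forall l, 'M[K]_(x l.+1, x l))
  (a : forall l, 'M[K]_(x l + l, x l)) (b : forall l, 'M[K]_(l, x l + l)).
Hypothesis hX : forall l, (1 <= l < d)%N -> is_hom (X l) (X l.+1) (h l).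
Hypothesis hex : forall l, (1 <= l <= d)%N ->
  short_exact (X l) (rep_dsum (X l) (sub_rep mu l)) (sub_rep nu l) (a l) (b l).
Hypothesis ha : forall l, (1 <= l < d)%N -> block_mx (h l) 0 0 (incl_mx K l) *m a l = a l.+1 *m h l.
Hypothesis hb : forall l, (1 <= l < d)%N ->
  incl_mx K l *m b l = b l.+1 *m block_mx (h l) 0 0 (incl_mx K l).

Local Notation J l := (std_incl K d l).
Local Notation dsum l := (rep_dsum (X l) (sub_rep mu l)).

Let um y : upper_tri (mu y). Proof. by case: hmu => [[]]. Qed.
Let un y : upper_tri (nu y). Proof. by case: hnu => [[]]. Qed.

Let std_incl_id : J d = 1%:M.
Proof. by apply/matrixP => i j; rewrite !mxE. Qed.

Let sub_rep_id (rho : L -> 'M[K]_d) y : upper_tri (rho y) -> sub_rep rho d y = rho y.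
Proof.
by move=> /(std_incl_sub_rep (leqnn d)); rewrite std_incl_id mulmx1 mul1mx.
Qed.

(** Downward induction on [l] composes the commuting squares from level [l] up to level [d]. *)
Let push l : (1 <= l <= d)%N -> exists H : 'M[K]_(x d, x l),
  [/\ block_mx H 0 0 (J l) *m a l = a d *m H, J l *m b l = b d *m block_mx H 0 0 (J l) &
      is_hom (X l) (X d) H].
Proof.
move=> /andP[l0 ld]; have [m ml] := ubnP (d - l)%N.
elim: m l ml l0 ld => // m IH l ml l0; rewrite leq_eqVlt => /orP[/eqP ->|ld].
  exists 1%:M; rewrite std_incl_id -scalar_mx_block !mul1mx !mulmx1; split=> // y.
  by rewrite mul1mx mulmx1.
have [|H [h1 h2 h3]] := IH l.+1 _ isT ld.
  by rewrite -ltnS; apply: leq_trans ml; rewrite ltnS ltn_sub2l.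
have l0d : (1 <= l < d)%N by rewrite l0.
have bE : block_mx (H *m h l) 0 0 (J l) = block_mx H 0 0 (J l.+1) *m block_mx (h l) 0 0 (incl_mx K l).
  by rewrite mulmx_block !mul0mx !mulmx0 !addr0 add0r std_incl_incl.
exists (H *m h l); split.
- by rewrite bE -mulmxA ha // mulmxA h1 mulmxA.
- by rewrite bE mulmxA -h2 -mulmxA -hb // mulmxA std_incl_incl.
- by move=> y; rewrite -mulmxA hX // mulmxA h3 mulmxA.
Qed.

Let one0 l : 'M[K]_(x l + l, x l) := col_mx 1%:M 0.
Let at_ l (t : K) := a l + t *: one0 l.

Let at_hom l t y : (1 <= l <= d)%N -> dsum l y *m at_ l t = at_ l t *m X l y.
Proof.
move=> /hex[hom _ _ _ _]; rewrite mulmxDr mulmxDl -hom -scalemxAr -scalemxAl; congr (_ + _ *: _).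
by rewrite /one0 /rep_dsum mul_block_col mul_col_mx !mulmx1 !mulmx0 mul0mx mul1mx !addr0.
Qed.

Let at_push l (H : 'M[K]_(x d, x l)) t : block_mx H 0 0 (J l) *m a l = a d *m H ->
  block_mx H 0 0 (J l) *m at_ l t = at_ d t *m H.
Proof.
move=> e1; rewrite mulmxDr mulmxDl e1 -scalemxAr -scalemxAl; congr (_ + _ *: _).
by rewrite /one0 mul_block_col mul_col_mx !mulmx1 !mulmx0 !mul0mx mul1mx !addr0.
Qed.

(* Lifts of the unit vectors of [N_d], taken in [X_l + M_l] with [l] minimal and in
   the image of the idempotent, so that [G] below is upper triangular and commutes with
   the idempotents. *)
Let lift_exists (j : 'I_d) : exists (H : 'M[K]_(x d, x j.+1)) (v : 'cV[K]_(x j.+1 + j.+1)),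
  [/\ block_mx H 0 0 (J j.+1) *m a j.+1 = a d *m H, is_hom (X j.+1) (X d) H &
      b d *m (block_mx H 0 0 (J j.+1) *m (dsum j.+1 (e (c j)) *m v)) = delta_mx j 0].
Proof.
have jd : (1 <= j.+1 <= d)%N by rewrite ltn_ord.
have [H [h1 h2 h3]] := push jd; have [_ bhom _ bsurj _] := hex jd.
have [v hv] := bsurj (delta_mx ord_max 0).
exists H, v; split=> //.
rewrite mulmxA -h2 -mulmxA (mulmxA (b _)) bhom -mulmxA hv mulmxA.
rewrite -std_incl_sub_rep ?ltn_ord // -mulmxA.
have -> : J j.+1 *m delta_mx ord_max 0 = delta_mx j 0 :> 'cV[K]_d.
  apply/colP => i; have [ij|ij] := leqP j.+1 i.
    by rewrite std_incl0 // mxE eqxx andbT -val_eqE /= gtn_eqF.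
  rewrite (@std_inclE K d j.+1 _ i (Ordinal ij)) // !mxE eqxx !andbT -!val_eqE /=; by [].
have [_ ->] := hnu; apply/colP => i; rewrite AmxE !mxE eqxx andbT.
by case: (eqVneq i j) => [->|_]; rewrite ?mulr0 // eqxx mulr1.
Qed.

Let sigma_exists : exists (H : forall j : 'I_d, 'M[K]_(x d, x j.+1))
    (v : forall j : 'I_d, 'cV[K]_(x j.+1 + j.+1)), forall j,
  [/\ block_mx (H j) 0 0 (J j.+1) *m a j.+1 = a d *m H j, is_hom (X j.+1) (X d) (H j) &
      b d *m (block_mx (H j) 0 0 (J j.+1) *m (dsum j.+1 (e (c j)) *m v j)) = delta_mx j 0].
Proof.
have pk j : {Hv : 'M[K]_(x d, x (j : 'I_d).+1) * 'cV[K]_(x j.+1 + j.+1) |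
  [/\ block_mx Hv.1 0 0 (J j.+1) *m a j.+1 = a d *m Hv.1, is_hom (X j.+1) (X d) Hv.1 &
      b d *m (block_mx Hv.1 0 0 (J j.+1) *m (dsum j.+1 (e (c j)) *m Hv.2)) = delta_mx j 0]}.
  by apply: boolp.cid; have [H [v hv]] := lift_exists j; exists (H, v).
by exists (fun j => (sval (pk j)).1), (fun j => (sval (pk j)).2) => j; apply: (svalP (pk j)).
Qed.

Lemma closure_of_sequences : zariski_closure (orbit_N e c mu) nu.
Proof.
have [H [v hHv]] := sigma_exists.
have dd : (1 <= d <= d)%N by rewrite d0 leqnn.
have [ahom bhom ainj bsurj exact_] := hex dd.
pose sig : 'M[K]_(x d + d, d) := \matrix_(k, j)
  (block_mx (H j) 0 0 (J j.+1) *m (dsum j.+1 (e (c j)) *m v j)) k 0.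
have sigE j : col j sig = block_mx (H j) 0 0 (J j.+1) *m (dsum j.+1 (e (c j)) *m v j).
  by apply/colP => k; rewrite !mxE.
have bsig : b d *m sig = 1%:M.
  apply/matrixP => i j; have [_ _ e1] := hHv j.
  have := congr1 (fun w : 'cV_d => w i 0) e1; rewrite -sigE -col_mul !mxE andbT => ->.
  by [].
(* The image of [at_ d t] next to the section [sig] of [b d]. At [t = 0] exactness makes this square
   matrix invertible, hence [del.[0] != 0] below. *)
pose P t := row_mx (at_ d t) sig.
pose Pp : 'M[{poly K}]_(x d + d) :=
  row_mx (map_mx polyC (a d) + 'X *: col_mx 1%:M 0) (map_mx polyC sig).
have PpE t : map_mx (horner_eval t) Pp = P t.
  rewrite /Pp /P map_row_mx map_mxD map_mxZ map_col_mx map_mx0 map_scalar_mx.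
  have h1 : (1 : {poly K}).[t] = 1 by rewrite -polyC1 hornerC.
  rewrite /= {2 3}/horner_eval hornerX h1 /at_ /one0; congr row_mx; first congr (_ + _).
  - by apply/matrixP => k l; rewrite !mxE /horner_eval hornerC.
  - by apply/matrixP => k l; rewrite !mxE /horner_eval hornerC.
pose del := \det Pp.
have delE t : del.[t] = \det (P t) by rewrite -PpE -[del.[t]]/(horner_eval t del) -det_map_mx.
have del0 : del.[0] != 0.
  rewrite delE -unitfE -unitmxE; apply: unitmx_inj => w.
  rewrite -[w]vsubmxK /P mul_row_col /at_ scale0r addr0 => e1.
  have bz : b d *m a d = 0.
    apply: mulmx_cV_inj => y; rewrite mul0mx -mulmxA; apply/exact_; by exists y.
  have z0 : dsubmx w = 0.
    move: e1 => /(congr1 (mulmx (b d))).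
    by rewrite mulmxDr !mulmxA bz mul0mx add0r bsig mul1mx mulmx0.
  move: e1; rewrite z0 mulmx0 addr0 => /ainj ->; by rewrite col_mx0.
(* The section need not be a homomorphism; its defect lies in the kernel of [b d], which is the
   image of [a d]. *)
have lift_w y : exists wy : 'M[K]_(x d, d), dsum d y *m sig = sig *m nu y + a d *m wy.
  have col_ex j : exists z : 'cV_(x d), col j (dsum d y *m sig - sig *m nu y) = a d *m z.
    apply/exact_; rewrite -col_mul mulmxBr !mulmxA bhom bsig mul1mx -mulmxA bsig mulmx1.
    by rewrite sub_rep_id // subrr; apply/colP => k; rewrite !mxE.
  have [z hz] := boolp.choice col_ex.
  exists (\matrix_(k, j) z j k 0).
  apply/eqP; rewrite addrC -subr_eq; apply/eqP/matrixP => k j.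
  have := congr1 (fun w : 'cV_(x d + d) => w k 0) (hz j); rewrite mxE => ->.
  by rewrite !mxE; apply: eq_bigr => l _; rewrite mxE.
have [w hw] := boolp.choice lift_w.
pose phi l : 'M[K]_(x l) := usubmx (a l).
pose psi l : 'M[K]_(l, x l) := dsubmx (a l).
have atE l t : at_ l t = col_mx (phi l + t%:M) (psi l).
  rewrite /at_ /one0 -{1}[a l]vsubmxK scale_col_mx scaler0 add_col_mx addr0.
  by rewrite scalemx1.
(* Off the zeros of [bad], [P t] is invertible and so is the upper block [phi l + t] of each
   [at_ l t]; then every vector of [X_l + M_l] is congruent to one of [M_l] modulo the image of
   [at_ l t]. *)
pose bad := del * \prod_(l < d) char_poly (- phi l.+1).
have bad0 : bad != 0.
  rewrite mulf_neq0 //; first by apply: contraNneq del0 => ->; rewrite horner0.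
  by apply/prodf_neq0 => l _; apply: monic_neq0; apply: char_poly_monic.
have badP t : bad.[t] != 0 -> del.[t] != 0 /\ forall j : 'I_d, phi j.+1 + t%:M \in unitmx.
  rewrite hornerM mulf_eq0 negb_or => /andP[dt pt]; split=> // j.
  move: pt; rewrite horner_prod => /prodf_neq0/(_ j isT); rewrite unitmxE unitfE.
  rewrite /char_poly -[_.[t]]/(horner_eval t _) -det_map_mx /char_poly_mx.
  rewrite map_mxB map_scalar_mx /= /horner_eval hornerX.
  have -> : map_mx (horner_eval t) (map_mx polyC (- phi j.+1)) = - phi j.+1.
    by apply/matrixP => k l; rewrite !mxE /horner_eval hornerC.
  by rewrite opprK addrC.
pose low (A : 'M[K]_(x d + d)) : 'M[K]_(d, x d) := lsubmx (dsubmx A).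
(* The action on the cokernel of [at_ d t] in the basis [sig]: substitute
   [a d = at_ d t - t *: one0 d] into [hw]. At [t = 0] it is [nu]. *)
pose mut t y := nu y - t *: (low (invmx (P t)) *m w y).
have mutE t y i j : mut t y i j = nu y i j - t * (low (invmx (P t)) *m w y) i j.
  by rewrite /mut; move: (low _ *m _) => Z; rewrite !mxE.
have inorbit t : bad.[t] != 0 -> orbit_N e c mu (mut t).
  move=> /badP[dt pt].
  have Pu : P t \in unitmx by rewrite unitmxE unitfE -delE.
  (* [R] is the projection onto the cokernel of [at_ d t] in the basis [sig], and [V] its
     restriction to [M_d], the wanted conjugating matrix. *)
  pose R := dsubmx (invmx (P t)); pose U := lsubmx R; pose V := rsubmx R.
  have RUV : R = row_mx U V by rewrite /U /V hsubmxK.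
  have RP : R *m P t = row_mx 0 1%:M.
    rewrite /R mul_dsub_mx mulVmx // scalar_mx_block.
    by rewrite /block_mx col_mxKd.
  have [Ra Rs] : R *m at_ d t = 0 /\ R *m sig = 1%:M.
    by move: RP; rewrite /P mul_mx_row => /eq_row_mx.
  have R0 m : R *m col_mx 0 m = V *m m by rewrite RUV mul_row_col mulmx0 add0r.
  have R1 : R *m one0 d = U by rewrite RUV /one0 mul_row_col mulmx1 mulmx0 addr0.
  have solve (j : 'I_d) : exists m : 'cV[K]_j.+1, exists y : 'cV[K]_(x j.+1),
      v j = at_ j.+1 t *m y + col_mx 0 m.
    exists (dsubmx (v j) - psi j.+1 *m (invmx (phi j.+1 + t%:M) *m usubmx (v j))).
    exists (invmx (phi j.+1 + t%:M) *m usubmx (v j)).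
    rewrite atE mul_col_mx (mulKVmx (pt j)) add_col_mx addr0 addrC subrK.
    by rewrite vsubmxK.
  (* The lift of the unit vector [j] is reduced to [M_(j+1)] inside level [j.+1], which gives the
     triangular shape; applying the idempotent [e (c j)] leaves only the coordinates of the same
     colour. These vectors are the columns of the inverse of [V]. *)
  have colG (j : 'I_d) : exists g : 'cV[K]_d, [/\ V *m g = delta_mx j 0,
      forall i : 'I_d, (j < i)%N -> g i 0 = 0 & forall i, c i != c j -> g i 0 = 0].
    have [m [y vE]] := solve j; have [h1 h2 h3] := hHv j.
    pose m' := sub_rep mu j.+1 (e (c j)) *m m.
    have dv : dsum j.+1 (e (c j)) *m v j = at_ j.+1 t *m (X j.+1 (e (c j)) *m y) + col_mx 0 m'.
      rewrite vE mulmxDr [in LHS]mulmxA at_hom ?ltn_ord // -mulmxA; congr (_ + _).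
      by rewrite /rep_dsum mul_block_col !mulmx0 !mul0mx addr0 add0r.
    exists (J j.+1 *m m'); split.
    - have -> : delta_mx j 0 = R *m col j sig :> 'cV[K]_d.
        by rewrite -col_mul Rs; apply/colP => k; rewrite !mxE eqxx andbT.
      rewrite sigE dv mulmxDr mulmxA (at_push t h1) mulmxDr -!mulmxA (mulmxA R (at_ d t)) Ra mul0mx add0r.
      by rewrite mul_block_col mulmx0 !mul0mx !add0r R0.
    - by move=> i ji; rewrite std_incl0.
    - move=> i ci; rewrite /m' mulmxA -std_incl_sub_rep // -mulmxA; have [_ ->] := hmu.
      by rewrite AmxE (negbTE ci) mul0r.
  have [g hg] := boolp.choice colG.
  pose G : 'M[K]_d := \matrix_(k, j) g j k 0.
  have VG : V *m G = 1%:M.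
    apply/matrixP => k j; have [e1 _ _] := hg j.
    have e1k : (V *m g j) k 0 = (k == j)%:R by rewrite e1 mxE eqxx andbT.
    by rewrite [RHS]mxE -e1k [LHS]mxE [RHS]mxE; apply: eq_bigr => l _; rewrite [G l j]mxE.
  have [Vu Gu] := mulmx1_unit VG.
  have uG : Ud G by split=> // i j ji; rewrite mxE; have [_ gj _] := hg j; apply: gj.
  have VE : V = invmx G by rewrite -[V]mulmx1 -(mulmxV Gu) mulmxA VG mul1mx.
  have UV : Ud V by split=> //; rewrite VE; apply: upper_tri_invmx.
  have GA i : G *m Amx K c i = Amx K c i *m G.
    apply/matrixP => k j.
    have -> : (G *m Amx K c i) k j = G k j * (c j == i)%:R.
      rewrite mxE (bigD1 j) //= [Amx _ _ _ _ _]mxE eqxx big1 ?addr0 // => l lj.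
      by rewrite [Amx _ _ _ _ _]mxE (negbTE lj) mulr0.
    have -> : (Amx K c i *m G) k j = (c k == i)%:R * G k j.
      rewrite mxE (bigD1 k) //= [Amx _ _ _ _ _]mxE eqxx big1 ?addr0 // => l lk.
      by rewrite [Amx _ _ _ _ _]mxE eq_sym (negbTE lk) mul0r.
    rewrite [G k j]mxE; have [_ _ gc] := hg j.
    have [ckj|/gc ->] := eqVneq (c k) (c j); last by rewrite mulr0 mul0r.
    by rewrite ckj mulrC.
  have VA i : V *m Amx K c i = Amx K c i *m V.
    have GV : G *m V = 1%:M by apply: mulmx1C.
    by rewrite -[LHS]mulmx1 -GV mulmxA -(mulmxA V) -GA mulmxA VG mul1mx.
  exists V; first exact: normalizer_of_commute.
  have RX y : R *m dsum d y = mut t y *m R.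
    apply: (can_inj (mulmxK Pu)); rewrite -!mulmxA /P !mul_mx_row at_hom //.
    have Ra0 : R *m a d = - (t *: U).
      have -> : a d = at_ d t - t *: one0 d by rewrite /at_ addrK.
      by rewrite mulmxBr Ra sub0r -scalemxAr R1.
    rewrite (mulmxA R (at_ d t)) Ra mul0mx Rs hw mulmxDr !mulmxA Rs mul1mx Ra0 mulmx1 mulmx0.
    by rewrite /mut mulNmx -scalemxAl.
  move=> y; have := congr1 (fun A => A *m col_mx 0 1%:M) (RX y).
  rewrite -!mulmxA R0 mulmx1 /rep_dsum mul_block_col !mulmx0 mul0mx addr0 add0r mulmx1.
  by rewrite sub_rep_id // R0 /conj_act => ->; rewrite mulmxK.
move=> p hp.
pose num (k : 'I_#|{: coord_index L d}|) : {poly K} := let: (r, i, j) := enum_val k in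
  (nu (tnth (vbasis fullv) r) i j)%:P * del -
  'X * (lsubmx (dsubmx (\adj Pp)) *m map_mx polyC (w (tnth (vbasis fullv) r))) i j.
have numE t k : del.[t] != 0 -> (num k).[t] / del.[t] = coords (mut t) k.
  move=> dt; rewrite /num /coords; case: (enum_val k) => [[r i] j].
  have Pu : P t \in unitmx by rewrite unitmxE unitfE -delE.
  rewrite mutE !hornerE mulrBl mulfK //; congr (_ - _).
  rewrite -mulrA; congr (_ * _); set y := tnth _ r.
  have -> : ((lsubmx (dsubmx (\adj Pp)) *m map_mx polyC (w y)) i j).[t] =
      (low (\adj (P t)) *m w y) i j.
    rewrite -PpE -map_mx_adj /low -map_dsubmx -map_lsubmx.
    rewrite !mxE -[LHS]/(horner_eval t _) rmorph_sum; apply: eq_bigr => l _.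
    by rewrite rmorphM !mxE /= /horner_eval hornerC.
  have -> : low (invmx (P t)) = del.[t]^-1 *: low (\adj (P t)).
    by rewrite /invmx Pu -delE /low !linearZ.
  by rewrite -scalemxAl [RHS]mxE mulrC.
have [m [hh hhE]] := mmap_common_denominator (@polyC K) num del p.
have hhE' t : del.[t] != 0 -> hh.[t] = del.[t] ^+ m * p.@[coords (mut t)].
  move=> dt; rewrite -[LHS]/(horner_eval t hh) (hhE K (horner_eval t) dt); congr (_ * _).
  apply: eq_bigr => z _; congr (_ * _); first by rewrite /= /horner_eval hornerC.
  by apply: mmap1_eq => k; rewrite -numE.
(* The factor [bad] excludes the finitely many exceptional [t], among which 0 may be. Once [hh] is
   known to be the zero polynomial, evaluation at 0 only uses [del.[0] != 0]. *)
have hh0 : hh * bad = 0.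
  apply/eqP; apply: contraT => /(@poly_nonroot K K idfun)[t /=].
  rewrite hornerM mulf_eq0 negb_or => /andP[ht bt].
  have [dt _] := badP _ bt.
  by move: ht; rewrite hhE' // hp ?mulr0 ?eqxx //; apply: inorbit.
move/eqP: hh0; rewrite mulf_eq0 (negbTE bad0) orbF => /eqP hh0.
move: (hhE' 0 del0); rewrite hh0 horner0 => /esym/eqP.
rewrite mulf_eq0 expf_eq0 (negbTE del0) andbF /= => /eqP <-.
apply: meval_eq => k; rewrite /coords; case: (enum_val k) => [[r i] j].
by rewrite /mut scale0r subr0.
Qed.

End Riedtmann.

Lemma zariski_closure_self (K : fieldType) (L : falgType K) (d : nat)
    (S : (L -> 'M[K]_d) -> Prop) (mu nu : L -> 'M[K]_d) :
  S mu -> nu =1 mu -> zariski_closure S nu.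
Proof.
move=> Smu e p hp; rewrite -(hp _ Smu); apply: meval_eq => k.
by rewrite /coords; case: (enum_val k) => [[r i] j]; rewrite e.
Qed.

Theorem theorem4p6 (K : closedFieldType) (L : falgType K) (n : nat)
    (e : 'I_n -> L) (he : basic_idempotents e)
    (d : nat) (c : 'I_d -> 'I_n) (mu nu : L -> 'M[K]_d)
    (hmu : Tc e c mu) (hnu : Tc e c nu) :
  zariski_closure (orbit_N e c mu) nu <->
  exists (x : nat -> nat) (X : forall l, L -> 'M[K]_(x l))
         (h : forall l, 'M[K]_(x l.+1, x l))
         (a : forall l, 'M[K]_(x l + l, x l))
         (b : forall l, 'M[K]_(l, x l + l)),
    [/\ forall l, (1 <= l <= d)%N -> is_rep (X l),
        forall l, (1 <= l < d)%N -> is_hom (X l) (X l.+1) (h l),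
        forall l, (1 <= l <= d)%N ->
          short_exact (X l) (rep_dsum (X l) (sub_rep mu l)) (sub_rep nu l) (a l) (b l),
        forall l, (1 <= l < d)%N ->
          block_mx (h l) 0 0 (incl_mx K l) *m a l = a l.+1 *m h l &
        forall l, (1 <= l < d)%N ->
          incl_mx K l *m b l = b l.+1 *m block_mx (h l) 0 0 (incl_mx K l)].
Proof.
have [tmu _] := hmu; have [tnu _] := hnu.
have [[mu_lin _ _] _] := tmu; have [[nu_lin _ _] _] := tnu.
split=> [cl|[x [X [h [a [b [_ hX hex ha hb]]]]]]].
  (* The normalizer lies in [Ud], so [nu] is also in the closure of the [Ud]-orbit, which the
     generic triangular matrix parametrizes. *)
  have [|g [k [u [W [ug dg u0 gW W0]]]]] :=
      @polynomial_degeneration_exists K L d mu nu mu_lin nu_lin.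
    move=> p hp; apply: cl => nu' [g [Ug _ _] nuE]; apply: hp.
    by exists g.
  (* The exponent [k.+2] is [s.+1] for [s = k.+1]. *)
  have [us [r usE]] := poly_inverse_mod k.+2 u0.
  exact: (degeneration_sequences tmu tnu ug dg u0 gW W0 usE).
(* The argument starts from the sequence at level [d], which is given only for positive [d]; for
   [d = 0] all matrices are empty and [nu] equals [mu]. *)
have [d0|d0] := posnP d; last exact: (closure_of_sequences hmu hnu d0 hX hex ha hb).
apply: (zariski_closure_self (mu := mu)).
  exists 1%:M; last by move=> y; rewrite /conj_act mul1mx invmx1 mulmx1.
  apply: normalizer_of_commute; last by move=> i; rewrite mul1mx mulmx1.
  split; last exact: unitmx1.
  by move=> i j; have := ltn_ord i; rewrite {2}d0.
by move=> y; apply/matrixP => i; have := ltn_ord i; rewrite {2}d0.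
Qed.
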